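(* Let $k$ be an algebraically closed field and let $\Lambda=k\langle\alpha,\beta\rangle/(\alpha^2,\ \alpha\beta+\beta\alpha,\ \beta^2)$ be the exterior algebra in two variables over $k$. For $n\in\mathbb Z$ let $M_n=\Lambda\oplus S_n\oplus S_{n+1}$, where $(S_n)_{n\in\mathbb Z}$ is the family of indecomposable $\Lambda$-modules defined in the context. Then $M_n$ is a minimal Auslander generator of $\Lambda$ for all $n\in\mathbb Z$.
   Context: All modules are finitely generated left modules. For a module $M$ over an artin algebra $A$, $\operatorname{add}M$ is the full subcategory of $\operatorname{mod}A$ consisting of direct summands of finite direct sums of copies of $M$. $M$ is a generator-cogenerator if all indecomposable projective and all indecomposable injective $A$-modules are in $\operatorname{add}M$. The representation dimension is $\operatorname{repdim}A=\inf\{\operatorname{gldim}\operatorname{End}_A(M)\mid M \text{ a generator-cogenerator for } \operatorname{mod}A\}$. An Auslander generator of $A$ is a basic generator-cogenerator $M$ (basic: its indecomposable direct summands are pairwise non-isomorphic) with $\operatorname{gldim}\operatorname{End}_A(M)=\operatorname{repdim}A$. An Auslander generator $M$ is minimal if for every nonzero direct summand $N$ of $M$ having no nonzero projective or injective direct summand, $\operatorname{gldim}\operatorname{End}_A(M/N)>\operatorname{gldim}\operatorname{End}_A(M)$, where $M/N$ is the cokernel of the split monomorphism $N\hookrightarrow M$. The modules $S_n$: $\Lambda$ is local and selfinjective; let $S$ be its unique simple module, let $\tau$ be the Auslander-Reiten translation and $\tau^{-1}=\operatorname{TrD}$ (for negative $m$, $\operatorname{TrD}^m$ means $\tau^{|m|}$).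 For $m\in\mathbb Z$ set $S_{2m}=(\operatorname{TrD})^m S$ and $S_{2m+1}=(\operatorname{TrD})^m(\Lambda/\operatorname{Soc}\Lambda)$. In particular $S_0=S$, $S_1=\Lambda/\operatorname{Soc}\Lambda$, $S_{-1}=\operatorname{rad}\Lambda$. Explicitly, up to isomorphism, for $n>0$ the module $S_n$ is $k^{2n+1}=k^n\oplus k^{n+1}$, with $\alpha$ and $\beta$ acting on column vectors by $g_\alpha=\begin{pmatrix}0_n&0\\ I_n&0\\ 0_{1\times n}&0\end{pmatrix}$ and $g_\beta=\begin{pmatrix}0_n&0\\ 0_{1\times n}&0\\ I_n&0\end{pmatrix}$ (the second block column has width $n+1$); for $n<0$ the module $S_n$ is $k^{2|n|+1}$ with $\alpha,\beta$ acting by the transposes of the matrices $g_\alpha,g_\beta$ for $|n|$. *)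

(* Defs.v *)
From HB Require Import structures.
From mathcomp Require Import all_boot all_order all_algebra.
From mathcomp Require Import boolp classical_sets constructive_ereal reals ereal.
From mathcomp Require Import Rstruct.
From mathcomp Require Import ring.

Set Implicit Arguments.
Unset Strict Implicit.
Unset Printing Implicit Defensive.

Import Order.TTheory GRing.Theory Num.Theory.

Local Open Scope classical_set_scope.
Local Open Scope ring_scope.

(* The definitions are stated over an arbitrary ring so that they apply both to
   an artin algebra and to the endomorphism rings of its modules. Over an artin
   algebra they are the notions of the category of finitely generated left
   modules; in particular projectivity and injectivity are tested there. *)

Section Modules.
Variable A : pzRingType.
Implicit Types M N X Y P : lmodType A.

Definition fin_gen M : Prop :=
  exists (n : nat) (g : 'I_n -> M),
    forall x : M, exists c : 'I_n -> A, x = \sum_(i < n) c i *: g i.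

Definition zero_module M : Prop := forall x : M, x = 0.

Definition surjective X Y (f : {linear X -> Y}) : Prop :=
  forall y : Y, exists x : X, f x = y.

Definition exact_at X Y (Z : lmodType A)
    (f : {linear X -> Y}) (g : {linear Y -> Z}) : Prop :=
  forall y : Y, g y = 0 <-> exists x : X, f x = y.

Definition isomorphic X Y : Prop :=
  exists f : {linear X -> Y}, bijective f.

Definition projective P : Prop :=
  fin_gen P /\
  forall (X Y : lmodType A) (g : {linear X -> Y}) (f : {linear P -> Y}),
    fin_gen X -> fin_gen Y -> surjective g ->
    exists h : {linear P -> X}, forall p : P, g (h p) = f p.

Definition injective_module M : Prop :=
  fin_gen M /\
  forall (X Y : lmodType A) (j : {linear X -> Y}) (f : {linear X -> M}),
    fin_gen X -> fin_gen Y -> injective j ->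
    exists h : {linear Y -> M}, forall x : X, h (j x) = f x.

Definition direct_summand N M : Prop :=
  exists N' : lmodType A, isomorphic M (N * N')%type.

Definition indecomposable M : Prop :=
  ~ zero_module M /\
  forall X Y : lmodType A,
    isomorphic M (X * Y)%type -> zero_module X \/ zero_module Y.

Definition in_add M X : Prop :=
  exists n : nat, direct_summand X {ffun 'I_n -> M}.

Definition generator_cogenerator M : Prop :=
  [/\ fin_gen M,
      forall P, projective P -> indecomposable P -> in_add M P
    & forall X, injective_module X -> indecomposable X -> in_add M X].

(* [X] and [Y] are complementary occurrences, so that [X = Y] is not excluded
   a priori: the condition says that no indecomposable summand is repeated. *)
Definition basic M : Prop :=
  forall X Y Z : lmodType A,
    isomorphic M (X * (Y * Z))%type ->
    indecomposable X -> indecomposable Y -> ~ isomorphic X Y.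

Record proj_resolution M := ProjResolution {
  res_obj : nat -> lmodType A;
  res_diff : forall i, {linear res_obj i.+1 -> res_obj i};
  res_aug : {linear res_obj 0 -> M};
  res_proj : forall i, projective (res_obj i);
  res_aug_surj : surjective res_aug;
  res_exact0 : exact_at (res_diff 0) res_aug;
  res_exact : forall i, exact_at (res_diff i.+1) (res_diff i)
}.

Definition resolution_length_le M (P : proj_resolution M) (n : nat) : Prop :=
  forall i : nat, (n < i)%N -> zero_module (res_obj P i).

(* The infimum is [+oo] if no finite resolution exists; the zero module gets
   dimension [0], which is harmless for [gldim]. *)
Definition projdim M : \bar Rdefinitions.R :=
  ereal_inf [set x | exists (P : proj_resolution M) (n : nat),
                       resolution_length_le P n /\ x = (n%:R)%:E].

Definition gldim : \bar Rdefinitions.R :=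
  ereal_sup [set x | exists M : lmodType A, fin_gen M /\ x = projdim M].

End Modules.

Section EndomorphismRing.
Variables (A : pzRingType) (M : lmodType A).

Definition lin_end : Type := {linear M -> M}.

HB.instance Definition _ := gen_eqMixin lin_end.
HB.instance Definition _ := gen_choiceMixin lin_end.

Definition end_fun (f : lin_end) : {linear M -> M} := f.
Local Coercion end_fun : lin_end >-> GRing.Linear.type.

Lemma lin_end_eq (f g : lin_end) : (forall x : M, f x = g x) -> f = g.
Proof.
case: f => f [[f1] [f2]]; case: g => g [[g1] [g2]] /= fg.
have e : f = g by apply/funext.
case: _ / e g1 g2 fg => g1 g2 _.
by rewrite (Prop_irrelevance g1 f1) (Prop_irrelevance g2 f2).
Qed.

Definition end_zero : lin_end := (\0 : M -> M) : {linear M -> M}.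
Definition end_opp (f : lin_end) : lin_end := (\- f : M -> M) : {linear M -> M}.
Definition end_add (f g : lin_end) : lin_end :=
  (f \+ g : M -> M) : {linear M -> M}.
Definition end_one : lin_end := (@idfun M : M -> M) : {linear M -> M}.
(* The product is [f \o g], so that [M] is a left module over its
   endomorphism ring. *)
Definition end_mul (f g : lin_end) : lin_end :=
  (f \o g : M -> M) : {linear M -> M}.

Fact end_addA : associative end_add.
Proof. by move=> f g h; apply: lin_end_eq => x; exact: addrA. Qed.
Fact end_addC : commutative end_add.
Proof. by move=> f g; apply: lin_end_eq => x; exact: addrC. Qed.
Fact end_add0 : left_id end_zero end_add.
Proof. by move=> f; apply: lin_end_eq => x; exact: add0r. Qed.
Fact end_addN : left_inverse end_zero end_opp end_add.
Proof. by move=> f; apply: lin_end_eq => x; exact: addNr. Qed.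

HB.instance Definition _ :=
  GRing.isZmodule.Build lin_end end_addA end_addC end_add0 end_addN.

Fact end_mulA : associative end_mul.
Proof. by move=> f g h; apply: lin_end_eq. Qed.
Fact end_mul1 : left_id end_one end_mul.
Proof. by move=> f; apply: lin_end_eq. Qed.
Fact end_mulr1 : right_id end_one end_mul.
Proof. by move=> f; apply: lin_end_eq. Qed.
Fact end_mulDl : left_distributive end_mul +%R.
Proof. by move=> f g h; apply: lin_end_eq. Qed.
Fact end_mulDr : right_distributive end_mul +%R.
Proof. by move=> f g h; apply: lin_end_eq => x; exact: (raddfD f). Qed.

HB.instance Definition _ := GRing.Zmodule_isPzRing.Build lin_end
  end_mulA end_mul1 end_mulr1 end_mulDl end_mulDr.

End EndomorphismRing.

Section AuslanderGenerators.
Variable A : pzRingType.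
Implicit Types M N Q X : lmodType A.

Definition repdim : \bar Rdefinitions.R :=
  ereal_inf [set x | exists M : lmodType A,
                       generator_cogenerator M /\ x = gldim (lin_end M)].

Definition Auslander_generator M : Prop :=
  [/\ generator_cogenerator M, basic M & gldim (lin_end M) = repdim].

(* [i] is a split monomorphism [N -> M] with retraction [r], and [p : M -> Q]
   is its cokernel, i.e. [Q = M/N]. *)
Definition minimal_Auslander_generator M : Prop :=
  Auslander_generator M /\
  forall N Q (i : {linear N -> M}) (r : {linear M -> N}) (p : {linear M -> Q}),
    cancel i r -> exact_at i p -> surjective p ->
    ~ zero_module N ->
    (forall X, direct_summand X N -> projective X \/ injective_module X ->
               zero_module X) ->
    (gldim (lin_end M) < gldim (lin_end Q))%E.

End AuslanderGenerators.

(* [ExtAlg c a b d] stands for [c + a alpha + b beta + d alpha beta]. By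
   [ext_alg_relations] and [ext_alg_presentation] below, this is the algebra
   presented by [alpha^2 = 0], [alpha beta + beta alpha = 0], [beta^2 = 0]. *)
Record ext_alg (k : Type) :=
  ExtAlg { coef1 : k; coefa : k; coefb : k; coefab : k }.

Section ExteriorAlgebra.
Variable k : fieldType.
Local Notation L := (ext_alg k).

Definition ext_alg_tuple (u : L) := (coef1 u, coefa u, coefb u, coefab u).
Definition tuple_ext_alg (t : k * k * k * k) : L :=
  let: (a, b, c, d) := t in ExtAlg a b c d.
Fact ext_alg_tupleK : cancel ext_alg_tuple tuple_ext_alg.
Proof. by case. Qed.

HB.instance Definition _ := Choice.copy L (can_type ext_alg_tupleK).

Definition ext_add (u v : L) : L :=
  ExtAlg (coef1 u + coef1 v) (coefa u + coefa v)
         (coefb u + coefb v) (coefab u + coefab v).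
Definition ext_opp (u : L) : L :=
  ExtAlg (- coef1 u) (- coefa u) (- coefb u) (- coefab u).
Definition ext_mul (u v : L) : L :=
  ExtAlg (coef1 u * coef1 v)
         (coef1 u * coefa v + coefa u * coef1 v)
         (coef1 u * coefb v + coefb u * coef1 v)
         (coef1 u * coefab v + coefab u * coef1 v
          + (coefa u * coefb v - coefb u * coefa v)).
Definition ext_scale (c : k) (u : L) : L :=
  ExtAlg (c * coef1 u) (c * coefa u) (c * coefb u) (c * coefab u).

Fact ext_addA : associative ext_add.
Proof. by move=> u v w; rewrite /ext_add /= !addrA. Qed.
Fact ext_addC : commutative ext_add.
Proof. by move=> u v; congr ExtAlg; exact: addrC. Qed.
Fact ext_add0 : left_id (ExtAlg 0 0 0 0) ext_add.
Proof. by case=> *; rewrite /ext_add /= !add0r. Qed.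
Fact ext_addN : left_inverse (ExtAlg 0 0 0 0) ext_opp ext_add.
Proof. by case=> *; rewrite /ext_add /= !addNr. Qed.

HB.instance Definition _ :=
  GRing.isZmodule.Build L ext_addA ext_addC ext_add0 ext_addN.

Fact ext_mulA : associative ext_mul.
Proof. by move=> u v w; rewrite /ext_mul /=; congr ExtAlg; ring. Qed.
Fact ext_mul1 : left_id (ExtAlg 1 0 0 0) ext_mul.
Proof. by case=> *; rewrite /ext_mul /=; congr ExtAlg; ring. Qed.
Fact ext_mulr1 : right_id (ExtAlg 1 0 0 0) ext_mul.
Proof. by case=> *; rewrite /ext_mul /=; congr ExtAlg; ring. Qed.
Fact ext_mulDl : left_distributive ext_mul +%R.
Proof. by move=> u v w; congr ExtAlg => /=; ring. Qed.
Fact ext_mulDr : right_distributive ext_mul +%R.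
Proof. by move=> u v w; congr ExtAlg => /=; ring. Qed.
Fact ext_one_neq0 : ExtAlg 1 0 0 0 != 0 :> L.
Proof. by apply/eqP => -[/eqP]; rewrite oner_eq0. Qed.

HB.instance Definition _ := GRing.Zmodule_isNzRing.Build L
  ext_mulA ext_mul1 ext_mulr1 ext_mulDl ext_mulDr ext_one_neq0.

Fact ext_scaleA c d u : ext_scale c (ext_scale d u) = ext_scale (c * d) u.
Proof. by congr ExtAlg; exact: mulrA. Qed.
Fact ext_scale1 : left_id 1 ext_scale.
Proof. by case=> *; rewrite /ext_scale /= !mul1r. Qed.
Fact ext_scaleDr : right_distributive ext_scale +%R.
Proof. by move=> c u v; congr ExtAlg; exact: mulrDr. Qed.
Fact ext_scaleDl u : {morph ext_scale^~ u : c d / c + d}.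
Proof. by move=> c d; congr ExtAlg; exact: mulrDl. Qed.

HB.instance Definition _ := GRing.Zmodule_isLmodule.Build k L
  ext_scaleA ext_scale1 ext_scaleDr ext_scaleDl.

Fact ext_scaleAl (c : k) (u v : L) : c *: (u * v) = c *: u * v.
Proof. by congr ExtAlg => /=; ring. Qed.
Fact ext_scaleAr (c : k) (u v : L) : c *: (u * v) = u * (c *: v).
Proof. by congr ExtAlg => /=; ring. Qed.

HB.instance Definition _ := GRing.Lmodule_isLalgebra.Build k L ext_scaleAl.
HB.instance Definition _ := GRing.Lalgebra_isAlgebra.Build k L ext_scaleAr.

Definition alpha : L := ExtAlg 0 1 0 0.
Definition beta : L := ExtAlg 0 0 1 0.

Lemma ext_algE (u : L) :
  u = coef1 u *: 1 + coefa u *: alpha + coefb u *: beta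
      + coefab u *: (alpha * beta).
Proof. by case: u => *; congr ExtAlg => /=; ring. Qed.

Lemma ext_alg_relations :
  [/\ alpha * alpha = 0, alpha * beta + beta * alpha = 0 & beta * beta = 0].
Proof. by split; congr ExtAlg => /=; ring. Qed.

Section Presentation.
Variables (B : algType k) (x y : B).
Hypotheses (xx : x * x = 0) (xy : x * y + y * x = 0) (yy : y * y = 0).

Definition ext_eval (u : L) : B :=
  coef1 u *: 1 + coefa u *: x + coefb u *: y + coefab u *: (x * y).

Fact ext_eval_linear : linear ext_eval.
Proof.
move=> c u v; rewrite /ext_eval /= !scalerDl -!scalerA !scalerDr.
by rewrite !addrA [RHS](ACl (1*5*2*6*3*7*4*8)).
Qed.

Fact ext_eval_monoid : monoid_morphism ext_eval.
Proof.
split=> [|u v]; first by rewrite /ext_eval /= !scale0r scale1r !addr0.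
have yx : y * x = - (x * y) by apply/eqP; rewrite -addr_eq0 addrC xy.
have xxy : x * (x * y) = 0 by rewrite mulrA xx mul0r.
have xyy : x * y * y = 0 by rewrite -mulrA yy mulr0.
have yxy : y * (x * y) = 0 by rewrite mulrA yx mulNr xyy oppr0.
have xyx : x * y * x = 0 by rewrite -mulrA yx mulrN xxy oppr0.
have xyxy : x * y * (x * y) = 0 by rewrite -mulrA yxy mulr0.
rewrite /ext_eval !mulrDl !mulrDr -!scalerAl -!scalerAr !scalerA !mul1r !mulr1.
rewrite xx yy yx xxy xyy yxy xyx xyxy !scaler0 !addr0 !scalerN /=.
rewrite !scalerDl !scaleNr !addrA.
by rewrite [RHS](ACl (1*2*5*3*7*4*9*6*8)).
Qed.

HB.instance Definition _ :=
  GRing.isLinear.Build k L B *:%R ext_eval ext_eval_linear.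
HB.instance Definition _ :=
  GRing.isMonoidMorphism.Build L B ext_eval ext_eval_monoid.

Lemma ext_alg_presentation :
  exists f : {lrmorphism L -> B},
    [/\ f alpha = x, f beta = y
      & forall g : {lrmorphism L -> B}, g alpha = x -> g beta = y -> g =1 f].
Proof.
exists (ext_eval : {lrmorphism L -> B}); split=> [||g gx gy u].
- by rewrite /= /ext_eval /= !scale0r scale1r add0r !addr0.
- by rewrite /= /ext_eval /= !scale0r scale1r !add0r addr0.
- have gxy : g (alpha * beta) = x * y by rewrite -gx -gy; exact: rmorphM.
  by rewrite [in LHS](ext_algE u) !linearD !linearZ /= rmorph1 gx gy gxy.
Qed.

End Presentation.

Record ext_rep (d : nat) := ExtRep {
  mx_alpha : 'M[k]_d;
  mx_beta : 'M[k]_d;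
  mx_alpha2 : mx_alpha *m mx_alpha = 0;
  mx_alpha_beta : mx_alpha *m mx_beta + mx_beta *m mx_alpha = 0;
  mx_beta2 : mx_beta *m mx_beta = 0
}.

Definition rep_module (d : nat) (r : ext_rep d) : Type := 'cV[k]_d.

Section RepModule.
Variables (d : nat) (r : ext_rep d).
Local Notation V := (rep_module r).

HB.instance Definition _ := GRing.Zmodule.on V.

Definition rep_act (u : L) (v : V) : V :=
  coef1 u *: (v : 'cV_d) + coefa u *: (mx_alpha r *m v)
  + coefb u *: (mx_beta r *m v)
  + coefab u *: (mx_alpha r *m (mx_beta r *m v)).

Fact rep_act1 : left_id 1 rep_act.
Proof. by move=> v; rewrite /rep_act /= scale1r !scale0r !addr0. Qed.

Fact rep_actDr : right_distributive rep_act +%R.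
Proof.
move=> u v w; rewrite /rep_act !mulmxDr !scalerDr !addrA.
by rewrite [LHS](ACl (1*3*5*7*2*4*6*8)).
Qed.

Fact rep_actDl v : {morph rep_act^~ v : u w / u + w}.
Proof.
move=> u w; rewrite /rep_act /= !scalerDl !addrA.
by rewrite [LHS](ACl (1*3*5*7*2*4*6*8)).
Qed.

Fact rep_actA u w v : rep_act u (rep_act w v) = rep_act (u * w) v.
Proof.
have [aa ab bb] := And3 (mx_alpha2 r) (mx_alpha_beta r) (mx_beta2 r).
have ba (z : 'cV_d) :
    mx_beta r *m (mx_alpha r *m z) = - (mx_alpha r *m (mx_beta r *m z)).
  by apply/eqP; rewrite -addr_eq0 !mulmxA -mulmxDl addrC ab mul0mx.
have aaz (z : 'cV_d) : mx_alpha r *m (mx_alpha r *m z) = 0.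
  by rewrite mulmxA aa mul0mx.
have bbz (z : 'cV_d) : mx_beta r *m (mx_beta r *m z) = 0.
  by rewrite mulmxA bb mul0mx.
rewrite /rep_act !mulmxDr -!scalemxAr !(ba, aaz, bbz) !mulmxN !(ba, aaz, bbz).
rewrite !(mulmx0, mulmxN, ba, aaz, bbz, oppr0, scaler0, addr0, scalerN).
rewrite !scalerDr !scalerN !scalerA /= !scalerDl !scaleNr !addrA.
by rewrite [LHS](ACl (1*2*5*3*7*4*9*6*8)).
Qed.

HB.instance Definition _ := GRing.Zmodule_isLmodule.Build L V
  rep_actA rep_act1 rep_actDr rep_actDl.

Lemma rep_alphaE (v : V) : alpha *: v = mx_alpha r *m v.
Proof.
by rewrite /GRing.scale /= /rep_act /= !scale0r scale1r add0r !addr0.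
Qed.

Lemma rep_betaE (v : V) : beta *: v = mx_beta r *m v.
Proof.
by rewrite /GRing.scale /= /rep_act /= !scale0r scale1r !add0r addr0.
Qed.

End RepModule.

(* [s = 0] gives the action of [alpha] and [s = 1] that of [beta] on
   [k^n (+) k^(n+1)]: the lower left block is the identity matrix with a zero
   row added below, resp. above. *)
Definition S_block (s n : nat) : 'M[k]_(n + n.+1) :=
  block_mx 0 0 (\matrix_(i < n.+1, j < n) (i == (j + s)%N :> nat)%:R) 0.

Definition S_mx (s : nat) (n : int) : 'M[k]_(`|n| + `|n|.+1) :=
  if n < 0 then (S_block s `|n|)^T else S_block s `|n|.

Fact S_mx_mul s t n : S_mx s n *m S_mx t n = 0.
Proof.
have block0 m : S_block s m *m S_block t m = 0.
  by rewrite mulmx_block !(mul0mx, mulmx0, addr0) block_mx0.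
have block0' m : S_block t m *m S_block s m = 0.
  by rewrite mulmx_block !(mul0mx, mulmx0, addr0) block_mx0.
by rewrite /S_mx; case: ifP => _; rewrite -?trmx_mul ?block0 ?block0' ?trmx0.
Qed.

Fact S_mx_comm s t n : S_mx s n *m S_mx t n + S_mx t n *m S_mx s n = 0.
Proof. by rewrite !S_mx_mul addr0. Qed.

Definition S_rep (n : int) : ext_rep (`|n| + `|n|.+1) :=
  ExtRep (S_mx_mul 0 0 n) (S_mx_comm 0 1 n) (S_mx_mul 1 1 n).

Definition S_ (n : int) : lmodType L := rep_module (S_rep n).

Definition M_ (n : int) : lmodType L := (L^o * (S_ n * S_ (n + 1)))%type.

End ExteriorAlgebra.

(* Main.v *)
(* Left modules over [G = End(M)] are controlled by the functor [Hom(-, M)]: if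
   [L] lies in [add M], every second syzygy over [G] is [Hom(X, M)] for some
   [L]-module [X], and [Hom(X, M)] is projective iff [X] is in [add M].  Hence
   [gldim G <= 3] iff every [X] has a left approximation [0 -> X -> Q -> C -> 0]
   with [Q] and [C] in [add M].  This condition is invariant under syzygies, as
   [L] is selfinjective, and [S_(n-1)] is the syzygy of [S_n], so that it suffices
   to treat [M_(-1) = L (+) rad L (+) S]: if [X] has no free summand, embed it in
   [(rad L)^r (+) X / rad X], with semisimple cokernel.  If the global dimension
   were at most 2, all the [S_m] would be in [add M], against their unbounded
   dimensions.  Minimality follows from the exact sequences
   [0 -> X -> S_n (+) P -> S_(n+1) -> 0] with [P] projective whose first map is an
   approximation: [L (+) S_n] does not have [S_(n+1)] in its [add].  The
   Krull-Schmidt arguments use that endomorphisms of [L] and of [S_n] act by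
   scalars on the socle. *)

From HB Require Import structures.
From mathcomp Require Import all_boot all_order all_algebra.
From mathcomp Require Import boolp constructive_ereal ereal.
From mathcomp Require Import Rstruct.
From mathcomp Require Import ring.
Require Import Defs.
Set Implicit Arguments.
Unset Strict Implicit.
Unset Printing Implicit Defensive.
Import Order.TTheory GRing.Theory Num.Theory.
Local Open Scope ring_scope.

(** * Linear maps, kernels and cokernels *)

(** The product of [lin_end M] is composition, so its left modules arise from the contravariant
    functor [Hom(-, M)]; this is why left approximations, cokernels and the injectivity of [L] carry
    the argument. Membership in [add M] is expressed through the identity map: [addin M X] says that
    the identity of [X] is a finite sum of maps through [M], and [sadd] says the same up to a map
    through a free module. Such sums can be lifted, restricted to syzygies or passed to cosyzygies
    term by term, which yields Schanuel's lemma and the passage between [n] and [n + 1] with no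
    choice of complements. Uniqueness of decompositions is not developed in general: for [L] and the
    [S_n], summands are cancelled and counted by computing with the scalars by which endomorphisms
    act on an essential socle. All finiteness questions are settled by restriction to [k], over
    which [L] and the rings [End(M)], for [M] finitely generated, have finite dimension. *)

Lemma linear_lift (A : pzRingType) (X Y : lmodType A) (f : X -> Y) :
  linear f -> exists h : {linear X -> Y}, h =1 f.
Proof.
move=> fL.
by exists (HB.pack_for {linear X -> Y} f (GRing.isLinear.Build A X Y *:%R f fL)).
Qed.

Lemma linear_inj (A : pzRingType) (X Y : lmodType A) (f : {linear X -> Y}) :
  (forall x, f x = 0 -> x = 0) -> injective f.
Proof.
by move=> f0 x y fxy; apply/subr0_eq/f0; rewrite linearB fxy subrr.
Qed.

Section SubModule.
Variables (A : pzRingType) (V : lmodType A) (S : V -> Prop).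
Hypothesis S_submod : S 0 /\ forall a x y, S x -> S y -> S (a *: x + y).

Definition submod_pred : {pred V} := fun x => `[< S x >].

Fact submod_pred_closed : submod_closed submod_pred.
Proof.
have [S0 SL] := S_submod; split; first exact/asboolP.
by move=> a x y /asboolP Sx /asboolP Sy; apply/asboolP/SL.
Qed.

HB.instance Definition _ :=
  GRing.isSubmodClosed.Build A V submod_pred submod_pred_closed.

Record submod := SubMod { submod_val : V; submod_valP : submod_val \in submod_pred }.
HB.instance Definition _ := [isSub for submod_val].
HB.instance Definition _ := [Choice of submod by <:].
HB.instance Definition _ := [SubChoice_isSubZmodule of submod by <:].
HB.instance Definition _ := [SubZmodule_isSubLmodule of submod by <:].

Lemma submod_ex : exists (K : lmodType A) (i : {linear K -> V}),
  injective i /\ forall x, S x <-> exists y, i y = x.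
Proof.
exists submod, (val : {linear submod -> V}); split; first exact: val_inj.
move=> x; split=> [Sx|[y <-]]; last exact/asboolP/(submod_valP y).
by exists (SubMod (introT (asboolP _) Sx)).
Qed.

(** [Quotient.quot] divides the additive group only; the scalar action is added through
    representatives, and [qscale_proj] shows that their choice does not matter. *)
Definition quotient_module := Quotient.quot submod_pred.
HB.instance Definition _ := GRing.Zmodule.on quotient_module.

Definition qproj (x : V) : quotient_module := \pi_(Quotient.quot submod_pred)%qT x.
Definition qscale (a : A) (x : quotient_module) : quotient_module :=
  qproj (a *: repr x).

Lemma qproj_eq x y : qproj x = qproj y <-> S (x - y).
Proof.
by split=> [/eqP|Sxy]; [rewrite -Quotient.idealrBE => /asboolP
  |apply/eqP; rewrite -Quotient.idealrBE; apply/asboolP].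
Qed.
Lemma qproj_repr x : qproj (repr x) = x.
Proof. exact: reprK. Qed.
Lemma qproj_surj x : exists y, qproj y = x.
Proof. by exists (repr x); rewrite qproj_repr. Qed.
Lemma qprojD : {morph qproj : x y / x + y}.
Proof. by move=> x y; rewrite /qproj raddfD. Qed.
Lemma qscale_proj a x : qscale a (qproj x) = qproj (a *: x).
Proof.
apply/qproj_eq; rewrite -scalerBr; apply/asboolP/(@rpredZ _ _ submod_pred).
by apply/asboolP/qproj_eq; rewrite qproj_repr.
Qed.

Fact qscaleA a b x : qscale a (qscale b x) = qscale (a * b) x.
Proof. by have [y <-] := qproj_surj x; rewrite !qscale_proj scalerA. Qed.
Fact qscale1 : left_id 1 qscale.
Proof. by move=> x; have [y <-] := qproj_surj x; rewrite qscale_proj scale1r. Qed.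
Fact qscaleDr : right_distributive qscale +%R.
Proof.
move=> a x y; have [x' <-] := qproj_surj x; have [y' <-] := qproj_surj y.
by rewrite -qprojD !qscale_proj scalerDr qprojD.
Qed.
Fact qscaleDl x : {morph qscale^~ x : a b / a + b}.
Proof.
by move=> a b; have [y <-] := qproj_surj x; rewrite !qscale_proj scalerDl qprojD.
Qed.

HB.instance Definition _ := GRing.Zmodule_isLmodule.Build A quotient_module
  qscaleA qscale1 qscaleDr qscaleDl.

Lemma qproj_linear : linear qproj.
Proof. by move=> a x y; rewrite qprojD -qscale_proj. Qed.

Lemma quotient_ex : exists (C : lmodType A) (p : {linear V -> C}),
  surjective p /\ forall x, p x = 0 <-> S x.
Proof.
have [p pE] := linear_lift qproj_linear.
exists quotient_module, p; split=> [y|x].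
  by have [x <-] := qproj_surj y; exists x; rewrite pE.
have p0 : qproj 0 = p 0 by rewrite pE.
by have := qproj_eq x 0; rewrite subr0 p0 raddf0 pE.
Qed.

End SubModule.

Section Exactness.
Variable A : pzRingType.
Implicit Types X Y Z W : lmodType A.

Lemma ker_ex X Y (f : {linear X -> Y}) :
  exists (K : lmodType A) (i : {linear K -> X}), injective i /\ exact_at i f.
Proof.
have [|K [i [iI iP]]] := @submod_ex A X (fun x => f x = 0).
  by split=> [|a x y fx fy]; rewrite ?raddf0 // linearP fx fy scaler0 addr0.
by exists K, i; split.
Qed.

Lemma coker_ex X Y (f : {linear X -> Y}) :
  exists (C : lmodType A) (p : {linear Y -> C}),
    surjective p /\ exact_at f p.
Proof.
pose S y := exists x, f x = y.
have SP : S 0 /\ forall a x y, S x -> S y -> S (a *: x + y).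
  split=> [|a _ _ [x <-] [y <-]]; first by exists 0; rewrite raddf0.
  by exists (a *: x + y); rewrite linearP.
by have [C [p [pS pP]]] := quotient_ex SP; exists C, p; split.
Qed.

Lemma factor_surj X Y Z (p : {linear X -> Y}) (f : {linear X -> Z}) :
  surjective p -> (forall x, p x = 0 -> f x = 0) ->
  exists h : {linear Y -> Z}, forall x, h (p x) = f x.
Proof.
move=> pS pf; have [g gE] := choice pS.
have pfE x y : p x = p y -> f x = f y.
  by move=> pxy; apply/subr0_eq; rewrite -linearB pf // linearB pxy subrr.
have [|h hE] := @linear_lift A Y Z (f \o g).
  by move=> a x y /=; rewrite -linearP; apply: pfE; rewrite linearP !gE.
by exists h => x; rewrite hE /=; apply: pfE; rewrite gE.
Qed.

Lemma factor_inj X Y Z (i : {linear X -> Y}) (f : {linear Z -> Y}) :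
  injective i -> (forall z, exists x, i x = f z) ->
  exists h : {linear Z -> X}, forall z, i (h z) = f z.
Proof.
move=> iI fi; have [g gE] := choice fi.
have [|h hE] := @linear_lift A Z X g; last by exists h => z; rewrite hE.
by move=> a x y; apply: iI; rewrite linearP !gE linearP.
Qed.

Lemma linear_bij X Y (f : {linear X -> Y}) :
  injective f -> surjective f ->
  exists g : {linear Y -> X}, cancel f g /\ cancel g f.
Proof.
move=> fI fS.
have [|g gE] := @factor_surj X Y X f idfun fS.
  by move=> x fx; apply: fI; rewrite fx raddf0.
by exists g; split=> // y; have [x <-] := fS y; rewrite gE.
Qed.

Lemma bij_surj X Y (f : {linear X -> Y}) : bijective f -> surjective f.
Proof. by case=> g fK gK y; exists (g y). Qed.

Definition ses X Y Z (i : {linear X -> Y}) (p : {linear Y -> Z}) : Prop :=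
  [/\ injective i, exact_at i p & surjective p].

Lemma ses0 X Y Z (i : {linear X -> Y}) (p : {linear Y -> Z}) x :
  ses i p -> p (i x) = 0.
Proof. by case=> _ ip _; apply/ip; exists x. Qed.

Lemma ses_ker X Y (p : {linear X -> Y}) : surjective p ->
  exists (K : lmodType A) (i : {linear K -> X}), ses i p.
Proof. by move=> pS; have [K [i [iI ip]]] := ker_ex p; exists K, i. Qed.

Lemma ses_coker X Y (i : {linear X -> Y}) : injective i ->
  exists (C : lmodType A) (p : {linear Y -> C}), ses i p.
Proof. by move=> iI; have [C [p [pS ip]]] := coker_ex i; exists C, p. Qed.

Lemma ses_ker_map X Y Z X' Y' Z' (i : {linear X -> Y}) (p : {linear Y -> Z})
    (i' : {linear X' -> Y'}) (p' : {linear Y' -> Z'}) (f : {linear Y -> Y'}) :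
  ses i p -> ses i' p' -> (forall x, p' (f (i x)) = 0) ->
  exists g : {linear X -> X'}, forall x, i' (g x) = f (i x).
Proof.
move=> s [i'I ip' _] fi.
have [|g gE] := @factor_inj _ _ _ i' (f \o i) i'I; last by exists g => x; rewrite gE.
by move=> x; apply: (ip' _).1; exact: fi.
Qed.

Lemma ses_coker_map X Y Z W (i : {linear X -> Y}) (p : {linear Y -> Z})
    (f : {linear Y -> W}) :
  ses i p -> (forall x, f (i x) = 0) ->
  exists g : {linear Z -> W}, forall y, g (p y) = f y.
Proof.
by move=> [_ ip pS] fi; apply: factor_surj => // y /ip [x <-].
Qed.

Lemma fin_gen_surj X Y (p : {linear X -> Y}) :
  surjective p -> fin_gen X -> fin_gen Y.
Proof.
move=> pS [n [g gP]]; exists n, (fun i => p (g i)) => y.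
have [x <-] := pS y; have [c ->] := gP x; exists c.
by rewrite linear_sum; apply: eq_bigr => i _; rewrite linearZ.
Qed.

Lemma fin_genI X (I : finType) (g : I -> X) :
  (forall x, exists c : I -> A, x = \sum_i c i *: g i) -> fin_gen X.
Proof.
move=> gP; exists #|I|, (g \o enum_val) => x; have [c ->] := gP x.
by exists (c \o enum_val); rewrite (reindex _ (onW_bij _ (enum_val_bij I))).
Qed.

Lemma fin_gen_add X Y Z (f : {linear X -> Z}) (g : {linear Y -> Z}) :
  fin_gen X -> fin_gen Y -> (forall z, exists x y, z = f x + g y) -> fin_gen Z.
Proof.
move=> [n [a aP]] [m [b bP]] fg.
apply: (@fin_genI Z ('I_n + 'I_m)%type
  (fun i => match i with inl i => f (a i) | inr j => g (b j) end)) => z.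
have [x [y ->]] := fg z; have [c ->] := aP x; have [d ->] := bP y.
exists (fun i => match i with inl i => c i | inr j => d j end).
rewrite big_sumType !linear_sum; congr (_ + _); apply: eq_bigr => i _;
  exact: linearZ.
Qed.

Lemma pair_lin X Y Z (f : {linear Z -> X}) (g : {linear Z -> Y}) :
  exists h : {linear Z -> (X * Y)%type}, forall z, h z = (f z, g z).
Proof. by apply: linear_lift => a x y; rewrite !linearP. Qed.

Lemma copair_lin X Y Z (f : {linear X -> Z}) (g : {linear Y -> Z}) :
  exists h : {linear (X * Y)%type -> Z}, forall z, h z = f z.1 + g z.2.
Proof.
apply: linear_lift => a x y /=.
by rewrite !linearP scalerDr addrACA.
Qed.

Lemma fin_gen_pair X Y : fin_gen X -> fin_gen Y -> fin_gen (X * Y)%type.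
Proof.
move=> Xf Yf; have [i iE] := pair_lin (idfun : {linear X -> X}) (\0 : {linear X -> Y}).
have [j jE] := pair_lin (\0 : {linear Y -> X}) (idfun : {linear Y -> Y}).
apply: (@fin_gen_add _ _ _ i j Xf Yf) => -[x y]; exists x, y.
by rewrite iE jE; congr pair; rewrite /= ?addr0 ?add0r.
Qed.

End Exactness.

(** * Factorisations through finite sums of copies of a module *)

Section Thru.
Variable A : pzRingType.
Implicit Types F M N X Y Z W : lmodType A.

(** Factorisation through a finite power of [M], given by components so that no power has to be
    formed. [f] is a bare function, so that sums and differences of maps fit without a linear
    structure. *)
Definition thru M X Y (f : X -> Y) : Prop :=
  exists (I : finType) (u : I -> {linear X -> M}) (v : I -> {linear M -> Y}),
    forall x, f x = \sum_i v i (u i x).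

Definition addin M X : Prop := thru M (fun x : X => x).

Lemma sum_lin (I : finType) X M Y (u : I -> {linear X -> M})
    (v : I -> {linear M -> Y}) :
  exists h : {linear X -> Y}, forall x, h x = \sum_i v i (u i x).
Proof.
apply: linear_lift => a x y; rewrite scaler_sumr -big_split.
by apply: eq_bigr => i _; rewrite !linearP.
Qed.

Lemma sub_lin X Y (f g : {linear X -> Y}) :
  exists h : {linear X -> Y}, forall x, h x = f x - g x.
Proof. by apply: linear_lift => a x y; rewrite !linearP scalerDr addrACA. Qed.

Lemma add_lin X Y (f g : {linear X -> Y}) :
  exists h : {linear X -> Y}, forall x, h x = f x + g x.
Proof. by apply: linear_lift => a x y; rewrite !linearP scalerDr addrACA. Qed.

Lemma thru_eq M X Y (f g : X -> Y) : thru M f -> f =1 g -> thru M g.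
Proof. by move=> [I [u [v uv]]] fg; exists I, u, v => x; rewrite -fg. Qed.

Lemma thru1 M X Y (u : {linear X -> M}) (v : {linear M -> Y}) : thru M (v \o u).
Proof.
exists unit, (fun=> u), (fun=> v) => x.
by rewrite (big_pred1 tt) //; case.
Qed.

Lemma thru0 M X Y : thru M (fun _ : X => 0 : Y).
Proof. by exists 'I_0, (fun=> \0), (fun=> \0) => x; rewrite big_ord0. Qed.

Lemma thruD M X Y (f g : X -> Y) :
  thru M f -> thru M g -> thru M (fun x => f x + g x).
Proof.
move=> [I [u [v uv]]] [J [w [z wz]]]; exists (I + J)%type,
  (fun i => match i with inl i => u i | inr j => w j end),
  (fun i => match i with inl i => v i | inr j => z j end) => x.
by rewrite big_sumType /= uv wz.
Qed.

Lemma thru_comp M X Y Z W (f : X -> Y) (g : {linear Y -> Z}) (h : {linear W -> X}) :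
  thru M f -> thru M (g \o f \o h).
Proof.
move=> [I [u [v uv]]]; exists I, (fun i => u i \o h), (fun i => g \o v i) => x.
by rewrite /= uv linear_sum.
Qed.

Lemma thru_trans M N X Y (f : X -> Y) : thru M f -> addin N M -> thru N f.
Proof.
move=> [I [u [v uv]]] [J [w [z wz]]].
exists (I * J)%type, (fun ij => w ij.2 \o u ij.1), (fun ij => v ij.1 \o z ij.2) => x.
rewrite uv -(pair_big xpredT xpredT (fun i j => v i (z j (w j (u i x))))) /=.
by apply: eq_bigr => i _; rewrite {1}[u i x]wz linear_sum.
Qed.

Lemma addin_refl M : addin M M.
Proof. exact: (@thru1 M M M idfun idfun). Qed.

Lemma addin_retract M X (u : {linear X -> M}) (v : {linear M -> X}) :
  cancel u v -> addin M X.
Proof. by move=> uK; apply: thru_eq (thru1 u v) _ => x /=; rewrite uK. Qed.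

Lemma addin_fst M N : addin (M * N)%type M.
Proof.
have [i iE] := pair_lin (idfun : {linear M -> M}) (\0 : {linear M -> N}).
by apply: (@addin_retract _ _ i (fst : {linear (M * N)%type -> M})) => x; rewrite iE.
Qed.

Lemma addin_snd M N : addin (M * N)%type N.
Proof.
have [i iE] := pair_lin (\0 : {linear N -> M}) (idfun : {linear N -> N}).
by apply: (@addin_retract _ _ i (snd : {linear (M * N)%type -> N})) => x; rewrite iE.
Qed.

Lemma addin_pair M X Y : addin M X -> addin M Y -> addin M (X * Y)%type.
Proof.
have [i iE] := pair_lin (idfun : {linear X -> X}) (\0 : {linear X -> Y}).
have [j jE] := pair_lin (\0 : {linear Y -> X}) (idfun : {linear Y -> Y}).
move=> Mx My; have := thruD (thru_comp i (fst : {linear (X * Y)%type -> X}) Mx)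
  (thru_comp j (snd : {linear (X * Y)%type -> Y}) My).
move/thru_eq; apply=> -[x y]; rewrite /= iE jE.
by congr pair; rewrite /= ?addr0 ?add0r.
Qed.

Lemma ffun_lin (I : finType) M N (u : I -> {linear N -> M}) :
  exists h : {linear N -> {ffun I -> M}}, forall x i, h x i = u i x.
Proof.
have [|h hE] := @linear_lift A N {ffun I -> M} (fun x => [ffun i => u i x]).
  by move=> a x y; apply/ffunP => i; rewrite !ffunE linearP.
by exists h => x i; rewrite hE ffunE.
Qed.

Lemma ffun_colin (I : finType) M N (v : I -> {linear M -> N}) :
  exists h : {linear {ffun I -> M} -> N}, forall f, h f = \sum_i v i (f i).
Proof.
apply: linear_lift => a x y; rewrite scaler_sumr -big_split.
by apply: eq_bigr => i _; rewrite !ffunE linearP.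
Qed.

Lemma ffun_proj (I : finType) M (i : I) :
  exists h : {linear {ffun I -> M} -> M}, forall f, h f = f i.
Proof. by apply: linear_lift => a x y; rewrite !ffunE. Qed.

Lemma ffun_inj (I : finType) M (i : I) :
  exists h : {linear M -> {ffun I -> M}}, forall x j, h x j = if j == i then x else 0.
Proof.
have [h hE] := @ffun_lin I M M (fun j => if j == i then (idfun : {linear M -> M}) else (\0 : {linear M -> M})).
by exists h => x j; rewrite hE; case: eqP.
Qed.

Lemma ffun_sum_inj (I : finType) M (e : I -> {linear M -> {ffun I -> M}})
    (f : {ffun I -> M}) :
  (forall i x j, e i x j = if j == i then x else 0) -> f = \sum_i e i (f i).
Proof.
move=> eE; apply/ffunP => i; rewrite sum_ffunE (bigD1 i) //= eE eqxx.
by rewrite big1 ?addr0 // => j; rewrite eE eq_sym => /negPf ->.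
Qed.

Lemma addin_ffun (I : finType) M : addin M {ffun I -> M}.
Proof.
have [p pE] := choice (@ffun_proj I M); have [e eE] := choice (@ffun_inj I M).
exists I, p, e => x; rewrite {1}(ffun_sum_inj x eE).
by apply: eq_bigr => i _; rewrite pE.
Qed.

(** The complement is the kernel of [v], onto which [1 - u v] projects. *)
Lemma retract_summand M X (u : {linear X -> M}) (v : {linear M -> X}) :
  cancel u v -> direct_summand X M.
Proof.
move=> uK; have [K [i [iI iv]]] := ker_ex v.
have [r rE] := sub_lin idfun (u \o v : {linear _ -> _}).
have [|s sE] := factor_inj (f := r) iI.
  by move=> z; apply/iv; rewrite rE linearB /= uK subrr.
have [h hE] := pair_lin v s; have [g gE] := copair_lin u i.
exists K, h, g => z; first by rewrite hE gE /= sE rE /= addrC subrK.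
rewrite gE hE; case: z => x y /=.
have vi : v (i y) = 0 by apply/iv; exists y.
have e : v (u x + i y) = x by rewrite linearD /= vi addr0 uK.
rewrite e; congr pair.
by apply: iI; rewrite sE rE /= e addrC addKr.
Qed.

Lemma addinP M X : addin M X <-> in_add M X.
Proof.
split=> [[I [u [v uv]]]|[n [N' [f [g fK gK]]]]].
  have [p pE] := ffun_lin (fun i : 'I_#|I| => u (enum_val i)).
  have [q qE] := ffun_colin (fun i : 'I_#|I| => v (enum_val i)).
  exists #|I|; apply: (retract_summand (u := p) (v := q)) => x.
  rewrite qE [RHS]uv (reindex _ (onW_bij _ (enum_val_bij I))) /=.
  by apply: eq_bigr => i _; rewrite pE.
have [h hE] := pair_lin (idfun : {linear X -> X}) (\0 : {linear X -> N'}).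
(* [isomorphic] provides a bare inverse [g]; [linear_bij] supplies a linear one. *)
have [f' [_ f'K]] := linear_bij (can_inj fK) (bij_surj (Bijective fK gK)).
have f'C : cancel f f' by move=> x; apply: (can_inj fK); rewrite f'K.
apply: thru_trans (addin_ffun 'I_n M).
pose w : {linear _ -> _} := (fst : {linear (X * N')%type -> X}) \o f.
apply: (@addin_retract _ _ (f' \o h) w) => x.
by rewrite /w /= f'K hE.
Qed.

End Thru.

(** * Projective modules, syzygies and projective dimension *)

Section Projective.
Variable A : pzRingType.
Implicit Types F K M N P X Y Z W : lmodType A.
Local Notation A1 := (A^o : lmodType A).

Lemma scale_lin X (x : X) : exists h : {linear A1 -> X}, forall a : A, h a = a *: x.
Proof. by apply: linear_lift => a b c; rewrite scalerDl -scalerA. Qed.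

Lemma fin_gen_free X : fin_gen X ->
  exists (n : nat) (p : {linear {ffun 'I_n -> A1} -> X}), surjective p.
Proof.
move=> [n [g gP]]; have [v vE] := choice (fun i => scale_lin (g i)).
have [p pE] := ffun_colin v; exists n, p => x; have [c ->] := gP x.
exists [ffun i => c i : A1]; rewrite pE; apply: eq_bigr => i _.
by rewrite ffunE vE.
Qed.

Lemma regular_scale1 (a : A) : a *: (1 : A1) = a.
Proof. exact: mulr1. Qed.

Lemma fin_gen_regular : fin_gen A1.
Proof.
by exists 1%N, (fun=> 1) => x; exists (fun=> x); rewrite big_ord1 regular_scale1.
Qed.

Lemma fin_gen_addin M X : addin M X -> fin_gen M -> fin_gen X.
Proof.
move=> [I [u [v uv]]] [n [g gP]].
apply: (@fin_genI A X (I * 'I_n)%type (fun ij => v ij.1 (g ij.2))) => x.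
have [c cP] := choice (fun i => gP (u i x)).
exists (fun ij => c ij.1 ij.2).
rewrite [LHS]uv -(pair_bigA _ (fun i j => c i j *: v i (g j))) /=.
apply: eq_bigr => i _; rewrite {1}cP linear_sum.
by apply: eq_bigr => j _; rewrite linearZ.
Qed.

Lemma fin_gen_ffun (I : finType) M : fin_gen M -> fin_gen {ffun I -> M}.
Proof. exact/fin_gen_addin/addin_ffun. Qed.

(** It suffices to lift the elements [f (v i 1)]. The lifting holds along all surjections, whereas
    [projective] tests finitely generated modules only. *)
Lemma addin_lift P X Y (g : {linear X -> Y}) (f : {linear P -> Y}) :
  addin A1 P -> surjective g -> exists h : {linear P -> X}, forall p, g (h p) = f p.
Proof.
move=> [I [u [v uv]]] gS.
have [x xE] := choice (fun i => gS (f (v i 1))).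
have [w wE] := choice (fun i => scale_lin (x i)).
have [h hE] := sum_lin u w; exists h => p.
rewrite hE [in RHS](uv p) !linear_sum; apply: eq_bigr => i _.
rewrite wE linearZ /= xE -!linearZ; congr (f (v i _)).
by rewrite regular_scale1.
Qed.

Lemma projectiveP P : projective P <-> addin A1 P.
Proof.
split=> [[Pf PP]|PA].
  have [n [p pS]] := fin_gen_free Pf.
  have [|h hE] := PP _ _ p idfun _ Pf pS; first exact/fin_gen_ffun/fin_gen_regular.
  apply: thru_trans (addin_ffun 'I_n A1).
  exact: (addin_retract hE).
split; first exact: fin_gen_addin PA fin_gen_regular.
by move=> X Y g f _ _ gS; apply: addin_lift.
Qed.

Lemma projective_free (I : finType) : projective {ffun I -> A1}.
Proof. exact/projectiveP/addin_ffun. Qed.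

(* [X] is a direct summand of the sum of some [Y^n] and a projective module. *)
Definition sadd Y X : Prop := exists f : {linear X -> X},
  thru Y f /\ thru A1 (fun x => x - f x).

Lemma sadd_addin Y M X : sadd Y X -> addin M Y -> addin M A1 -> addin M X.
Proof.
move=> [f [Yf Af]] MY MA.
apply: thru_eq (thruD (thru_trans Yf MY) (thru_trans Af MA)) _ => x.
by rewrite addrC subrK.
Qed.

Lemma addin_sadd Y X : addin Y X -> sadd Y X.
Proof.
by exists idfun; split=> //; apply: thru_eq (thru0 _ _ _) _ => x; rewrite subrr.
Qed.

Lemma projective_sadd Y P : projective P -> sadd Y P.
Proof.
move=> /projectiveP PA; exists \0; split; first exact: thru0.
by apply: thru_eq PA _ => x; rewrite subr0.
Qed.

Lemma sadd_pair Y X X' : sadd Y X -> sadd Y X' -> sadd Y (X * X')%type.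
Proof.
move=> [f [Yf Af]] [g [Yg Ag]].
have [i iE] := pair_lin (idfun : {linear X -> X}) (\0 : {linear X -> X'}).
have [j jE] := pair_lin (\0 : {linear X' -> X}) (idfun : {linear X' -> X'}).
have [h hE] := pair_lin (f \o (fst : {linear (X * X')%type -> X}) : {linear _ -> _})
  (g \o (snd : {linear (X * X')%type -> X'}) : {linear _ -> _}).
exists h; split.
  apply: thru_eq (thruD (thru_comp i (fst : {linear (X * X')%type -> X}) Yf)
    (thru_comp j (snd : {linear (X * X')%type -> X'}) Yg)) _ => -[x y].
  by rewrite /= hE iE jE; congr pair; rewrite /= ?addr0 ?add0r.
apply: thru_eq (thruD (thru_comp i (fst : {linear (X * X')%type -> X}) Af)
  (thru_comp j (snd : {linear (X * X')%type -> X'}) Ag)) _ => -[x y].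
by rewrite /= hE iE jE; congr pair; rewrite /= ?addr0 ?add0r.
Qed.

(* A factorisation [f = sum v_j u_j] lifts termwise to the projective covers and
   then restricts to the syzygies. *)
Lemma sadd_syzygy K F Y K' F' Y'
    (i : {linear K -> F}) (p : {linear F -> Y})
    (i' : {linear K' -> F'}) (p' : {linear F' -> Y'}) :
  ses i p -> ses i' p' -> projective F -> projective F' -> sadd Y' Y -> sadd K' K.
Proof.
move=> s s' /projectiveP FA /projectiveP FA' [f [[J [u [v uv]]] [L [w [z wz]]]]].
have pS : surjective p by case: s.
have pS' : surjective p' by case: s'.
have [U UE] := choice (fun j => addin_lift (u j \o p : {linear _ -> _}) FA pS').
have [V VE] := choice (fun j => addin_lift (v j \o p' : {linear _ -> _}) FA' pS).
have [W WE] := choice (fun l => addin_lift (z l) (addin_refl A1) pS).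
have UiE j : exists g : {linear K -> K'}, forall x, i' (g x) = U j (i x).
  by apply: (ses_ker_map s s') => x; rewrite UE /= (ses0 _ s) raddf0.
have ViE j : exists g : {linear K' -> K}, forall x, i (g x) = V j (i' x).
  by apply: (ses_ker_map s' s) => x; rewrite VE /= (ses0 _ s') raddf0.
have [U' U'E] := choice UiE; have [V' V'E] := choice ViE.
(* [g] and [h] lift the two parts of the identity of [Y], so [d = 1 - g - h] lands in [K]. On [K]
   the map [h] vanishes, as it factors through [p], and [1 - f'] becomes [e \o i], which factors
   through [F]. *)
have [f' f'E] := sum_lin U' V'; have [g gE] := sum_lin U V.
have [h hE] := sum_lin (fun l => w l \o p : {linear _ -> _}) W.
have [d0 d0E] := sub_lin idfun g; have [d dE] := sub_lin d0 h.
have pd x : p (d x) = 0.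
  rewrite dE d0E gE hE !linearB !(linear_sum p) /=.
  rewrite (eq_bigr (fun j => v j (u j (p x)))) => [|j _]; last by rewrite VE /= UE.
  rewrite -uv [X in _ - X](eq_bigr (fun l => z l (w l (p x)))) => [|l _].
    by rewrite -wz subrr.
  by rewrite WE.
have [iI ip _] := s.
have [|e eE] := factor_inj (f := d) iI; first by move=> x; apply: (ip _).1; exact: pd.
exists f'; split; first by exists J, U', V'.
apply: thru_eq (thru_comp e i FA) _ => x /=; apply: iI.
rewrite eE dE d0E gE hE linearB f'E (linear_sum i) /= (ses0 _ s).
rewrite [X in _ - X]big1 ?subr0 => [|l _]; last by rewrite raddf0 raddf0.
by congr (_ - _); apply: eq_bigr => j _; rewrite V'E U'E.
Qed.

(** Projective dimension at most [d], one syzygy at a time; [projdim_le] links it to the infimum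
    over resolutions. *)
Fixpoint pdle (d : nat) Y : Prop :=
  if d is d'.+1 then
    exists K P (i : {linear K -> P}) (p : {linear P -> Y}),
      [/\ projective P, ses i p & pdle d' K]
  else projective Y.

Lemma pdle_fin_gen d Y : pdle d Y -> fin_gen Y.
Proof.
by case: d => [[]//|d] [K [P [i [p [[Pf _] [_ _ pS] _]]]]]; exact: fin_gen_surj pS Pf.
Qed.

Lemma fin_gen_sadd Y X : sadd Y X -> fin_gen Y -> fin_gen X.
Proof.
move=> YX Yf; apply: fin_gen_addin (fin_gen_pair Yf fin_gen_regular).
by apply: sadd_addin YX _ _; [exact: addin_fst|exact: addin_snd].
Qed.

Lemma ses_free X : fin_gen X ->
  exists n K (i : {linear K -> {ffun 'I_n -> A1}}) (p : {linear {ffun 'I_n -> A1} -> X}),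
    ses i p.
Proof.
move=> /fin_gen_free [n [p pS]]; have [K [i s]] := ses_ker pS.
by exists n, K, i, p.
Qed.

(** An iterated Schanuel lemma: the syzygies of [Y] and [Y'] stay related by [sadd], whatever
    presentations are used. *)
Lemma pdle_sadd d Y Y' : sadd Y' Y -> pdle d Y' -> pdle d Y.
Proof.
elim: d Y Y' => [|d IH] Y Y' YY' Yd; have Yf := fin_gen_sadd YY' (pdle_fin_gen Yd).
  apply/projectiveP; apply: sadd_addin YY' _ (addin_refl _).
  exact/projectiveP.
have [n [K [i [p s]]]] := ses_free Yf.
case: Yd => [K' [P' [i' [p' [P'P s' K'd]]]]].
exists K, {ffun 'I_n -> A1}, i, p; split=> //; first exact: projective_free.
by apply: IH K'd; apply: sadd_syzygy s s' _ P'P YY'; exact: projective_free.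
Qed.

(** [pdle] supplies some presentation of [Y]; the kernel of any other one agrees with it up to
    projective summands. *)
Lemma pdle_syzygy d K P Y (i : {linear K -> P}) (p : {linear P -> Y}) :
  ses i p -> projective P -> pdle d.+1 Y -> pdle d K.
Proof.
move=> s PP [K' [P' [i' [p' [P'P s' K'd]]]]].
by apply: pdle_sadd K'd; apply: sadd_syzygy s s' PP P'P (addin_sadd (addin_refl _)).
Qed.

Lemma pdle_resolution d Y : pdle d Y ->
  exists r : proj_resolution Y, resolution_length_le r d.
Proof.
elim: d Y => [|d IH] Y.
  move=> YP; pose O : lmodType A := {ffun 'I_0 -> A1}.
  have O0 : zero_module O by move=> x; apply/ffunP => -[].
  pose obj i : lmodType A := if i is 0 then Y else O.
  have objP i : projective (obj i) by case: i => //= i; exact: projective_free.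
  have S0 : surjective (idfun : {linear Y -> Y}) by move=> y; exists y.
  have ex0 : exact_at (\0 : {linear obj 1%N -> obj 0}) (idfun : {linear Y -> Y}).
    by move=> y; split=> [/= ->|[x <-]//]; exists 0.
  have ex1 i : exact_at (\0 : {linear obj i.+2 -> obj i.+1})
      (\0 : {linear obj i.+1 -> obj i}).
    by move=> y; split=> // _; exists 0; rewrite (O0 y).
  exists (@ProjResolution A Y obj (fun i => \0) idfun objP S0 ex0 ex1).
  by case.
move=> [K [P [i [p [PP [iI ip pS] /IH [r rd]]]]]].
pose obj j : lmodType A := if j is j'.+1 then res_obj r j' else P.
pose diff j : {linear obj j.+1 -> obj j} :=
  match j with 0 => i \o res_aug r | j'.+1 => res_diff r j' end.
have objP j : projective (obj j) by case: j => //= j; exact: res_proj.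
have ex0 : exact_at (diff 0) p.
  move=> y; split=> [/ip [x <-]|[x <-]]; last by apply/ip; exists (res_aug r x).
  by have [z <-] := @res_aug_surj _ _ r x; exists z.
have ex1 j : exact_at (diff j.+1) (diff j).
  case: j => [|j] y /=; last exact: res_exact.
  split=> [|/(@res_exact0 _ _ r) ->]; last exact: raddf0.
  by rewrite -(raddf0 i) => /iI /(@res_exact0 _ _ r).
exists (@ProjResolution A Y obj diff p objP pS ex0 ex1).
by case=> // j jd; exact: rd.
Qed.

Lemma resolution_pdle d Y (r : proj_resolution Y) :
  resolution_length_le r d -> pdle d Y.
Proof.
elim: d Y r => [|d IH] Y r rd.
  have augI : injective (res_aug r).
    apply: linear_inj => x /(@res_exact0 _ _ r) [y <-].
    by rewrite (rd 1%N isT y) raddf0.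
  have [g [gK Kg]] := linear_bij augI (@res_aug_surj _ _ r).
  apply/projectiveP; apply: thru_trans (addin_retract Kg) _.
  exact/projectiveP/res_proj.
have [K [i s]] := ses_ker (@res_aug_surj _ _ r).
exists K, (res_obj r 0), i, (res_aug r); split=> //; first exact: res_proj.
have [iI ip _] := s.
(* The first differential, corestricted to the kernel [K] of the augmentation, augments the shifted
   resolution. *)
have [|a aE] := factor_inj (f := res_diff r 0) iI.
  by move=> z; apply/ip/(@res_exact0 _ _ r); exists z.
have aS : surjective a.
  move=> y; have /(@res_exact0 _ _ r) [x xE] : res_aug r (i y) = 0 by apply/ip; exists y.
  by exists x; apply: iI; rewrite aE.
have ex0 : exact_at (res_diff r 1) a.
  move=> y; split=> [ay|[x <-]].
    by apply/(@res_exact _ _ r 0); rewrite -aE ay raddf0.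
  by apply: iI; rewrite aE raddf0; apply/(@res_exact _ _ r 0); exists x.
apply: (IH _ (@ProjResolution A K (fun j => res_obj r j.+1)
  (fun j => res_diff r j.+1) a (fun j => @res_proj _ _ r j.+1) aS ex0
  (fun j => @res_exact _ _ r j.+1))).
by move=> j jd; exact: rd.
Qed.

(** For resolutions, unlike for the recursion of [pdle], the bound is visibly monotone. *)
Lemma pdle_leq d e Y : (d <= e)%N -> pdle d Y -> pdle e Y.
Proof.
move=> de /pdle_resolution [r rd]; apply: (resolution_pdle (r := r)).
by move=> i ei; apply: rd; exact: leq_ltn_trans ei.
Qed.

(** The infimum ranges over natural numbers, so the failure of [pdle d] bounds it below by
    [d + 1]. *)
Lemma projdim_le d Y : (projdim Y <= d%:R%:E)%E <-> pdle d Y.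
Proof.
split=> [Yd|/pdle_resolution [r rd]]; last by apply: ereal_inf_lbound; exists r, d.
apply: contrapT => nYd.
suff : (d.+1%:R%:E <= projdim Y)%E.
  move=> /le_trans /(_ Yd); rewrite lee_fin ler_nat ltnn //.
apply: le_ereal_inf_tmp => _ [r [e [re ->]]]; rewrite lee_fin ler_nat ltnNge.
by apply/negP => /pdle_leq ed; apply/nYd/ed/resolution_pdle/re.
Qed.

Lemma gldim_le d :
  (gldim A <= d%:R%:E)%E <-> forall Y : lmodType A, fin_gen Y -> pdle d Y.
Proof.
split=> [Ad Y Yf|Ad].
  by apply/projdim_le; apply: le_trans Ad; apply: ereal_sup_ubound; exists Y.
by apply: ge_ereal_sup => _ [Y [Yf ->]]; apply/projdim_le/Ad.
Qed.

Lemma gldim_lt d :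
  (gldim A < d.+1%:R%:E)%E -> forall Y : lmodType A, fin_gen Y -> pdle d Y.
Proof.
move=> Ad Y Yf; have YA : (projdim Y <= gldim A)%E.
  by apply: ereal_sup_ubound; exists Y.
apply: contrapT => nYd.
suff : (d.+1%:R%:E <= projdim Y)%E.
  by move=> /le_lt_trans - /(_ _ (le_lt_trans YA Ad)); rewrite ltxx.
apply: le_ereal_inf_tmp => _ [r [e [re ->]]]; rewrite lee_fin ler_nat ltnNge.
by apply/negP => /pdle_leq ed; apply/nYd/ed/resolution_pdle/re.
Qed.

End Projective.

(** * Finite-dimensional vector spaces and restriction of scalars *)

Section VectorSpaces.
Variable k : fieldType.
Implicit Types V W : lmodType k.

(** Take a matrix of maximal rank among those whose row space lies in [S]: a vector of [S] outside
    that row space would raise the rank. *)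
Lemma subspace_mx n (S : 'rV[k]_n -> Prop) :
  S 0 -> (forall a x y, S x -> S y -> S (a *: x + y)) ->
  exists B : 'M[k]_n, forall v, S v <-> (v <= B)%MS.
Proof.
move=> S0 SL.
pose inS (B : 'M[k]_n) := forall v : 'rV_n, (v <= B)%MS -> S v.
pose Q r := `[< exists B : 'M[k]_n, inS B /\ \rank B = r >].
have Q0 : exists r, Q r.
  by exists 0%N; apply/asboolP; exists 0; rewrite mxrank0; split=> // v /submx0null ->.
have Qn r : Q r -> (r <= n)%N by move=> /asboolP [B [_ <-]]; exact: rank_leq_row.
case: (ex_maxnP Q0 Qn) => r /asboolP [B [BS Br]] rmax.
exists B => v; split=> [Sv|]; last exact: BS.
apply/negPn/negP => vB.
have : Q (\rank (v + B)%MS).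
  apply/asboolP; exists (v + B)%MS; split=> // w /sub_addsmxP [[a b] ->] /=.
  have [c ->] : exists c, a *m v = c *: v.
    by exists (a 0 0); rewrite -mul_scalar_mx -mx11_scalar.
  by apply: SL => //; apply/BS/submxMl.
move/rmax; rewrite -Br leqNgt => /negP; apply.
suff : (B < v + B)%MS by rewrite ltmxErank => /andP[].
rewrite ltmxE addsmxSr /=; apply: contra vB; exact/submx_trans/addsmxSl.
Qed.

Lemma rV_span V n (g : 'I_n -> V) :
  exists p : {linear 'rV[k]_n -> V}, forall c, p c = \sum_i c 0 i *: g i.
Proof.
apply: linear_lift => a x y; rewrite scaler_sumr -big_split; apply: eq_bigr => i _.
by rewrite !mxE scalerDl scalerA.
Qed.

Lemma fin_gen_rV V : fin_gen V ->
  exists n (f : {linear V -> 'rV[k]_n}) (g : {linear 'rV[k]_n -> V}),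
    cancel f g /\ cancel g f.
Proof.
move=> [n [a aP]]; have [p pE] := rV_span a.
have pS : surjective p.
  move=> v; have [c ->] := aP v; exists (\row_i c i); rewrite pE.
  by apply: eq_bigr => i _; rewrite mxE.
have [||B BP] := @subspace_mx n (fun c => p c = 0); first exact: raddf0.
  by move=> b x y px py; rewrite linearP px py scaler0 addr0.
(* The kernel of [p] is the row space of [B], so [p] is an isomorphism on a complement; [C] is a
   basis of one. *)
pose C := row_base (B^C)%MS.
have [|q qE] := @linear_lift _ 'rV_(\rank (B^C)) V (fun w => p (w *m C)).
  by move=> a' x y; rewrite mulmxDl -scalemxAl linearP.
have qI : injective q.
  apply: linear_inj => w; rewrite qE => /BP wB.
  have : (w *m C <= B :&: B^C)%MS.
    by rewrite sub_capmx wB (submx_trans (submxMl _ _)) // eq_row_base.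
  rewrite capmx_compl => /submx0null /(congr1 (mulmx^~ (pinvmx C))).
  by rewrite -mulmxA mulmxVp ?row_base_free // mulmx1 mul0mx.
have qS : surjective q.
  move=> v; have [c <-] := pS v.
  have /sub_addsmxP [[x y] /= cE] : (c <= B + B^C)%MS.
    by rewrite (submx_trans (submx1 c)) // sub1mx addsmx_compl_full.
  have /submxP [w wE] : (y *m B^C <= C)%MS by rewrite eq_row_base submxMl.
  exists w; rewrite qE cE linearD wE.
  by have /BP -> : (x *m B <= B)%MS; rewrite ?submxMl ?add0r.
by have [f [gK fK]] := linear_bij qI qS; exists (\rank (B^C)), f, q.
Qed.

Lemma fin_gen_sub V W (j : {linear W -> V}) : injective j -> fin_gen V -> fin_gen W.
Proof.
move=> jI /fin_gen_rV [n [f [g [fK gK]]]].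
have [||B BP] := @subspace_mx n (fun c => exists w, f (j w) = c).
- by exists 0; rewrite !raddf0.
- by move=> a _ _ [x <-] [y <-]; exists (a *: x + y); rewrite !linearP.
have [w wE] := choice (fun i => (BP (row i B)).2 (row_sub i B)).
exists n, w => x; have /submxP [c cE] : (f (j x) <= B)%MS by apply/BP; exists x.
exists (c 0); apply: jI; apply: (can_inj fK); rewrite cE mulmx_sum_row !linear_sum.
by apply: eq_bigr => i _; rewrite !linearZ wE.
Qed.

Lemma retraction_ex V W (j : {linear W -> V}) : injective j -> fin_gen V ->
  exists r : {linear V -> W}, cancel j r.
Proof.
move=> jI Vf; have [m [f [g [fK gK]]]] := fin_gen_rV Vf.
have [n [f' [g' [f'K g'K]]]] := fin_gen_rV (fin_gen_sub jI Vf).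
pose J := lin1_mx (f \o j \o g').
have JE x : f (j x) = f' x *m J by rewrite mul_rV_lin1 /= f'K.
have Jfree : row_free J.
  rewrite -kermx_eq0; apply/rowV0P => v /sub_kermxP vJ.
  apply: (can_inj g'K); apply: jI; apply: (can_inj fK).
  by rewrite JE g'K vJ !raddf0.
exists (g' \o mulmxr (pinvmx J) \o f) => x /=.
by rewrite JE -mulmxA mulmxVp // mulmx1 f'K.
Qed.

Lemma functional_sep V (v : V) : fin_gen V -> v != 0 ->
  exists phi : {linear V -> k^o}, phi v != 0.
Proof.
move=> /fin_gen_rV [n [f [g [fK _]]]] v0.
have [i fvi] : exists i, f v 0 i != 0.
  apply/existsP; rewrite -negb_forall; apply: contra v0 => /forallP fv.
  rewrite -(fK v) (_ : f v = 0) ?raddf0 //.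
  by apply/rowP => i; rewrite mxE; exact/eqP/fv.
have [|phi phiE] := @linear_lift _ V k^o (fun v => f v 0 i).
  by move=> a x y; rewrite linearP !mxE.
by exists phi; rewrite phiE.
Qed.

Lemma dim_le V m n (j : {linear 'rV[k]_m -> V}) (g : 'I_n -> V) :
  injective j -> (forall v, exists c : 'I_n -> k, v = \sum_i c i *: g i) ->
  (m <= n)%N.
Proof.
move=> jI gP; have [p pE] := rV_span g.
have [c cP] := choice (fun i => gP (j (delta_mx 0 i))).
pose J : 'M_(m, n) := \matrix_(i, l) c i l.
have JE v : p (v *m J) = j v.
  rewrite [v in RHS]row_sum_delta linear_sum mulmx_sum_row linear_sum.
  apply: eq_bigr => i _; rewrite !linearZ cP pE; congr (_ *: _).
  by apply: eq_bigr => l _; rewrite !mxE.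
suff /eqP <- : row_free J by exact: rank_leq_col.
rewrite -kermx_eq0; apply/rowV0P => v /sub_kermxP vJ.
by apply: jI; rewrite -JE vJ !raddf0.
Qed.

Lemma inj_surj V (f : {linear V -> V}) : fin_gen V -> injective f -> surjective f.
Proof.
move=> /fin_gen_rV [n [g [h [gK hK]]]] fI.
pose J := lin1_mx (g \o f \o h).
have JE x : g (f x) = g x *m J by rewrite mul_rV_lin1 /= gK.
have Jfree : row_free J.
  rewrite -kermx_eq0; apply/rowV0P => v /sub_kermxP vJ.
  apply: (can_inj hK); apply: fI; apply: (can_inj gK).
  by rewrite JE hK vJ !raddf0.
move: Jfree; rewrite row_free_unit => JU y; exists (h (g y *m invmx J)).
by apply: (can_inj gK); rewrite JE hK mulmxKV.
Qed.

End VectorSpaces.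

(** A synonym with the same carrier, able to bear a second scalar action, that of [k] through
    [iota]. *)
Definition restr (k : fieldType) (A : pzRingType) (iota : {rmorphism k -> A})
  (X : lmodType A) : Type := X.

Section Restriction.
Variables (k : fieldType) (A : pzRingType) (iota : {rmorphism k -> A}).
Implicit Types X Y Z : lmodType A.

Local Notation restr := (restr iota).

Section RestrInstance.
Variable X : lmodType A.
HB.instance Definition _ := GRing.Zmodule.on (restr X).
Definition restr_scale (c : k) (x : restr X) : restr X := iota c *: (x : X).
Fact restr_scaleA c d x : restr_scale c (restr_scale d x) = restr_scale (c * d) x.
Proof. by rewrite /restr_scale scalerA rmorphM. Qed.
Fact restr_scale1 : left_id 1 restr_scale.
Proof. by move=> x; rewrite /restr_scale rmorph1 scale1r. Qed.
Fact restr_scaleDr : right_distributive restr_scale +%R.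
Proof. by move=> c x y; rewrite /restr_scale scalerDr. Qed.
Fact restr_scaleDl x : {morph restr_scale^~ x : c d / c + d}.
Proof. by move=> c d; rewrite /restr_scale rmorphD scalerDl. Qed.
HB.instance Definition _ := GRing.Zmodule_isLmodule.Build k (restr X)
  restr_scaleA restr_scale1 restr_scaleDr restr_scaleDl.
Lemma restr_scaleE (c : k) (x : restr X) : c *: x = iota c *: (x : X).
Proof. by []. Qed.
End RestrInstance.

Lemma restr_lin X Y (f : {linear X -> Y}) :
  exists h : {linear restr X -> restr Y}, forall x, h x = f x.
Proof. by apply: (@linear_lift k) => a x y; rewrite !restr_scaleE linearP. Qed.

Lemma fin_gen_of_restr X : fin_gen (restr X) -> fin_gen X.
Proof.
move=> [n [g gP]]; exists n, g => x; have [c ->] := gP x.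
by exists (fun i => iota (c i)).
Qed.

Hypothesis A_fin : fin_gen (restr (A^o : lmodType A)).

Lemma fin_gen_restr X : fin_gen X -> fin_gen (restr X).
Proof.
have [n [a aP]] := A_fin; move=> [m [g gP]].
apply: (@fin_genI k (restr X) ('I_m * 'I_n)%type (fun ij => (a ij.2 : A) *: g ij.1)).
move=> x; have [c cE] := gP x; have [d dE] := choice (fun i => aP (c i)).
exists (fun ij => d ij.1 ij.2); rewrite cE.
rewrite -(pair_bigA _ (fun i j => d i j *: ((a j : A) *: g i : restr X))) /=.
apply: eq_bigr => i _; rewrite {1}dE scaler_suml.
by apply: eq_bigr => j _; rewrite !restr_scaleE scalerA.
Qed.

(** Noetherianity by dimension: [A] is finite over [k], and subspaces of finite-dimensional spaces
    are finite-dimensional. *)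
Lemma fin_gen_submodule X Y (j : {linear Y -> X}) :
  injective j -> fin_gen X -> fin_gen Y.
Proof.
move=> jI /fin_gen_restr Xf; apply: fin_gen_of_restr.
by have [h hE] := restr_lin j; apply: (fin_gen_sub (j := h)) => // x y; rewrite !hE => /jI.
Qed.

End Restriction.

(** * Modules over the endomorphism ring *)

Section Hom.
Variables (A : pzRingType) (M : lmodType A).
Local Notation G := (lin_end M).

Section HomInstance.
Variable X : lmodType A.

Definition lin_hom : Type := {linear X -> M}.
HB.instance Definition _ := gen_eqMixin lin_hom.
HB.instance Definition _ := gen_choiceMixin lin_hom.

Definition hom_fun (f : lin_hom) : {linear X -> M} := f.
Local Coercion hom_fun : lin_hom >-> GRing.Linear.type.

Lemma lin_hom_eq (f g : lin_hom) : (forall x : X, f x = g x) -> f = g.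
Proof.
case: f => f [[f1] [f2]]; case: g => g [[g1] [g2]] /= fg.
have e : f = g by apply/funext.
case: _ / e g1 g2 fg => g1 g2 _.
by rewrite (Prop_irrelevance g1 f1) (Prop_irrelevance g2 f2).
Qed.

Definition hom_zero : lin_hom := (\0 : X -> M) : {linear X -> M}.
Definition hom_opp (f : lin_hom) : lin_hom := (\- f : X -> M) : {linear X -> M}.
Definition hom_add (f g : lin_hom) : lin_hom := (f \+ g : X -> M) : {linear X -> M}.
Definition hom_scale (g : G) (f : lin_hom) : lin_hom :=
  (end_fun g \o f : X -> M) : {linear X -> M}.

Fact hom_addA : associative hom_add.
Proof. by move=> f g h; apply: lin_hom_eq => x; exact: addrA. Qed.
Fact hom_addC : commutative hom_add.
Proof. by move=> f g; apply: lin_hom_eq => x; exact: addrC. Qed.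
Fact hom_add0 : left_id hom_zero hom_add.
Proof. by move=> f; apply: lin_hom_eq => x; exact: add0r. Qed.
Fact hom_addN : left_inverse hom_zero hom_opp hom_add.
Proof. by move=> f; apply: lin_hom_eq => x; exact: addNr. Qed.
HB.instance Definition _ :=
  GRing.isZmodule.Build lin_hom hom_addA hom_addC hom_add0 hom_addN.

Fact hom_scaleA a b f : hom_scale a (hom_scale b f) = hom_scale (a * b) f.
Proof. exact: lin_hom_eq. Qed.
Fact hom_scale1 : left_id 1 hom_scale.
Proof. by move=> f; apply: lin_hom_eq. Qed.
Fact hom_scaleDr : right_distributive hom_scale +%R.
Proof. by move=> a f g; apply: lin_hom_eq => x; exact: (raddfD (end_fun a)). Qed.
Fact hom_scaleDl f : {morph hom_scale^~ f : a b / a + b}.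
Proof. by move=> a b; apply: lin_hom_eq. Qed.
HB.instance Definition _ := GRing.Zmodule_isLmodule.Build G lin_hom
  hom_scaleA hom_scale1 hom_scaleDr hom_scaleDl.

Lemma lin_homD (f g : lin_hom) x : (f + g) x = f x + g x.
Proof. by []. Qed.
Lemma lin_hom0 x : (0 : lin_hom) x = 0.
Proof. by []. Qed.
Lemma lin_homZ (a : G) (f : lin_hom) x : (a *: f) x = end_fun a (f x).
Proof. by []. Qed.
Lemma lin_hom_sum (I : finType) (F : I -> lin_hom) x :
  (\sum_i F i) x = \sum_i F i x.
Proof.
by apply: (big_morph (fun f : lin_hom => hom_fun f x)) => // f g; rewrite lin_homD.
Qed.

End HomInstance.

Local Coercion hom_fun : lin_hom >-> GRing.Linear.type.
Local Coercion end_fun : lin_end >-> GRing.Linear.type.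

Implicit Types X Y Z Q : lmodType A.

Lemma lin_end_sum (I : finType) (F : I -> G) x : (\sum_i F i) x = \sum_i F i x.
Proof. by apply: (big_morph (fun f : G => f x)). Qed.

Lemma precomp_lin X Y (u : {linear X -> Y}) :
  exists h : {linear lin_hom Y -> lin_hom X}, forall f x, h f x = f (u x).
Proof.
have [|h hE] := @linear_lift G (lin_hom Y) (lin_hom X)
  (fun f => (f \o u : X -> M) : {linear X -> M}).
  by move=> a f g; apply: lin_hom_eq.
by exists h => f x; rewrite hE.
Qed.

(** Precomposition with the [v i] gives maps from [Hom(X, M)] to [G]; together with the elements
    [u i] they form a dual basis. *)
Lemma hom_projective X : addin M X -> projective (lin_hom X).
Proof.
move=> [I [u [v uv]]]; apply/projectiveP.
have phi i : exists h : {linear lin_hom X -> (G^o : lmodType G)},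
    forall f (m : M), end_fun (h f) m = f (v i m).
  have [|h hE] := @linear_lift G (lin_hom X) (G^o)
    (fun f => (f \o v i : M -> M) : {linear M -> M}).
    by move=> a f g; apply: lin_end_eq.
  by exists h => f m; rewrite hE.
have [w wE] := choice phi.
have [z zE] := choice (fun i => scale_lin (u i : lin_hom X)).
exists I, w, z => f; apply: lin_hom_eq => x.
rewrite {1}[x]uv linear_sum lin_hom_sum; apply: eq_bigr => i _.
by rewrite zE lin_homZ wE.
Qed.

Lemma hom_ses X Q Z (i : {linear X -> Q}) (p : {linear Q -> Z})
    (i' : {linear lin_hom Q -> lin_hom X}) (p' : {linear lin_hom Z -> lin_hom Q}) :
  ses i p -> (forall f x, i' f x = f (i x)) -> (forall f x, p' f x = f (p x)) ->
  injective p' /\ exact_at p' i'.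
Proof.
move=> s i'E p'E; have [_ _ pS] := s; split.
  move=> f g fg; apply: lin_hom_eq => z; have [x <-] := pS z.
  by rewrite -!p'E fg.
move=> f; split=> [i'f|[g <-]].
  have [|g gE] := ses_coker_map (f := f) s.
    by move=> x; rewrite -i'E i'f.
  by exists g; apply: lin_hom_eq => x; rewrite p'E gE.
apply: lin_hom_eq => x; rewrite i'E p'E.
by rewrite (ses0 _ s) raddf0.
Qed.

(** The approximation property of [i] is the surjectivity of [Hom(Q, M) -> Hom(X, M)], which
    completes the left exact sequence to a projective resolution of length 1. *)
Lemma pdle1_hom X Q Z (i : {linear X -> Q}) (p : {linear Q -> Z}) :
  ses i p -> addin M Q -> addin M Z ->
  (forall f : {linear X -> M}, exists g : {linear Q -> M}, forall x, g (i x) = f x) ->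
  pdle 1 (lin_hom X).
Proof.
move=> s MQ MZ iM; have [i' i'E] := precomp_lin i; have [p' p'E] := precomp_lin p.
have [p'I p'i'] := hom_ses s i'E p'E.
exists (lin_hom Z), (lin_hom Q), p', i'; split; try exact: hom_projective.
split=> // f; have [g gE] := iM f.
by exists g; apply: lin_hom_eq => x; rewrite i'E gE.
Qed.

(* The kernel of [G^m -> G^n] is [Hom(X, M)] for the cokernel [X] of the
   transposed map [M^n -> M^m]. *)
Lemma free_ker_hom m n
    (r : {linear {ffun 'I_m -> (G^o : lmodType G)} -> {ffun 'I_n -> (G^o : lmodType G)}}) :
  fin_gen M ->
  exists X (t : {linear lin_hom X -> {ffun 'I_m -> (G^o : lmodType G)}}),
    [/\ fin_gen X, injective t & exact_at t r].
Proof.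
move=> Mf.
have [e eE] := choice (@ffun_inj G 'I_m (G^o : lmodType G)).
(* [g] is the matrix of [r]: the [j]-th component of [r c] is the sum of the [c i \o g i j]. The map
   [F : M^n -> M^m] below is its transpose. *)
pose g i j : {linear M -> M} := end_fun (r (e i 1) j).
have rE (c : {ffun 'I_m -> (G^o : lmodType G)}) j (x : M) :
    end_fun (r c j) x = \sum_i end_fun (c i) (g i j x).
  rewrite {1}(ffun_sum_inj c eE) linear_sum sum_ffunE lin_end_sum.
  apply: eq_bigr => i _; rewrite -[c i in LHS](regular_scale1 (c i : G)).
  by rewrite !linearZ ffunE.
have [b bE] := choice (@ffun_inj A 'I_n M).
have [d dE] := choice (@ffun_inj A 'I_m M).
have [f fE] := choice (fun i => ffun_colin (fun j => g i j)).
have [F FE] := ffun_lin f.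
have [X [q [qS Fq]]] := coker_ex F.
have [t tE] : exists t : {linear lin_hom X -> {ffun 'I_m -> (G^o : lmodType G)}},
    forall h i x, end_fun (t h i) x = h (q (d i x)).
  have pre i : exists t : {linear lin_hom X -> (G^o : lmodType G)},
      forall h x, end_fun (t h) x = h (q (d i x)).
    have [|t tE] := @linear_lift G (lin_hom X) (G^o)
      (fun h => (h \o (q \o d i) : M -> M) : {linear M -> M}).
      by move=> a h h'; apply: lin_end_eq.
    by exists t => h x; rewrite tE.
  have [t tE] := choice pre; have [T TE] := ffun_lin t.
  by exists T => h i x; rewrite TE tE.
have tsum (h : lin_hom X) x : h (q x) = \sum_i end_fun (t h i) (x i).
  by rewrite {1}(ffun_sum_inj x dE) !linear_sum; apply: eq_bigr => i _; rewrite tE.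
exists X, t; split.
- exact: fin_gen_surj qS (fin_gen_ffun _ Mf).
- move=> h h' hh'; apply: lin_hom_eq => y; have [x <-] := qS y.
  by rewrite !tsum hh'.
move=> c; split=> [rc|[h <-]].
  (* The row [c] is a map [H : M^m -> M]; [r c = 0] says that [H] kills the image of [F], so it
     descends to the cokernel [X]. *)
  have [H HE] := ffun_colin (fun i => end_fun (c i)).
  have [|h hE] := @factor_surj A _ _ _ q H qS.
    move=> _ /Fq [y <-]; rewrite HE.
    under eq_bigr do rewrite FE fE linear_sum.
    rewrite exchange_big big1 // => j _.
    by rewrite -rE rc ffunE.
  exists (h : lin_hom X); apply/ffunP => i; apply: lin_end_eq => x.
  rewrite tE /hom_fun hE HE (bigD1 i) //= dE eqxx big1 ?addr0 // => l il.
  by rewrite dE (negPf il) raddf0.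
apply/ffunP => j; apply: lin_end_eq => x; rewrite rE ffunE.
have -> : \sum_i end_fun (t h i) (g i j x) = h (q (F (b j x))).
  rewrite tsum; apply: eq_bigr => i _; rewrite FE fE (bigD1 j) //= bE eqxx.
  by rewrite big1 ?addr0 // => l lj; rewrite bE (negPf lj) raddf0.
have -> : q (F (b j x)) = 0 by apply/Fq; exists (b j x).
by rewrite raddf0.
Qed.

(** The bound is [2 + 1]: two steps of a free resolution reach some [Hom(X, M)], which has
    projective dimension at most 1. *)
Lemma gldim_end_le :
  fin_gen M ->
  (forall (X Y : lmodType G) (j : {linear Y -> X}),
    injective j -> fin_gen X -> fin_gen Y) ->
  (forall X, fin_gen X -> pdle 1 (lin_hom X)) ->
  (gldim G <= 3%:R%:E)%E.
Proof.
move=> Mf noeth Mpd; apply/gldim_le => Y Yf.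
have [n [K [i [p s]]]] := ses_free Yf; have [iI _ _] := s.
have Kf : fin_gen K by apply: noeth iI _; case: (projective_free G 'I_n).
have [m [q qS]] := fin_gen_free Kf.
have [X [t [Xf tI tr]]] := free_ker_hom (i \o q : {linear _ -> _}) Mf.
exists K, {ffun 'I_n -> (G^o : lmodType G)}, i, p; split=> //; first exact: projective_free.
exists (lin_hom X), {ffun 'I_m -> (G^o : lmodType G)}, t, q; split; last exact: Mpd.
  exact: projective_free.
split=> // y; rewrite -(tr y) /=.
by split=> [->|]; [rewrite raddf0|rewrite -{1}(raddf0 i) => /iI].
Qed.

Hypothesis noethA : forall X Y (j : {linear Y -> X}),
  injective j -> fin_gen X -> fin_gen Y.

(** Apply [Hom(-, M)] to a free presentation of [X]. As [A] lies in [add M], the two free terms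
    become projective, so [Hom(X, M)] is a second syzygy, namely of the cokernel [Y]. *)
Lemma pdle_hom d X : addin M (A^o : lmodType A) -> fin_gen X ->
  (forall Y : lmodType G, fin_gen Y -> pdle d.+2 Y) -> pdle d (lin_hom X).
Proof.
move=> MA Xf Gd.
have [m [K [i [p s]]]] := ses_free Xf; have [iI ip pS] := s.
have Kf : fin_gen K by apply: noethA iI _; case: (projective_free A 'I_m).
have [n [q qS]] := fin_gen_free Kf.
have free_proj l : projective (lin_hom {ffun 'I_l -> (A^o : lmodType A)}).
  exact/hom_projective/(thru_trans (addin_ffun _ _)).
have [p' p'E] := precomp_lin p.
have [f fE] := precomp_lin (i \o q : {linear _ -> _}).
have [Y [c [cS fc]]] := coker_ex f.
have [I [j s']] := ses_ker cS; have [jI jc _] := s'.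
have [|a aE] := factor_inj (f := f) jI.
  by move=> h; apply: (jc _).1; apply/fc; exists h.
have sa : ses p' a.
  have [i' i'E] := precomp_lin i.
  have [p'I p'i'] := hom_ses s i'E p'E; split=> //.
    move=> h; rewrite -p'i'; split=> [ah|i'h].
      apply: lin_hom_eq => x; have [y <-] := qS x.
      by rewrite i'E -[h _]fE -aE ah raddf0.
    apply: jI; rewrite aE raddf0; apply: lin_hom_eq => x.
    by rewrite fE /= -i'E i'h.
  move=> y; have /fc [x xE] : c (j y) = 0 by apply/jc; exists y.
  by exists x; apply: jI; rewrite aE.
have Yf : fin_gen Y by apply: fin_gen_surj cS _; case: (free_proj n).
exact: pdle_syzygy sa (free_proj m) (pdle_syzygy s' (free_proj n) (Gd Y Yf)).
Qed.

(* Evaluation identifies [X] with [Hom_G(Hom(X, M), M)] because [M] cogenerates,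
   so that a dual basis of [Hom(X, M)] splits off [X] from a power of [M]. *)
Lemma hom_projective_addin X : fin_gen M -> fin_gen X ->
  (forall (C : lmodType A) (c : C), fin_gen C -> c != 0 -> exists g : {linear C -> M}, g c != 0) ->
  projective (lin_hom X) -> addin M X.
Proof.
move=> Mf Xf cog /projectiveP [I [u [v uv]]].
have sep x y : (forall h : lin_hom X, h x = h y) -> x = y.
  move=> hxy; apply/subr0_eq/eqP; apply: contrapT => /negP xy.
  have [g] := cog X (x - y) Xf xy.
  have gxy : g x = g y := hxy g.
  by rewrite linearB gxy subrr eqxx.
pose h i : lin_hom X := v i (1 : G).
have hE (f : lin_hom X) x : f x = \sum_i end_fun (u i f) (h i x).
  rewrite {1}(uv f) lin_hom_sum; apply: eq_bigr => i _.
  by rewrite -[u i f in LHS](regular_scale1 (u i f : G)) linearZ.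
have [E EE] := ffun_lin (fun i => hom_fun (h i)).
have [C [q [qS Eq]]] := coker_ex E.
have Cf : fin_gen C by exact: fin_gen_surj qS (fin_gen_ffun I Mf).
have [d dE] := choice (@ffun_inj A I M).
(* Such an [x] exists once [z] is in the image of [E]. Otherwise [g] separates [z] from that image;
   its components satisfy a relation [\sum gj *: h j = 0], which the linear map [u i] turns into
   [g (q z) = 0]. *)
have ev i m : exists x : X, forall f : lin_hom X, f x = end_fun (u i f) m.
  pose z : {ffun I -> M} := [ffun j => end_fun (u i (h j)) m].
  have [x xE] : exists x, E x = z.
    apply/Eq; apply/eqP; apply: contrapT => /negP /(cog _ _ Cf) [g].
    pose gj j : G := (g \o q \o d j : M -> M) : {linear M -> M}.
    have gE y : g (q y) = \sum_j end_fun (gj j) (y j).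
      by rewrite {1}(ffun_sum_inj y dE) !linear_sum.
    have g0 : \sum_j gj j *: h j = 0 :> lin_hom X.
      apply: lin_hom_eq => x; rewrite lin_hom_sum lin_hom0.
      transitivity (g (q (E x))).
        by rewrite gE; apply: eq_bigr => j _; rewrite EE.
      by have -> : q (E x) = 0; [apply/Eq; exists x|rewrite raddf0].
    rewrite gE; have -> : \sum_j end_fun (gj j) (z j) = end_fun (u i (\sum_j gj j *: h j)) m.
      rewrite linear_sum lin_end_sum; apply: eq_bigr => j _.
      by rewrite linearZ ffunE.
    by rewrite g0 raddf0 eqxx.
  exists x => f; rewrite hE.
  have {2}-> : f = \sum_j (u j f : G) *: h j.
    by apply: lin_hom_eq => y; rewrite lin_hom_sum hE.
  rewrite linear_sum lin_end_sum; apply: eq_bigr => j _; rewrite linearZ /=.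
  by rewrite -EE xE ffunE.
have xL i : exists w : {linear M -> X}, forall m (f : lin_hom X), f (w m) = end_fun (u i f) m.
  have [x xE] := choice (ev i).
  have [|w wE] := @linear_lift A M X x; last by exists w => m f; rewrite wE xE.
  by move=> a m m'; apply: sep => f; rewrite linearP !xE linearP.
have [w wE] := choice xL.
exists I, (fun i => hom_fun (h i)), w => y; apply: sep => f.
by rewrite linear_sum hE; apply: eq_bigr => i _; rewrite wE.
Qed.

End Hom.

(** * The endomorphism ring as a finite-dimensional algebra *)

Section EndAlgebra.
Variables (k : fieldType) (A : pzRingType) (iota : {rmorphism k -> A}).
Hypothesis iotaC : forall c a, iota c * a = a * iota c.
Hypothesis A_fin : fin_gen (restr iota (A^o : lmodType A)).
Variable M : lmodType A.

Fact end_scal_linear c : linear (fun x : M => iota c *: x).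
Proof. by move=> a x y; rewrite scalerDr !scalerA iotaC. Qed.

Definition end_scal (c : k) : lin_end M :=
  HB.pack_for {linear M -> M} (fun x : M => iota c *: x)
    (GRing.isLinear.Build A M M *:%R (fun x : M => iota c *: x) (end_scal_linear c)).

Fact end_scal_zmod : zmod_morphism end_scal.
Proof.
by move=> c d; apply: lin_end_eq => x; rewrite /= rmorphB scalerBl.
Qed.
Fact end_scal_monoid : monoid_morphism end_scal.
Proof.
split=> [|c d]; apply: lin_end_eq => x /=; first by rewrite rmorph1 scale1r.
by rewrite rmorphM scalerA.
Qed.
HB.instance Definition _ := GRing.isZmodMorphism.Build k (lin_end M) end_scal end_scal_zmod.
HB.instance Definition _ := GRing.isMonoidMorphism.Build k (lin_end M) end_scal end_scal_monoid.

(** An endomorphism is determined by its values on generators, so the ring embeds [k]-linearly in a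
    finite power of [M]. *)
Lemma lin_end_fin : fin_gen M ->
  fin_gen (restr (end_scal : {rmorphism k -> lin_end M}) ((lin_end M)^o : lmodType (lin_end M))).
Proof.
move=> Mf; have Rf := fin_gen_restr A_fin Mf; have [n [g gP]] := Mf.
set V := restr _ _.
have [|j jE] := @linear_lift k V {ffun 'I_n -> restr iota M}
  (fun f => [ffun i => end_fun f (g i) : restr iota M]).
  by move=> c f f'; apply/ffunP => i; rewrite !ffunE.
apply: (fin_gen_sub (j := j)) (fin_gen_ffun _ Rf) => f f'; rewrite !jE => /ffunP ff'.
apply: lin_end_eq => x; have [c ->] := gP x; rewrite !linear_sum.
by apply: eq_bigr => i _; rewrite !linearZ; have := ff' i; rewrite !ffunE => ->.
Qed.

End EndAlgebra.

(** * The exterior algebra is selfinjective *)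

Section ExtModules.
Variable k : fieldType.
Local Notation L := (ext_alg k).
Local Notation L1 := (L^o : lmodType L).
Local Notation iota := (GRing.in_alg L : {rmorphism k -> L}).
Local Notation restr := (restr iota).
Implicit Types X Y Z P : lmodType L.

Lemma in_alg_central (c : k) (a : L) : iota c * a = a * iota c.
Proof. by rewrite /= mulr_algl mulr_algr. Qed.

Lemma ext_actE X (u : L) (x : restr X) :
  u *: (x : X) = coef1 u *: x + coefa u *: ((alpha k *: (x : X)) : restr X)
    + coefb u *: ((beta k *: (x : X)) : restr X)
    + coefab u *: (((alpha k * beta k) *: (x : X)) : restr X).
Proof.
rewrite {1}(ext_algE u) !restr_scaleE /= !scalerDl.
by rewrite !scalerA !mulr_algl.
Qed.

Lemma ext_fin : fin_gen (restr L1).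
Proof.
exists 4, (fun i : 'I_4 => nth 0 [:: 1; alpha k; beta k; alpha k * beta k] i) => x.
exists (fun i : 'I_4 => nth 0 [:: coef1 x; coefa x; coefb x; coefab x] i).
have sE (c : k) (a : L) : c *: (a : restr L1) = c *: a :> L := mulr_algl c a.
by rewrite !big_ord_recl big_ord0 addr0 /= {1}(ext_algE x) -!addrA !sE.
Qed.

Lemma fin_gen_sub_ext X Y (j : {linear Y -> X}) :
  injective j -> fin_gen X -> fin_gen Y.
Proof. exact: (fin_gen_submodule ext_fin). Qed.

Lemma fin_gen_sub_end X (U V : lmodType (lin_end X)) (j : {linear V -> U}) :
  fin_gen X -> injective j -> fin_gen U -> fin_gen V.
Proof.
move=> /(lin_end_fin in_alg_central ext_fin) Ef; exact: (fin_gen_submodule Ef).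
Qed.

(* The map [X -> L] with [coefab]-component [phi]: [L] is a Frobenius algebra
   with trace form [coefab]. *)
Lemma ext_dual X (phi : {linear restr X -> k^o}) :
  exists h : {linear X -> L1}, forall x,
    h x = ExtAlg (phi ((alpha k * beta k) *: (x : X))) (- phi (beta k *: (x : X)))
            (phi (alpha k *: (x : X))) (phi x).
Proof.
have phiE (u : L) (x : X) : phi (u *: x) = coef1 u * phi x
    + coefa u * phi (alpha k *: x) + coefb u * phi (beta k *: x)
    + coefab u * phi ((alpha k * beta k) *: x).
  by rewrite ext_actE !linearD !linearZ.
apply: linear_lift => u x y; rewrite !scalerDr !scalerA !linearD.
rewrite (phiE (alpha k * beta k * u)) (phiE (beta k * u)) (phiE (alpha k * u)) (phiE u).
by congr ExtAlg => /=; ring.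
Qed.

(** For [P = L], extend the functional [coefab \o g] along a [k]-linear retraction of [j] and turn
    it back into an [L]-linear map by [ext_dual]; the general case follows componentwise. *)
Lemma ext_selfinjective X Y P (j : {linear X -> Y}) (f : {linear X -> P}) :
  addin L1 P -> injective j -> fin_gen Y ->
  exists h : {linear Y -> P}, forall x, h (j x) = f x.
Proof.
move=> [I [u [v uv]]] jI Yf.
have ext (g : {linear X -> L1}) : exists h : {linear Y -> L1}, forall x, h (j x) = g x.
  have [j' j'E] := restr_lin iota j.
  have [|r rK] := @retraction_ex k (restr Y) (restr X) j' _ (fin_gen_restr ext_fin Yf).
    by move=> x y; rewrite !j'E => /jI.
  have [|phi phiE] := @linear_lift k (restr Y) k^o (fun y => coefab (g (r y))).
    move=> c x y; rewrite linearP restr_scaleE linearP /GRing.scale /=.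
    by ring.
  have [h hE] := ext_dual phi; exists h => x.
  (* Pairing with [alpha beta], [beta], [alpha] and [1] reads off the four coefficients of [g x],
     the second one with a minus sign. *)
  have phij (a : L) : phi (a *: j x) = coefab (a * g x).
    by rewrite phiE -linearZ -j'E rK linearZ.
  rewrite hE !phij -[j x]scale1r phij mul1r.
  by case: (g x) => a b c d; congr ExtAlg => /=; ring.
have [w wE] := choice (fun i => ext (u i \o f : {linear _ -> _})).
have [h hE] := sum_lin w v; exists h => x.
by rewrite hE [RHS]uv; apply: eq_bigr => i _; rewrite wE.
Qed.

Lemma ext_cogenerator X (x : X) : fin_gen X -> x != 0 ->
  exists h : {linear X -> L1}, h x != 0.
Proof.
move=> Xf x0; have [phi phix] := functional_sep (fin_gen_restr ext_fin Xf) x0.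
have [h hE] := ext_dual phi; exists h; apply: contra phix.
by rewrite hE => /eqP[_ _ _ ->].
Qed.

Lemma ext_embedding X : fin_gen X ->
  exists n (j : {linear X -> {ffun 'I_n -> L1}}), injective j.
Proof.
move=> Xf; have [n [f [g [fK _]]]] := fin_gen_rV (fin_gen_restr ext_fin Xf).
have dual i : exists h : {linear X -> L1}, forall x, coefab (h x) = f x 0 i.
  have [|phi phiE] := @linear_lift k (restr X) k^o (fun x => f x 0 i).
    by move=> c x y; rewrite linearP !mxE.
  by have [h hE] := ext_dual phi; exists h => x; rewrite hE /= phiE.
have [h hE] := choice dual; have [j jE] := ffun_lin h.
exists n, j => x y xy; apply: (can_inj fK); apply/rowP => i.
by rewrite -!hE -!jE xy.
Qed.

(** An injective module embeds in a free module and splits off, so the cogenerator condition also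
    reduces to [L]. *)
Lemma ext_generator_cogenerator M : fin_gen M -> addin M L1 -> generator_cogenerator M.
Proof.
move=> Mf ML; split=> // X.
  by move=> /projectiveP XP _; apply/addinP/(thru_trans XP).
move=> [Xf XI] _; have [n [j jI]] := ext_embedding Xf.
have [|h hE] := XI _ _ j idfun Xf _ jI; first exact/fin_gen_ffun/fin_gen_regular.
apply/addinP/(@thru_trans _ L1) => //.
apply: thru_trans (addin_ffun 'I_n L1); exact: (addin_retract hE).
Qed.

(* Dual of [sadd_syzygy]. *)
Lemma sadd_cosyzygy (K F Y K' F' Y' : lmodType L)
    (i : {linear K -> F}) (p : {linear F -> Y})
    (i' : {linear K' -> F'}) (p' : {linear F' -> Y'}) :
  ses i p -> ses i' p' -> projective F -> projective F' -> sadd K' K -> sadd Y' Y.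
Proof.
move=> s s' FP FP' [f [[J [u [v uv]]] [I [w [z wz]]]]].
have [/projectiveP FA /projectiveP FA'] := (FP, FP').
have [[iI ip pS] [iI' ip' pS']] := (s, s').
have [[Ff _] [Ff' _]] := (FP, FP').
have [U UE] := choice (fun j => ext_selfinjective (i' \o u j : {linear _ -> _}) FA' iI Ff).
have [V VE] := choice (fun j => ext_selfinjective (i \o v j : {linear _ -> _}) FA iI' Ff').
have [W WE] := choice (fun l => ext_selfinjective (w l) (addin_refl L1) iI Ff).
have UpE j : exists g : {linear Y -> Y'}, forall x, g (p x) = p' (U j x).
  have [|g gE] := ses_coker_map (f := p' \o U j : {linear _ -> _}) s; last by exists g.
  by move=> x; rewrite /= UE /= (ses0 _ s').
have VpE j : exists g : {linear Y' -> Y}, forall x, g (p' x) = p (V j x).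
  have [|g gE] := ses_coker_map (f := p \o V j : {linear _ -> _}) s'; last by exists g.
  by move=> x; rewrite /= VE /= (ses0 _ s).
have [U' U'E] := choice UpE; have [V' V'E] := choice VpE.
have [f' f'E] := sum_lin U' V'; have [g gE] := sum_lin U V.
have [h hE] := sum_lin W (fun l => i \o z l : {linear _ -> _}).
have [d0 d0E] := sub_lin idfun g; have [d dE] := sub_lin d0 h.
have di x : d (i x) = 0.
  rewrite dE d0E gE hE /= -[X in X - _ - _ = _]/(i x).
  rewrite (eq_bigr (fun j => i (v j (u j x)))) => [|j _]; last by rewrite UE /= VE.
  rewrite -(linear_sum i) -uv [X in _ - X](eq_bigr (fun l => i (z l (w l x)))) => [|l _].
    by rewrite -(linear_sum i) -wz linearB subrr.
  by rewrite WE.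
have [e eE] := ses_coker_map s di.
exists f'; split; first by exists J, U', V'.
apply: thru_eq (thru_comp p e FA) _ => y /=; have [x <-] := pS y.
rewrite eE dE d0E gE hE f'E !(linearB p) !(linear_sum p) /=.
rewrite [X in _ - X]big1 ?subr0 => [|l _]; last exact: ses0 s.
by congr (_ - _); apply: eq_bigr => j _; rewrite U'E V'E.
Qed.

End ExtModules.

(** * Left approximations and their syzygies *)

Section Approximations.
Variable k : fieldType.
Local Notation L := (ext_alg k).
Local Notation L1 := (L^o : lmodType L).
Local Notation iota := (GRing.in_alg L : {rmorphism k -> L}).
Local Notation restr := (restr iota).
Implicit Types X Y Z P C T Q : lmodType L.

(* [0 -> X -> Q -> C -> 0] with [Q] in [add (L (+) T)] and [X -> Q] a left
   approximation; maps to [L] need not be mentioned because [L] is injective. *)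
Definition approx T X C : Prop :=
  exists Q (i : {linear X -> Q}) (p : {linear Q -> C}),
    [/\ ses i p, sadd T Q &
      forall h : {linear X -> T}, exists g : {linear Q -> T}, forall x, g (i x) = h x].

Section Transfer.
Variables (T' P T X' I X C' P1 C : lmodType L).
Variables (jT : {linear T' -> P}) (qT : {linear P -> T}).
Variables (jX : {linear X' -> I}) (qX : {linear I -> X}).
Variables (jC : {linear C' -> P1}) (qC : {linear P1 -> C}).
Hypotheses (sT : ses jT qT) (sX : ses jX qX) (sC : ses jC qC).
Hypotheses (PP : projective P) (IP : projective I) (P1P : projective P1).

Let IP1P : projective (I * P1)%type.
Proof. by apply/projectiveP/addin_pair; exact/projectiveP. Qed.

(** A horseshoe construction: [I (+) P1] maps onto [Q], and the kernel [K] is an extension of [C']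
    by [X']. *)
Lemma approx_syzygy : approx T X C -> approx T' X' C'.
Proof.
move=> [Q [i [p [s TQ iT]]]].
have [[iI ip pS] [jTI jqT qTS]] := (s, sT).
have [[jXI jqX qXS] [jCI jqC qCS]] := (sX, sC).
have [If _] := IP; have [IP1f _] := IP1P.
have [/projectiveP PA /projectiveP P1A] := (PP, P1P).
have [r rE] := addin_lift qC P1A pS.
have [w wE] := copair_lin (i \o qX : {linear _ -> _}) r.
have [K [c [cI cw]]] := ker_ex w.
have wS : surjective w.
  move=> y; have [b bE] := qCS (p y).
  have /ip [x xE] : p (y - r b) = 0 by rewrite linearB rE bE subrr.
  have [a aE] := qXS x; exists (a, b).
  by rewrite wE /= aE xE subrK.
have sK : ses c w by [].
have [e eE] := pair_lin jX (\0 : {linear X' -> P1}).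
have [|i' i'E] := factor_inj (f := e) cI.
  by move=> x; apply/cw; rewrite eE wE /= (ses0 _ sX) !raddf0 addr0.
have [|p' p'E] := factor_inj (f := (snd : {linear (I * P1)%type -> P1}) \o c : {linear _ -> _}) jCI.
  move=> y; apply/jqC; rewrite /= -rE.
  have : w (c y) = 0 by apply/cw; exists y.
  by rewrite wE /= => /(congr1 p); rewrite linearD (ses0 _ s) add0r raddf0.
exists K, i', p'; split.
- split.
  + move=> x y xy; apply: jXI; have : c (i' x) = c (i' y) by rewrite xy.
    by rewrite !i'E !eE => -[].
  + move=> y; split=> [p'y|[x <-]]; last first.
      by apply: jCI; rewrite p'E /= i'E eE raddf0.
    have cy2 : (c y).2 = 0 by rewrite -[LHS]p'E p'y raddf0.
    have : w (c y) = 0 by apply/cw; exists y.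
    rewrite wE cy2 raddf0 addr0 -(raddf0 i) => /iI /jqX [x xE].
    by exists x; apply: cI; rewrite i'E eE xE /= -[0]cy2; case: (c y).
  + move=> z; have /ip [x xE] : p (- r (jC z)) = 0.
      by rewrite linearN rE (ses0 _ sC) oppr0.
    have [a aE] := qXS x.
    have /cw [y yE] : w (a, jC z) = 0 by rewrite wE /= aE xE addNr.
    by exists y; apply: jCI; rewrite p'E /= yE.
- exact: sadd_syzygy sK sT IP1P PP TQ.
(* A map [X' -> T'] is carried to [X -> T] by way of [I -> P], extended to [Q], and brought back to
   the kernels. *)
move=> h'; have [g gE] := ext_selfinjective (jT \o h' : {linear _ -> _}) PA jXI If.
have [|h hE] := ses_coker_map (f := qT \o g : {linear _ -> _}) sX.
  by move=> x; rewrite /= gE /= (ses0 _ sT).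
have [h0 h0E] := iT h.
have [F FE] := addin_lift (h0 \o w : {linear _ -> _}) (iffLR (projectiveP _) IP1P) qTS.
have [|h1 h1E] := factor_inj (f := F \o c : {linear _ -> _}) jTI.
  by move=> y; apply/jqT; rewrite /= FE /=; have -> : w (c y) = 0; [apply/cw; exists y|rewrite raddf0].
have [inl inlE] := pair_lin (idfun : {linear I -> I}) (\0 : {linear I -> P1}).
(* On [X'] the map [h1] is [F \o inl] and not yet [h']. The error [D] sends [I] into [T'], so it is
   repaired through the first component of [K]. *)
have [D DE] := sub_lin g (F \o inl : {linear _ -> _}).
have [|d dE] := factor_inj (f := D) jTI.
  move=> a; apply/jqT; rewrite DE linearB /= FE /= wE inlE /= raddf0 addr0.
  by rewrite h0E hE subrr.
have [h2 h2E] := add_lin h1 (d \o (fst : {linear (I * P1)%type -> I}) \o c : {linear _ -> _}).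
exists h2 => x; apply: jTI; rewrite h2E linearD h1E /= dE DE i'E eE /= gE inlE /=.
by rewrite addrC subrK.
Qed.

(** The mirror image of [approx_syzygy]: [Q] embeds in [I (+) P1] and [K] is the cokernel. Liftings
    become extensions, which require finitely generated targets. *)
Lemma approx_cosyzygy : approx T' X' C' -> approx T X C.
Proof.
move=> [Q [i [p [s TQ iT]]]].
have [[iI ip pS] [jTI jqT qTS]] := (s, sT).
have [[jXI jqX qXS] [jCI jqC qCS]] := (sX, sC).
have [[If _] [IP1f _]] := (IP, IP1P); have [Pf _] := PP.
have [/projectiveP PA /projectiveP IA] := (PP, IP).
have T'f : fin_gen T' := fin_gen_sub_ext jTI Pf.
have Qf : fin_gen Q := fin_gen_sadd TQ T'f.
have [r rE] := ext_selfinjective jX IA iI Qf.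
have [w wE] := pair_lin r (jC \o p : {linear _ -> _}).
have wI : injective w.
  apply: linear_inj => y; rewrite wE => -[ry] /=; rewrite -(raddf0 jC) => /jCI /ip [x xE].
  by move: ry; rewrite -xE rE -(raddf0 jX) => /jXI ->; rewrite raddf0.
have [K [c [cS wc]]] := coker_ex w.
have sK : ses w c by [].
have [inl inlE] := pair_lin (idfun : {linear I -> I}) (\0 : {linear I -> P1}).
have [|i' i'E] := ses_coker_map (f := c \o inl : {linear _ -> _}) sX.
  move=> x; apply/wc; exists (i x).
  by rewrite wE rE inlE /= (ses0 _ s) raddf0.
have [|p' p'E] := ses_coker_map (f := qC \o (snd : {linear (I * P1)%type -> P1}) : {linear _ -> _}) sK.
  by move=> y; rewrite /= wE /= (ses0 _ sC).
have sK' : ses i' p'.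
  split.
  + apply: linear_inj => x; have [a <-] := qXS x.
    rewrite i'E /= => /wc [y]; rewrite wE inlE /= => -[<-].
    rewrite -(raddf0 jC) => /jCI /ip [z <-].
    by rewrite rE (ses0 _ sX).
  + move=> y; split=> [|[x <-]]; last first.
      by have [a <-] := qXS x; rewrite i'E /= inlE p'E /= raddf0.
    have [[a b] <-] := cS y; rewrite p'E /= => /jqC [z zE].
    have [v vE] := pS z; exists (qX (a - r v)); rewrite i'E /= inlE.
    apply/subr0_eq; rewrite -linearB; apply/wc; exists (- v).
    rewrite linearN wE /= vE zE; congr pair => /=; last by rewrite sub0r.
    by rewrite addrAC subrr add0r.
  + move=> z; have [b <-] := qCS z; exists (c (0, b)).
    by rewrite p'E.
have Kf : fin_gen K := fin_gen_surj cS IP1f.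
exists K, i', p'; split=> //; first exact: sadd_cosyzygy sK sT IP1P PP TQ.
move=> h; have [g gE] := addin_lift (h \o qX : {linear _ -> _}) IA qTS.
have [|h' h'E] := factor_inj (f := g \o jX : {linear _ -> _}) jTI.
  by move=> x; apply/jqT; rewrite /= gE /= (ses0 _ sX) raddf0.
have [h0 h0E] := iT h'.
have [F FE] := ext_selfinjective (jT \o h0 : {linear _ -> _}) PA wI IP1f.
have [|h1 h1E] := ses_coker_map (f := qT \o F : {linear _ -> _}) sK.
  by move=> y; rewrite /= FE /= (ses0 _ sT).
(* Along [i'] the maps [h1] and [h] differ by [qT \o d], and [d : X -> P] extends to [K] by the
   injectivity of [P]. *)
have [D DE] := sub_lin g (F \o inl : {linear _ -> _}).
have [|d dE] := ses_coker_map (f := D) sX.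
  move=> x; have wi : w (i x) = inl (jX x).
    by rewrite wE inlE /= rE (ses0 _ s) raddf0.
  by rewrite DE /= -wi FE /= h0E h'E subrr.
have [iI' _ _] := sK'.
have [d' d'E] := ext_selfinjective d PA iI' Kf.
have [h2 h2E] := add_lin h1 (qT \o d' : {linear _ -> _}).
exists h2 => x; have [a <-] := qXS x.
rewrite h2E /= d'E dE DE i'E /= h1E /= linearB gE /=.
by rewrite addrC subrK.
Qed.

End Transfer.

(** A projective summand of [X] is put unchanged into the middle term, so the cokernel stays the
    same. *)
Lemma approx_free (T X X' F C : lmodType L) (r : {linear X -> F}) (t : {linear X -> X'})
    (g : {linear (F * X')%type -> X}) :
  projective F -> (forall x, g (r x, t x) = x) -> (forall z, (r (g z), t (g z)) = z) ->
  approx T X' C -> approx T X C.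
Proof.
move=> FP gK Kg [Q [i [p [[iI ip pS] TQ iT]]]].
have [i' i'E] := pair_lin r (i \o t : {linear _ -> _}).
exists (F * Q)%type, i', (p \o (snd : {linear (F * Q)%type -> Q})); split.
- split.
  + move=> x y; rewrite !i'E /= => -[rxy /iI txy].
    by rewrite -(gK x) -(gK y) rxy txy.
  + move=> [a y] /=; split=> [/ip [x <-]|[x]].
      exists (g (a, x)); rewrite i'E /=; have := Kg (a, x).
      by move=> [-> ->].
    by rewrite i'E => -[_ <-]; apply/ip; exists (t x).
  + by move=> z; have [y <-] := pS z; exists (0, y).
- by apply: sadd_pair => //; exact: projective_sadd.
move=> h; have [inl inlE] := pair_lin (idfun : {linear F -> F}) (\0 : {linear F -> X'}).
have [inr inrE] := pair_lin (\0 : {linear X' -> F}) (idfun : {linear X' -> X'}).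
have [h' h'E] := iT (h \o g \o inr : {linear _ -> _}).
have [h2 h2E] := copair_lin (h \o g \o inl : {linear _ -> _}) h'.
exists h2 => x; rewrite h2E i'E /= h'E /= -!linearD inlE inrE -[in RHS](gK x).
by congr (h (g _)); congr pair; rewrite /= ?addr0 ?add0r.
Qed.

End Approximations.

(** * Approximation by the radical and the simple module *)

Section BaseCase.
Variable k : fieldType.
Local Notation L := (ext_alg k).
Local Notation L1 := (L^o : lmodType L).
Local Notation iota := (GRing.in_alg L : {rmorphism k -> L}).
Local Notation restr := (restr iota).
Local Notation al := (alpha k).
Local Notation be := (beta k).
Implicit Types X Y Z P C T Q : lmodType L.

(** [R] stands for the radical of [L] and [S] for the simple module, known only through this
    sequence. *)
Variables (R S : lmodType L) (jR : {linear R -> L1}) (qS : {linear L1 -> S}).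
Hypotheses (sRS : ses jR qS) (qS0 : forall u : L, qS u = 0 <-> coef1 u = 0).

Lemma iota_coef (c : k) : [/\ coef1 (iota c) = c, coefa (iota c) = 0,
  coefb (iota c) = 0 & coefab (iota c) = 0].
Proof. by split; rewrite /= ?mulr1 ?mulr0. Qed.

Lemma ext_socle (u : L) : al * u = 0 -> be * u = 0 -> u = ExtAlg 0 0 0 (coefab u).
Proof.
case: u => c ca cb cab [_ a1 _ a3] [_ _ _ b3] /=; congr ExtAlg.
- by rewrite -a1; ring.
- by rewrite -[RHS]oppr0 -b3; ring.
- by rewrite -a3; ring.
Qed.

Lemma qS_eq (u v : L) : coef1 u = coef1 v -> qS u = qS v.
Proof.
move=> uv; apply/subr0_eq; rewrite -linearB; apply/qS0.
by rewrite /= uv subrr.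
Qed.

Lemma trivial_act C (u : L) (x : C) :
  al *: x = 0 -> be *: x = 0 -> u *: x = iota (coef1 u) *: x.
Proof.
by move=> ax bx; rewrite (ext_actE u x) ax bx -scalerA bx !scaler0 !addr0.
Qed.

Lemma simple_act (u : L) (x : S) : u *: x = iota (coef1 u) *: x.
Proof.
have [_ _ qSS] := sRS; have [v <-] := qSS x; rewrite -!linearZ; apply: qS_eq.
by rewrite /= mulr1.
Qed.

Lemma trivial_addin C : fin_gen C ->
  (forall x : C, al *: x = 0) -> (forall x : C, be *: x = 0) -> addin S C.
Proof.
move=> Cf aC bC; have [_ _ qSS] := sRS.
have [n [f [g [fK gK]]]] := fin_gen_rV (fin_gen_restr (ext_fin k) Cf).
have act (u : L) (x : restr C) : u *: (x : C) = coef1 u *: x.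
  by rewrite trivial_act.
have U i : exists h : {linear C -> S}, forall x, h x = qS (iota (f x 0 i)).
  apply: linear_lift => u x y; rewrite -linearZ -linearD; apply: qS_eq.
  rewrite act linearP !mxE /=.
  by rewrite !mulr1.
have V i : exists h : {linear S -> C}, forall u, h (qS u) = (u : L) *: (g (delta_mx 0 i) : C).
  have [w wE] := scale_lin (g (delta_mx 0 i) : C).
  have [|h hE] := factor_surj (f := w) qSS; last by exists h => u; rewrite hE wE.
  by move=> u /qS0 u0; rewrite wE act u0 scale0r.
have [u uE] := choice U; have [v vE] := choice V.
exists 'I_n, u, v => x; rewrite -{1}(fK x) [f x]row_sum_delta linear_sum.
apply: eq_bigr => i _; rewrite uE vE act linearZ.
by have [-> _ _ _] := iota_coef (f x 0 i).
Qed.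

(** Here [R0] is the radical of [X] and [r] its dimension: each coordinate of [R0] gives a map from
    [X] to [R] that embeds that coordinate in the socle of [R], while [X / R0] accounts for the
    rest. *)
Lemma approx_annihilated X : fin_gen X ->
  (forall x : X, (al * be) *: x = 0) ->
  exists C, addin S C /\ approx (R * S)%type X C.
Proof.
move=> Xf abX; have [jI jq qSS] := sRS.
have Xkf := fin_gen_restr (ext_fin k) Xf.
(* The commutators of [u] with [alpha] and [beta] are multiples of [alpha beta], which acts by zero;
   this makes [p0] linear. *)
have comm (u : L) (x : X) : al *: (u *: x) = u *: (al *: x) /\ be *: (u *: x) = u *: (be *: x).
  have zero (d : k) : (d *: (al * be)) *: x = 0.
    by rewrite -mulr_algl -scalerA abX scaler0.
  split; apply/subr0_eq; rewrite !scalerA -scalerBl.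
    have -> : al * u - u * al = (coefb u + coefb u) *: (al * be).
      by case: u => *; congr ExtAlg => /=; ring.
    exact: zero.
  have -> : be * u - u * be = (- (coefa u + coefa u)) *: (al * be).
    by case: u => *; congr ExtAlg => /=; ring.
  exact: zero.
have aaX (x : X) : al *: (al *: x) = 0.
  by have [aa _ _] := ext_alg_relations k; rewrite scalerA aa scale0r.
have bbX (x : X) : be *: (be *: x) = 0.
  by have [_ _ bb] := ext_alg_relations k; rewrite scalerA bb scale0r.
have abX' (x : X) : al *: (be *: x) = 0 by rewrite scalerA abX.
have baX (x : X) : be *: (al *: x) = 0 by rewrite (comm al x).2 abX'.
have [|p0 p0E] := @linear_lift L (X * X)%type X (fun z => al *: z.1 + be *: z.2).
  move=> u x y /=; rewrite !scalerDr (comm u x.1).1 (comm u x.2).2.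
  by rewrite addrACA.
have [Xb [pi [piS p0pi]]] := coker_ex p0.
have [R0 [i0 si]] := ses_ker piS; have [iI ip _] := si.
have Xbf : fin_gen Xb := fin_gen_surj piS Xf.
have piZ (x : X) : pi (al *: x) = 0 /\ pi (be *: x) = 0.
  split; apply/p0pi; [exists (x, 0)|exists (0, x)]; rewrite p0E /=;
    by rewrite scaler0 ?addr0 ?add0r.
have R0act (y : R0) : al *: i0 y = 0 /\ be *: i0 y = 0.
  have [[x1 x2] <-] : exists z, p0 z = i0 y by apply/p0pi/ip; exists y.
  by rewrite p0E !scalerDr /= aaX bbX abX' baX !addr0.
have Xb_triv (z : Xb) : al *: z = 0 /\ be *: z = 0.
  by have [x <-] := piS z; rewrite -!linearZ; exact: piZ.
have R0f : fin_gen R0 := fin_gen_sub_ext iI Xf.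
have [r [b [b' [bK b'K]]]] := fin_gen_rV (fin_gen_restr (ext_fin k) R0f).
have [i' i'E] := restr_lin iota i0.
have [|rho rhoK] := @retraction_ex k (restr X) (restr R0) i' _ Xkf.
  by move=> x y; rewrite !i'E => /iI.
have rhoi (y : R0) : rho (i0 y) = y by rewrite -i'E rhoK.
(* This is [ext_dual] of the [i]-th coordinate of [R0], extended to [X] by [rho]. Its [coef1]
   vanishes because [alpha beta] kills [X], so it lands in [R]. *)
have F i : exists h : {linear X -> R}, forall x, jR (h x) =
    ExtAlg 0 (- b (rho (be *: x)) 0 i) (b (rho (al *: x)) 0 i) (b (rho x) 0 i).
  have [|phi phiE] := @linear_lift k (restr X) k^o (fun x => b (rho x) 0 i).
    by move=> c x y; rewrite !linearP !mxE.
  have [h hE] := ext_dual phi.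
  have hE' (x : X) : h x =
    ExtAlg 0 (- b (rho (be *: x)) 0 i) (b (rho (al *: x)) 0 i) (b (rho x) 0 i).
    by rewrite hE abX raddf0 !phiE.
  have [|f fE] := factor_inj (f := h) jI; last by exists f => x; rewrite fE hE'.
  by move=> x; apply/jq/qS0; rewrite hE'.
have [f fE] := choice F; have [f' f'E] := ffun_lin f.
have [g gE] := pair_lin f' pi.
have fi0 i y : jR (f i (i0 y)) = ExtAlg 0 0 0 (b y 0 i).
  have [ay bY] := R0act y.
  by rewrite fE ay bY !raddf0 mxE oppr0 rhoi.
have gI : injective g.
  apply: linear_inj => x; rewrite gE => -[f'x /ip [y yE]].
  suff y0 : y = 0 by rewrite -yE y0 raddf0.
  apply: (can_inj bK); rewrite raddf0; apply/rowP => i; rewrite mxE.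
  have := congr1 jR (congr1 (fun w : {ffun _} => w i) f'x).
  by rewrite f'E -yE fi0 ffunE raddf0 => -[].
have [C [p sg]] := ses_coker gI; have [_ gp pS] := sg.
(* An element of [socle(R)^r (+) 0] is the image under [g] of an element of [R0], hence zero in [C].
   For [u] equal to [alpha] or [beta] this makes [C] semisimple. *)
have Cact (u : L) (d : 'I_r -> k) : coef1 u = 0 -> forall (s : {ffun 'I_r -> R}) (z : Xb),
  (forall z' : Xb, u *: z' = 0) ->
  (forall i, u * jR (s i) = ExtAlg 0 0 0 (d i)) -> u *: p (s, z) = 0.
  move=> u0 s z uz ud; rewrite -linearZ; apply/gp; exists (i0 (b' (\row_i d i))).
  rewrite gE (ses0 _ si); congr pair; last by rewrite /= uz.
  apply/ffunP => i; rewrite f'E ffunE; apply: jI.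
  by rewrite fi0 b'K mxE linearZ /= -ud.
have s1 (s : R) : coef1 (jR s) = 0 by apply/qS0/jq; exists s.
have Cf : fin_gen C.
  apply: fin_gen_surj pS (fin_gen_pair (fin_gen_ffun _ _) Xbf).
  by apply: fin_gen_sub_ext jI _; exact: fin_gen_regular.
have SC : addin S C.
  apply: trivial_addin => // y; have [[s z] <-] := pS y.
    apply: (Cact al (fun i => coefb (jR (s i)))) => //= [z'|i]; first exact: (Xb_triv z').1.
    by move: (s1 (s i)); case: (jR (s i)) => c1 ca cb cab /= ->; congr ExtAlg => /=; ring.
  apply: (Cact be (fun i => - coefa (jR (s i)))) => //= [z'|i]; first exact: (Xb_triv z').2.
  by move: (s1 (s i)); case: (jR (s i)) => c1 ca cb cab /= ->; congr ExtAlg => /=; ring.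
exists C; split=> //; exists ({ffun 'I_r -> R} * Xb)%type, g, p; split=> //.
  apply/addin_sadd/addin_pair.
    by apply: thru_trans (addin_ffun _ _) (addin_fst _ _).
  apply: thru_trans (addin_snd _ _).
  by apply: trivial_addin => // z; have [] := Xb_triv z.
have ext1 (h : {linear X -> R}) :
    exists h' : {linear ({ffun 'I_r -> R} * Xb)%type -> R}, forall x, h' (g x) = h x.
  (* On [R0] the map [h] has values in the socle of [R], so it agrees there with the combination of
     the [f i] with coefficients [c i]; the difference factors through [pi]. *)
  pose c i := coefab (jR (h (i0 (b' (delta_mx 0 i))))).
  pose cz i : {linear R -> R} := end_fun (end_scal (in_alg_central (k := k)) R (c i)).
  have [v vE] := ffun_colin cz.
  have [D DE] := sub_lin h (v \o f' : {linear _ -> _}).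
  have [|D' D'E] := ses_coker_map (f := D) si.
    move=> y; apply: jI; rewrite raddf0.
    have jact (w : {linear X -> R}) : jR (w (i0 y)) = ExtAlg 0 0 0 (coefab (jR (w (i0 y)))).
      have [ay bY] := R0act y.
      apply: ext_socle.
        by have := congr1 jR (congr1 w ay); rewrite !linearZ !raddf0.
      by have := congr1 jR (congr1 w bY); rewrite !linearZ !raddf0.
    rewrite (jact D) (_ : coefab _ = 0) //.
    have tr (w : {linear X -> R}) : exists t : {linear restr R0 -> k^o},
        forall y, t y = coefab (jR (w (i0 y))).
      apply: linear_lift => e x z.
      by rewrite restr_scaleE !linearP /GRing.scale /=; ring.
    have [t tE] := tr D.
    rewrite -tE -(bK y) [b y]row_sum_delta !linear_sum big1 // => i _.
    have jcz j (s : R) : jR (cz j s) = c j *: (jR s : L).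
      by rewrite -[RHS]mulr_algl; exact: (linearZZ jR (iota (c j)) s).
    have vi : jR (v (f' (i0 (b' (delta_mx 0 i))))) = ExtAlg 0 0 0 (c i).
      rewrite vE linear_sum (bigD1 i) //= [X in _ + X]big1 => [|j ji].
        rewrite -/(cz i _) jcz f'E fi0 b'K mxE !eqxx addr0.
        by congr ExtAlg => /=; ring.
      rewrite -/(cz j _) jcz f'E fi0 b'K mxE eqxx (negPf ji).
      by congr ExtAlg => /=; ring.
    by rewrite (linearZZ b') (linearZZ t) tE DE linearB /= vi subrr scaler0.
  have [h' h'E] := copair_lin v D'; exists h' => x.
  by rewrite h'E gE /= D'E DE /= addrC subrK.
move=> h; have [h1 h1E] := ext1 ((fst : {linear (R * S)%type -> R}) \o h : {linear _ -> _}).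
(* A map to [S] kills the radical [R0] and factors through [pi]. *)
pose hS : {linear X -> S} := (snd : {linear (R * S)%type -> S}) \o h.
have [|h2 h2E] := ses_coker_map (f := hS) si.
  move=> y; have [[x1 x2] <-] : exists z, p0 z = i0 y by apply/p0pi/ip; exists y.
  rewrite p0E linearD (linearZZ hS al) (linearZZ hS be).
  by rewrite (simple_act al) (simple_act be) /= !scale0r !addr0.
have [h' h'E] := pair_lin h1 (h2 \o (snd : {linear ({ffun 'I_r -> R} * Xb)%type -> Xb}) : {linear _ -> _}).
by exists h' => x; rewrite h'E h1E gE /= h2E /hS /=; case: (h x).
Qed.

(** Split off a free submodule of maximal rank, bounded by dimension. An element of the complement
    not killed by [alpha beta] would generate one more copy of [L]. *)
Lemma split_free X : fin_gen X ->
  exists (F X' : lmodType L) (r : {linear X -> F}) (t : {linear X -> X'}) (g : {linear (F * X')%type -> X}),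
    [/\ projective F, forall x, g (r x, t x) = x, forall z, (r (g z), t (g z)) = z,
        fin_gen X' & forall x : X', (al * be) *: x = 0].
Proof.
move=> Xf; have [N [gen genP]] := fin_gen_restr (ext_fin k) Xf.
pose free m := `[< exists (I : finType) (e : {linear {ffun I -> L1} -> X}),
  injective e /\ #|I| = m >].
have free0 : exists m, free m.
  exists 0%N; apply/asboolP; exists 'I_0, \0; split; last exact: card_ord.
  by move=> u v _; apply/ffunP => -[].
have freeN m : free m -> (m <= N)%N.
  move=> /asboolP [I [e [eI <-]]].
  have [|j jE] := @linear_lift k 'rV[k]_#|I| (restr X)
    (fun v => e [ffun i => iota (v 0 (enum_rank i)) : L1]).
    move=> c u v; rewrite restr_scaleE -linearP; congr (e _).
    apply/ffunP => i; rewrite !ffunE !mxE rmorphD rmorphM.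
    by [].
  apply: (dim_le (j := j)) genP => u v; rewrite !jE => /eI /ffunP uv.
  apply/rowP => i; have := congr1 (@coef1 k) (uv (enum_val i)).
  by rewrite !ffunE enum_valK /= !mulr1.
case: (ex_maxnP free0 freeN) => m /asboolP [I [e [eI eM]]] mmax.
have FP := projective_free L I; have /projectiveP FA := FP.
have [r rK] := ext_selfinjective idfun FA eI Xf.
have rS : surjective r by move=> y; exists (e y).
have [X' [i s]] := ses_ker rS; have [iI ir _] := s.
have [d dE] := sub_lin idfun (e \o r : {linear _ -> _}).
have [|t tE] := factor_inj (f := d) iI.
  by move=> x; apply/ir; rewrite dE linearB /= rK subrr.
have [g gE] := copair_lin e i.
have ri x : r (i x) = 0 := ses0 x s.
exists {ffun I -> L1}, X', r, t, g; split=> //.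
- by move=> x; rewrite gE /= tE dE /= addrC subrK.
- move=> [y x]; have rg : r (g (y, x)) = y by rewrite gE linearD /= rK ri addr0.
  rewrite rg; congr pair; apply: iI.
  by rewrite tE dE /= rg gE /= addrC addKr.
- exact: fin_gen_sub_ext iI Xf.
move=> x; apply: contrapT => abx.
suff : free m.+1 by move/mmax; rewrite ltnn.
apply/asboolP; exists (option I).
have [|e' e'E] := @linear_lift L {ffun option I -> L1} X
  (fun c => e [ffun j => c (Some j)] + (c None : L) *: i x).
  move=> u c c'.
  have -> : ((u *: c + c') None : L) = u * c None + c' None by rewrite !ffunE.
  have -> : [ffun j => (u *: c + c') (Some j)] =
      u *: [ffun j => c (Some j)] + [ffun j => c' (Some j)].
    by apply/ffunP => j; rewrite !ffunE.
  by rewrite linearP scalerDl -scalerA addrACA -scalerDr.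
exists e'; split; last by rewrite card_option eM.
apply: linear_inj => c; rewrite e'E => ec.
have c0 : [ffun j => c (Some j)] = 0 :> {ffun I -> L1}.
  by have := congr1 r ec; rewrite linearD linearZ /= ri scaler0 addr0 rK raddf0.
have cx : (c None : L) *: x = 0.
  by apply: iI; rewrite linearZZ raddf0 -[RHS]ec c0 raddf0 add0r.
suff cN : c None = 0.
  by apply/ffunP => -[j|]; rewrite ?cN ffunE //; have := congr1 (fun w : {ffun _} => w j) c0; rewrite !ffunE.
(* Since [c None] kills [x] but [alpha beta] does not, no product [v * c None] is a nonzero multiple
   of [alpha beta]. The choices [alpha beta], [alpha], [beta] and [1] for [v] remove the
   coefficients of [c None] one by one. *)
have scal (v : L) (z : k) : v * (c None : L) = z *: (al * be) -> z = 0.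
  move=> vc; apply: contrapT => /eqP z0; apply: abx.
  have zz : (z^-1)%:A * z%:A = 1 :> L by rewrite mulr_algl scalerA mulVf // scale1r.
  have : (z *: (al * be)) *: x = 0 by rewrite -vc -scalerA cx scaler0.
  rewrite -mulr_algl -(scalerA z%:A) => e0.
  by rewrite -[LHS]scale1r -zz -(scalerA (z^-1)%:A) e0 scaler0.
have c1 : coef1 (c None : L) = 0.
  by apply: (scal (al * be)); case: (c None) => *; congr ExtAlg => /=; ring.
have cb : coefb (c None : L) = 0.
  by apply: (scal al); move: c1; case: (c None) => /= ? ? ? ? ->; congr ExtAlg => /=; ring.
have ca : - coefa (c None : L) = 0.
  by apply: (scal be); move: c1; case: (c None) => /= ? ? ? ? ->; congr ExtAlg => /=; ring.
have cab : coefab (c None : L) = 0.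
  apply: (scal 1); move: c1 cb ca; case: (c None) => /= ? ? ? ? -> -> /eqP.
  by rewrite oppr_eq0 => /eqP ->; congr ExtAlg => /=; ring.
move: c1 ca cb cab; case: (c None) => /= ? ? ? ? -> /eqP.
by rewrite oppr_eq0 => /eqP -> -> ->.
Qed.

Lemma approx_base X : fin_gen X -> exists C, addin S C /\ approx (R * S)%type X C.
Proof.
move=> /split_free [F [X' [r [t [g [FP gK Kg X'f X'0]]]]]].
have [C [SC X'C]] := approx_annihilated X'f X'0.
by exists C; split=> //; exact: approx_free FP gK Kg X'C.
Qed.

End BaseCase.

(** * The modules [S_n] in coordinates *)

Section Coordinates.
Variable k : fieldType.
Local Notation L := (ext_alg k).
Local Notation L1 := (L^o : lmodType L).
Local Notation al := (alpha k).
Local Notation be := (beta k).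

(** The default value 0 out of range lets shifted indices be written without bounds; [fent] below
    does the same. *)
Definition ent n (v : 'cV[k]_n) (i : nat) : k :=
  if insub i is Some j then v j 0 else 0.

Lemma ent_ord n (v : 'cV[k]_n) (i : 'I_n) : ent v i = v i 0.
Proof. by rewrite /ent valK. Qed.

Lemma ent_ge n (v : 'cV[k]_n) i : (n <= i)%N -> ent v i = 0.
Proof. by move=> ni; rewrite /ent insubF // ltnNge ni. Qed.

Lemma entD n (v w : 'cV[k]_n) i : ent (v + w) i = ent v i + ent w i.
Proof. by rewrite /ent; case: insub => [j|]; rewrite ?mxE ?addr0. Qed.

Lemma entZ n c (v : 'cV[k]_n) i : ent (c *: v) i = c * ent v i.
Proof. by rewrite /ent; case: insub => [j|]; rewrite ?mxE ?mulr0. Qed.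

Lemma ent_col n (f : nat -> k) i : (i < n)%N -> ent (\col_(j < n) f j) i = f i.
Proof. by move=> ni; rewrite /ent insubT /= mxE. Qed.

Lemma ent_ext n (v w : 'cV[k]_n) : ent v =1 ent w -> v = w.
Proof. by move=> vw; apply/colP => i; rewrite -!ent_ord vw. Qed.

Lemma sum_ent n (v : 'cV[k]_n) (b : nat) :
  \sum_(j < n) (b == j)%:R * v j 0 = ent v b.
Proof.
have [nb|bn] := leqP n b.
  rewrite ent_ge // big1 // => j _.
  by rewrite gtn_eqF ?mul0r // (leq_trans (ltn_ord j)).
rewrite -[b]/(nat_of_ord (Ordinal bn)) ent_ord (bigD1 (Ordinal bn)) //= eqxx mul1r.
by rewrite big1 ?addr0 // => j; rewrite eq_sym -val_eqE /= => /negPf ->; rewrite mul0r.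
Qed.

(* Coordinates of [S_n] for [n = N >= 0] and for [n = - N <= 0]: [t] are the
   coordinates of the top and [s] those of the socle, extended by [0].  For
   [n = 0] there are two descriptions, according to whether the module is viewed
   as a socle or as a top. *)
Definition pos_rules (N : nat) (V : lmodType L) (t s : V -> nat -> k) : Prop :=
  [/\ forall x y i, t (x + y) i = t x i + t y i /\ s (x + y) i = s x i + s y i,
      forall (u : L) x i, t (u *: x) i = coef1 u * t x i /\
        s (u *: x) i = coef1 u * s x i + coefa u * t x i
                       + (if i is j.+1 then coefb u * t x j else 0)
    & forall x i, ((N <= i)%N -> t x i = 0) /\ ((N < i)%N -> s x i = 0)].

Definition neg_rules (N : nat) (V : lmodType L) (t s : V -> nat -> k) : Prop :=
  [/\ forall x y i, t (x + y) i = t x i + t y i /\ s (x + y) i = s x i + s y i,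
      forall (u : L) x i, t (u *: x) i = coef1 u * t x i /\
        s (u *: x) i = coef1 u * s x i
          + (if (i < N)%N then coefa u * t x i + coefb u * t x i.+1 else 0)
    & forall x i, ((N < i)%N -> t x i = 0) /\ ((N <= i)%N -> s x i = 0)].

Definition coord_ext (V : lmodType L) (t s : V -> nat -> k) : Prop :=
  forall x y, t x =1 t y -> s x =1 s y -> x = y.

(** The rules alone suffice for the source of a map given by coordinates; a target must also be
    determined by its coordinates and realise all of them, as in [pos_map]. *)
Definition pos_coord (N : nat) (V : lmodType L) (t s : V -> nat -> k) : Prop :=
  [/\ pos_rules N t s, coord_ext t s
    & forall f g, exists x, forall i,
        ((i < N)%N -> t x i = f i) /\ ((i <= N)%N -> s x i = g i)].

Definition neg_coord (N : nat) (V : lmodType L) (t s : V -> nat -> k) : Prop :=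
  [/\ neg_rules N t s, coord_ext t s
    & forall f g, exists x, forall i,
        ((i <= N)%N -> t x i = f i) /\ ((i < N)%N -> s x i = g i)].

Lemma S_actE (n : int) (u : L) (x : S_ k n) :
  u *: x = coef1 u *: (x : 'cV[k]_(`|n| + `|n|.+1)) + coefa u *: (S_mx k 0 n *m x)
    + coefb u *: (S_mx k 1 n *m x) :> 'cV[k]_(`|n| + `|n|.+1).
Proof.
by rewrite {1}/GRing.scale /= /rep_act /= mulmxA S_mx_mul mul0mx scaler0 addr0.
Qed.

Lemma S_pos_coord (N : nat) : exists t s, @pos_coord N (S_ k N) t s.
Proof.
exists (fun x => ent (usubmx (x : 'cV[k]_(N + N.+1)))),
  (fun x => ent (dsubmx (x : 'cV[k]_(N + N.+1)))).
have blockE b (x : 'cV[k]_(N + N.+1)) : S_mx k b N *m x =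
    col_mx 0 ((\matrix_(i < N.+1, j < N) (i == (j + b)%N :> nat)%:R) *m usubmx x).
  by rewrite /S_mx /= -{1}[x]vsubmxK mul_block_col !mul0mx !addr0.
split; first split.
- by move=> x y i; rewrite !linearD !entD.
- move=> u x i; rewrite !S_actE !blockE !linearD !linearZ /= !col_mxKu !col_mxKd.
  rewrite !scaler0 !addr0 !entD !entZ; split=> //.
  have [Ni|iN] := ltnP N i.
    rewrite [ent (_ *m _) i]ent_ge // [ent (_ *m _) i]ent_ge // (@ent_ge _ (usubmx x)).
      by case: i Ni => // i Ni; rewrite (@ent_ge _ (usubmx x) i) // !mulr0.
    exact: ltnW.
  rewrite -[i]/(nat_of_ord (Ordinal (iN : (i < N.+1)%N))) !ent_ord.
  rewrite ![(_ *m _ : matrix _ _ _) _ _]mxE.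
  under eq_bigr do rewrite !mxE /= addn0.
  under [X in _ + coefb u * X]eq_bigr do rewrite !mxE /= addn1.
  congr (_ + _ * _ + _).
    by rewrite -sum_ent; apply: eq_bigr => j _; rewrite [in RHS]mxE.
  case: i iN => [|i] iN; first by rewrite big1 ?mulr0 // => j _; rewrite mul0r.
  by congr (_ * _); rewrite -sum_ent; apply: eq_bigr => j _; rewrite [in RHS]mxE.
- by move=> x i; split=> Ni; rewrite ent_ge.
- move=> x y /ent_ext u /ent_ext d.
  by rewrite -[LHS](@vsubmxK k N N.+1 1) u d vsubmxK.
move=> f g; exists (col_mx (\col_(i < N) f i) (\col_(i < N.+1) g i)) => i.
by rewrite col_mxKu col_mxKd; split=> iN; rewrite ent_col.
Qed.

Lemma S_neg_coord (N : nat) : exists t s, @neg_coord N (S_ k (- N%:Z)) t s.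
Proof.
case: N => [|m].
  (* The only block of [S_0] is read as a top here; there are no socle coordinates. *)
  exists (fun x => ent (dsubmx (x : 'cV[k]_(0 + 1)))), (fun _ _ => 0).
  have blockE b (x : 'cV[k]_(0 + 1)) : S_mx k b 0 *m x = 0.
    by rewrite /S_mx /= /S_block [\matrix_(i < 1, j < 0) _]thinmx0 block_mx0 mul0mx.
  split; first split.
  - by move=> x y i; rewrite linearD entD /= addr0.
  - move=> u x i; rewrite !S_actE !blockE !scaler0 !addr0 linearZ entZ /=.
    by rewrite mulr0.
  - by move=> x i; split=> // Ni; rewrite ent_ge.
  - move=> x y /ent_ext d _; rewrite -[LHS](@vsubmxK k 0 1 1) d.
    by rewrite (_ : usubmx _ = usubmx y) ?vsubmxK //; apply/matrixP => -[].
  move=> f g; exists (col_mx 0 (\col_(i < 1) f i)) => i.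
  by rewrite col_mxKd; split=> // iN; rewrite ent_col.
rewrite (_ : - m.+1%:Z = Negz m) // /S_ /=.
(* The transposed matrices send the lower block to the upper one, so the blocks exchange roles. *)
exists (fun x => ent (dsubmx (x : 'cV[k]_(m.+1 + m.+2)))),
  (fun x => ent (usubmx (x : 'cV[k]_(m.+1 + m.+2)))).
have blockE b (x : 'cV[k]_(m.+1 + m.+2)) : S_mx k b (Negz m) *m x =
    col_mx ((\matrix_(i < m.+1, j < m.+2) (j == (i + b)%N :> nat)%:R) *m dsubmx x) 0.
  rewrite /S_mx /= tr_block_mx -{1}[x]vsubmxK mul_block_col !trmx0 !mul0mx !addr0 add0r.
  by congr (col_mx (_ *m _) _); apply/matrixP => i j; rewrite !mxE.
have JE b (v : 'cV[k]_m.+2) i : (b <= 1)%N ->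
    ent ((\matrix_(i < m.+1, j < m.+2) (j == (i + b)%N :> nat)%:R) *m v) i =
    if (i < m.+1)%N then ent v (i + b) else 0.
  move=> b1; case: ltnP => im; last exact: ent_ge.
  rewrite -[i in LHS]/(nat_of_ord (Ordinal im)) ent_ord mxE -sum_ent.
  by apply: eq_bigr => j _; rewrite mxE eq_sym.
split; first split.
- by move=> x y i; rewrite !linearD !entD.
- move=> u x i; rewrite !(@S_actE (Negz m)) !blockE !linearD !linearZ /= !col_mxKu !col_mxKd.
  rewrite !scaler0 !addr0 !entD !entZ !JE // addn0 addn1; split=> //.
  by case: ifP => _; rewrite ?mulr0 ?addr0 // addrA.
- by move=> x i; split=> Ni; rewrite ent_ge.
- move=> x y /ent_ext d /ent_ext u.
  by rewrite -[LHS](@vsubmxK k m.+1 m.+2 1) u d vsubmxK.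
move=> f g; exists (col_mx (\col_(i < m.+1) g i) (\col_(i < m.+2) f i)) => i.
by rewrite col_mxKu col_mxKd; split=> iN; rewrite ent_col.
Qed.

End Coordinates.

(** * The syzygies of [S_n] *)

Section Syzygies.
Variable k : fieldType.
Local Notation L := (ext_alg k).
Local Notation L1 := (L^o : lmodType L).
Local Notation al := (alpha k).
Local Notation be := (beta k).

Definition shift (f : nat -> k) (i : nat) : k := if i is j.+1 then f j else 0.

Definition fent n (c : {ffun 'I_n -> L1}) (i : nat) : L :=
  if insub i is Some j then c j else 0.

Lemma fent_ord n (c : {ffun 'I_n -> L1}) (i : 'I_n) : fent c i = c i.
Proof. by rewrite /fent valK. Qed.

Lemma fent_ge n (c : {ffun 'I_n -> L1}) i : (n <= i)%N -> fent c i = 0.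
Proof. by move=> ni; rewrite /fent insubF // ltnNge ni. Qed.

Lemma fentD n (c d : {ffun 'I_n -> L1}) i : fent (c + d) i = fent c i + fent d i.
Proof. by rewrite /fent; case: insub => [j|]; rewrite ?ffunE ?addr0. Qed.

Lemma fentZ n (u : L) (c : {ffun 'I_n -> L1}) i : fent (u *: c) i = u * fent c i.
Proof. by rewrite /fent; case: insub => [j|]; rewrite ?ffunE ?mulr0. Qed.

Lemma fent_fun n (f : nat -> L) i : (i < n)%N ->
  fent [ffun j : 'I_n => f j : L1] i = f i.
Proof. by move=> ni; rewrite /fent insubT /= ffunE. Qed.

Lemma fent_ext n (c d : {ffun 'I_n -> L1}) : fent c =1 fent d -> c = d.
Proof. by move=> cd; apply/ffunP => i; rewrite -!fent_ord cd. Qed.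

Lemma fent_lin n (V : lmodType L) (f : V -> nat -> L) :
  (forall x y i, f (x + y) i = f x i + f y i) ->
  (forall (u : L) x i, f (u *: x) i = u * f x i) ->
  (forall x i, (n <= i)%N -> f x i = 0) ->
  exists h : {linear V -> {ffun 'I_n -> L1}}, forall x, fent (h x) =1 f x.
Proof.
move=> fD fZ f0; have [|h hE] := @linear_lift L V {ffun 'I_n -> L1}
  (fun x => [ffun j : 'I_n => f x j : L1]).
  by move=> u x y; apply/ffunP => i; rewrite !ffunE fD fZ.
exists h => x i; rewrite hE; have [ni|/(fent_fun (f x))//] := leqP n i.
by rewrite fent_ge // f0.
Qed.

Lemma ext_alg_eq (u v : L) : coef1 u = coef1 v -> coefa u = coefa v ->
  coefb u = coefb v -> coefab u = coefab v -> u = v.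
Proof. by case: u => ????; case: v => ???? /= -> -> -> ->. Qed.

Lemma pos_map N (U W : lmodType L) (f g : U -> nat -> k) (t s : W -> nat -> k) :
  pos_rules N f g -> pos_coord N t s ->
  exists h : {linear U -> W}, forall x, t (h x) =1 f x /\ s (h x) =1 g x.
Proof.
move=> [fgD fgZ fg0] [[tsD tsZ ts0] ts_ext ts_surj].
have hP x : exists y, t y =1 f x /\ s y =1 g x.
  have [y yE] := ts_surj (f x) (g x); exists y; split=> i.
    have [Ni|/((yE i).1)//] := leqP N i.
    by rewrite (ts0 y i).1 // (fg0 x i).1.
  have [Ni|/((yE i).2)//] := ltnP N i.
  by rewrite (ts0 y i).2 // (fg0 x i).2.
have [h hE] := choice hP.
have [|h' h'E] := @linear_lift L U W h; last by exists h' => x; rewrite h'E.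
move=> u x y; apply: ts_ext => i.
  rewrite (hE _).1 (tsD _ _ _).1 (tsZ _ _ _).1 (hE _).1 (hE _).1.
  by rewrite (fgD _ _ _).1 (fgZ _ _ _).1.
rewrite (hE _).2 (tsD _ _ _).2 (tsZ _ _ _).2 (hE _).2 (hE _).2 (hE _).1.
rewrite (fgD _ _ _).2 (fgZ _ _ _).2.
by case: i => // i; rewrite (hE _).1.
Qed.

Lemma neg_map N (U W : lmodType L) (f g : U -> nat -> k) (t s : W -> nat -> k) :
  neg_rules N f g -> neg_coord N t s ->
  exists h : {linear U -> W}, forall x, t (h x) =1 f x /\ s (h x) =1 g x.
Proof.
move=> [fgD fgZ fg0] [[tsD tsZ ts0] ts_ext ts_surj].
have hP x : exists y, t y =1 f x /\ s y =1 g x.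
  have [y yE] := ts_surj (f x) (g x); exists y; split=> i.
    have [Ni|/((yE i).1)//] := ltnP N i.
    by rewrite (ts0 y i).1 // (fg0 x i).1.
  have [Ni|/((yE i).2)//] := leqP N i.
  by rewrite (ts0 y i).2 // (fg0 x i).2.
have [h hE] := choice hP.
have [|h' h'E] := @linear_lift L U W h; last by exists h' => x; rewrite h'E.
move=> u x y; apply: ts_ext => i.
  rewrite (hE _).1 (tsD _ _ _).1 (tsZ _ _ _).1 (hE _).1 (hE _).1.
  by rewrite (fgD _ _ _).1 (fgZ _ _ _).1.
rewrite (hE _).2 (tsD _ _ _).2 (tsZ _ _ _).2 (hE _).2 (hE _).2 !(hE x).1.
by rewrite (fgD _ _ _).2 (fgZ _ _ _).2.
Qed.

(** The kernel of the projective cover [p] is given by [coef1 = 0] and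
    [coefa c_j = - coefb c_(j-1)]. So [coefb] and [coefab] are free parameters, which dictates [i];
    the sign makes [beta] act as in [S_N]. *)
Lemma pos_ses N (V W : lmodType L) (t s : V -> nat -> k) (t' s' : W -> nat -> k) :
  pos_coord N t s -> pos_coord N.+1 t' s' ->
  exists (i : {linear V -> {ffun 'I_N.+1 -> L1}}) (p : {linear {ffun 'I_N.+1 -> L1} -> W}),
    ses i p.
Proof.
move=> [[tsD tsZ ts0] ts_ext ts_surj] tsW.
have [_ ts_ext' ts_surj'] := tsW.
have [|||i iE] := @fent_lin N.+1 V
  (fun x i => ExtAlg 0 (- shift (t x) i) (t x i) (s x i)).
- move=> x y [|i]; rewrite /= !(tsD x y _).1 (tsD x y _).2;
    by congr ExtAlg => /=; ring.
- move=> u x [|i]; rewrite /= !(tsZ u x _).1 (tsZ u x _).2;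
    by congr ExtAlg => /=; ring.
- move=> x [|i] //= Ni; rewrite (ts0 x i).1 // (ts0 x i.+1).1 ?(ts0 x i.+1).2 //.
    by rewrite oppr0.
  exact: leq_trans Ni.
have [|p pE] := pos_map (f := fun (c : {ffun 'I_N.+1 -> L1}) i => coef1 (fent c i))
  (g := fun c i => coefa (fent c i) + shift (fun j => coefb (fent c j)) i) _ tsW.
  split.
  - by move=> x y [|j]; rewrite /= !fentD /=; split=> //; ring.
  - by move=> u x [|j]; rewrite /= !fentZ /=; split=> //; ring.
  - move=> c j; split=> Nj; first by rewrite fent_ge.
    by case: j Nj => // j Nj; rewrite /= !fent_ge ?addr0 // ltnW.
exists i, p; split.
- move=> x y xy; have e j : fent (i x) j = fent (i y) j by rewrite xy.
  by apply: ts_ext => j; have := e j; rewrite !iE => -[].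
- move=> c; split=> [pc|[x <-]]; last first.
    have p0 : t' 0 =1 (fun=> 0) /\ s' 0 =1 (fun=> 0).
      rewrite -(raddf0 p); split=> j; rewrite ?(pE 0).1 ?(pE 0).2.
        by rewrite /fent; case: insub => // ?; rewrite ffunE.
      by case: j => [|j]; rewrite /= /fent; do !case: insub => [?|]; rewrite ?ffunE ?addr0.
    apply: ts_ext' => j; rewrite ?(pE _).1 ?(pE _).2 ?p0.1 ?p0.2 ?iE //.
    by case: j => [|j]; rewrite /= ?iE /= ?addNr // oppr0 addr0.
  have c1 j : coef1 (fent c j) = 0.
    have := (pE c).1 j; rewrite pc -(raddf0 p) (pE 0).1 => <-.
    by rewrite /fent; case: insub => // ?; rewrite ffunE.
  have cab j : coefa (fent c j) + shift (fun j => coefb (fent c j)) j = 0.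
    have := (pE c).2 j; rewrite pc -(raddf0 p) (pE 0).2 => <-.
    by case: j => [|j]; rewrite /= /fent; do !case: insub => [?|]; rewrite ?ffunE ?addr0.
  have [x xE] := ts_surj (fun j => coefb (fent c j)) (fun j => coefab (fent c j)).
  have xt j : t x j = coefb (fent c j).
    have [Nj|/((xE j).1)//] := leqP N j.
    rewrite (ts0 x j).1 //; have := cab j.+1.
    by rewrite fent_ge ?add0r.
  have xs j : s x j = coefab (fent c j).
    have [Nj|/((xE j).2)//] := ltnP N j.
    by rewrite (ts0 x j).2 // fent_ge.
  exists x; apply: fent_ext => j; rewrite iE; apply: ext_alg_eq => //=.
  have := cab j; case: j => [|j] /=; first by rewrite addr0 oppr0.
  by rewrite xt => /eqP; rewrite addr_eq0 => /eqP.
(* All socle coordinates are reached through [alpha] except the last, [s' y N.+1], which needs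
   [beta] at index [N]. *)
- move=> y; pose cf j := ExtAlg (t' y j) (s' y j) (if j == N then s' y N.+1 else 0) 0.
  exists [ffun j : 'I_N.+1 => cf j : L1].
  have [[_ _ ts0'] _ _] := tsW.
  apply: ts_ext' => j; rewrite ?(pE _).1 ?(pE _).2.
    have [Nj|jN] := leqP N.+1 j; last by rewrite (fent_fun cf).
    by rewrite fent_ge // (ts0' y j).1.
  have [Nj|jN] := leqP N.+1 j.
    rewrite fent_ge // add0r; case: j Nj => // j Nj /=.
    move: Nj; rewrite ltnS leq_eqVlt => /orP[/eqP <-|Nj].
      by rewrite (fent_fun cf) //= eqxx.
    by rewrite fent_ge // (ts0' y j.+1).2.
  rewrite (fent_fun cf) //=.
  case: j jN => [|j] jN; first by rewrite addr0.
  by rewrite /= (fent_fun cf) ?(ltnW jN) //= ltn_eqF // addr0.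
Qed.

(** As in [pos_ses], but now the kernel relations are [coefa c_j = - coefb c_(j+1)] for [j < N], so
    [coefa c_N] remains a free parameter. *)
Lemma neg_ses N (V W : lmodType L) (t s : V -> nat -> k) (t' s' : W -> nat -> k) :
  neg_coord N.+1 t s -> neg_coord N t' s' ->
  exists (i : {linear V -> {ffun 'I_N.+1 -> L1}}) (p : {linear {ffun 'I_N.+1 -> L1} -> W}),
    ses i p.
Proof.
move=> [[tsD tsZ ts0] ts_ext ts_surj] tsW.
have [[_ _ ts0'] ts_ext' ts_surj'] := tsW.
have [|||i iE] := @fent_lin N.+1 V
  (fun x i => if (i < N.+1)%N then ExtAlg 0 (- t x i.+1) (t x i) (s x i) else 0).
- move=> x y i; case: ifP => _; last by rewrite addr0.
  rewrite (tsD _ _ i).1 (tsD _ _ _).2 (tsD _ _ i.+1).1.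
  by congr ExtAlg => /=; ring.
- move=> u x i; case: ifP => [iN|_]; last by rewrite mulr0.
  rewrite (tsZ _ _ i).1 (tsZ _ _ _).2 (tsZ _ _ i.+1).1 iN.
  by congr ExtAlg => /=; ring.
- by move=> x i; rewrite leqNgt => /negPf ->.
have [|p pE] := neg_map (f := fun (c : {ffun 'I_N.+1 -> L1}) i => coef1 (fent c i))
  (g := fun c i => if (i < N)%N then coefa (fent c i) + coefb (fent c i.+1) else 0) _ tsW.
  split.
  - by move=> x y j; rewrite !fentD; split=> //=; case: ifP => _; ring.
  - by move=> u x j; rewrite !fentZ; split=> //=; case: ifP => _; ring.
  - move=> c j; split=> Nj; first by rewrite fent_ge.
    by rewrite ltnNge Nj.
have fent0 j : fent (0 : {ffun 'I_N.+1 -> L1}) j = 0.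
  by rewrite /fent; case: insub => // ?; rewrite ffunE.
exists i, p; split.
- move=> x y xy; have e j : fent (i x) j = fent (i y) j by rewrite xy.
  apply: ts_ext => j.
    have [Nj|jN] := ltnP N j.
      move: Nj; rewrite leq_eqVlt => /orP[/eqP <-|Nj]; last first.
        by rewrite (ts0 x j).1 // (ts0 y j).1.
      by have := e N; rewrite !iE ltnSn => -[/oppr_inj].
    by have := e j; rewrite !iE ltnS jN => -[].
  have [Nj|jN] := ltnP N j; first by rewrite (ts0 x j).2 // (ts0 y j).2.
  by have := e j; rewrite !iE ltnS jN => -[].
- move=> c; split=> [pc|[x <-]]; last first.
    have p0 : t' 0 =1 (fun=> 0) /\ s' 0 =1 (fun=> 0).
      rewrite -(raddf0 p); split=> j; rewrite ?(pE 0).1 ?(pE 0).2 ?fent0 //.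
      by rewrite addr0; case: ifP.
    apply: ts_ext' => j; rewrite ?(pE _).1 ?(pE _).2 ?p0.1 ?p0.2 ?iE; first by case: ifP.
    case: ifP => // jN; rewrite !ltnS jN (ltnW jN) /=.
    exact: addNr.
  have c1 j : coef1 (fent c j) = 0.
    by have := (pE c).1 j; rewrite pc -(raddf0 p) (pE 0).1 fent0.
  have cab j : (j < N)%N -> coefa (fent c j) + coefb (fent c j.+1) = 0.
    by move=> jN; have := (pE c).2 j; rewrite pc -(raddf0 p) (pE 0).2 jN !fent0 addr0.
  (* The top coordinates up to [N] are read from [coefb]; the coordinate [N.+1] is the free
     parameter [- coefa c_N]. *)
  have [x xE] := ts_surj
    (fun j => if (j <= N)%N then coefb (fent c j) else - coefa (fent c N))
    (fun j => coefab (fent c j)).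
  exists x; apply: fent_ext => j; rewrite iE.
  case: ifP => [jN|/negbT]; last by rewrite -leqNgt => Nj; rewrite fent_ge.
  rewrite (xE j).1 ?(xE j.+1).1 ?(xE j).2 ?(ltnW jN) //.
  rewrite -(ltnS j N) jN; apply: ext_alg_eq => //=.
  move: jN; rewrite ltnS leq_eqVlt => /orP[/eqP ->|jN]; first by rewrite ltnn opprK.
  by rewrite jN; apply/eqP; rewrite eq_sym -addr_eq0 cab.
- move=> y; pose cf j := ExtAlg (t' y j) (s' y j) 0 0.
  exists [ffun j : 'I_N.+1 => cf j : L1].
  apply: ts_ext' => j; rewrite ?(pE _).1 ?(pE _).2.
    have [Nj|jN] := leqP N.+1 j; last by rewrite (fent_fun cf).
    by rewrite fent_ge // (ts0' y j).1.
  case: ltnP => [jN|Nj]; last by rewrite (ts0' y j).2.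
  rewrite (fent_fun cf) 1?ltnW //=.
  by rewrite (fent_fun cf) //= addr0.
Qed.

Lemma S_ses (n : int) : exists m (i : {linear S_ k (n - 1) -> {ffun 'I_m -> L1}})
  (p : {linear {ffun 'I_m -> L1} -> S_ k n}), ses i p.
Proof.
(* The two families meet in [S_0]: it enters the sequence for [n = 1] with positive coordinates and
   that for [n = 0] with negative ones. *)
have [N [->|->]] : exists N : nat, n = N.+1 \/ n = - N%:Z.
  case: n => N; last by exists N.+1; right; rewrite NegzE.
  by case: N => [|N]; [exists 0%N; right|exists N; left].
  have [t [s ts]] := S_pos_coord k N; have [t' [s' ts']] := S_pos_coord k N.+1.
  exists N.+1; rewrite (_ : N.+1%:Z - 1 = N); first exact: pos_ses ts ts'.
  by rewrite intS addrAC subrr add0r.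
have [t [s ts]] := S_neg_coord k N.+1; have [t' [s' ts']] := S_neg_coord k N.
exists N.+1; rewrite (_ : - N%:Z - 1 = - N.+1%:Z); first exact: neg_ses ts ts'.
by rewrite intS opprD addrC.
Qed.

End Syzygies.

(** * Modules whose endomorphisms act by scalars on the socle *)

Section SocleScalar.
Variable k : fieldType.
Local Notation L := (ext_alg k).
Local Notation L1 := (L^o : lmodType L).
Local Notation iota := (GRing.in_alg L : {rmorphism k -> L}).
Local Notation restr := (restr iota).
Local Notation al := (alpha k).
Local Notation be := (beta k).
Implicit Types X Y Z M T : lmodType L.

Definition in_soc X (x : X) : Prop := al *: x = 0 /\ be *: x = 0.

(** A substitute for a local endomorphism ring: the socle being essential and [T]
    finite-dimensional, an endomorphism with nonzero scalar is bijective; and the scalars are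
    additive, so a decomposition of the identity has an invertible term. *)
Definition socle_scalar T : Prop :=
  [/\ fin_gen T, exists x : T, x != 0 /\ in_soc x,
      forall x : T, x != 0 -> exists u : L, u *: x != 0 /\ in_soc (u *: x)
    & forall f : {linear T -> T}, exists c : k,
        forall x, in_soc x -> f x = iota c *: x].

(** Beware of the order: [T] is the summand and [X] the ambient module. *)
Definition retract X T : Prop :=
  exists (u : {linear T -> X}) (v : {linear X -> T}), cancel u v.

Lemma iota_neq0 (c : k) X (x : X) : c != 0 -> iota c *: x = 0 -> x = 0.
Proof.
move=> c0 cx; have cc : iota c^-1 * iota c = 1 by rewrite -rmorphM mulVf ?rmorph1.
by rewrite -[x]scale1r -cc -scalerA cx scaler0.
Qed.

Lemma iota_inj (c d : k) X (x : X) : x != 0 -> iota c *: x = iota d *: x -> c = d.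
Proof.
move=> x0 /eqP; rewrite -subr_eq0 -scalerBl -rmorphB => /eqP cd.
apply/eqP; rewrite -subr_eq0; apply/negPn/negP => /iota_neq0 /(_ cd) /eqP.
exact/negP.
Qed.

Lemma in_soc_lin X Y (f : {linear X -> Y}) x : in_soc x -> in_soc (f x).
Proof. by case=> ax bx; split; rewrite -linearZZ ?ax ?bx raddf0. Qed.

Lemma inj_surj_ext X (f : {linear X -> X}) : fin_gen X -> injective f -> surjective f.
Proof.
move=> Xf fI; have [h hE] := restr_lin iota f.
have hI : injective h by move=> x y; rewrite !hE => /fI.
move=> y; have [x xE] := inj_surj (fin_gen_restr (ext_fin k) Xf) hI y.
by exists x; rewrite -hE.
Qed.

Lemma socle_scalar_bij T (f : {linear T -> T}) c : socle_scalar T -> c != 0 ->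
  (forall x, in_soc x -> f x = iota c *: x) ->
  exists g : {linear T -> T}, cancel f g /\ cancel g f.
Proof.
move=> [Tf _ ess _] c0 fc.
have fI : injective f.
  apply: linear_inj => x fx; apply/eqP; apply: contrapT => /negP /ess [u [ux0 us]].
  have := fc _ us; rewrite linearZZ fx scaler0 => /esym /(iota_neq0 c0) /eqP.
  exact/negP.
exact: linear_bij fI (inj_surj_ext Tf fI).
Qed.

Lemma socle_scalar_sum T (I : finType) (h : I -> {linear T -> T}) :
  socle_scalar T -> (forall x, x = \sum_i h i x) ->
  exists i (g : {linear T -> T}), cancel (h i) g /\ cancel g (h i).
Proof.
move=> Tl hE; have [_ [x [x0 xs]] _ scal] := Tl.
have [c cE] := choice (fun i => scal (h i)).
suff [i ci] : exists i, c i != 0.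
  by exists i; exact: socle_scalar_bij Tl ci (cE i).
apply: contrapT => c0; move/eqP: x0; apply.
rewrite (hE x) big1 // => i _; rewrite cE // (_ : c i = 0) ?rmorph0 ?scale0r //.
by apply/eqP/negPn/negP => ci; apply: c0; exists i.
Qed.

Lemma retract_addin T M : socle_scalar T -> addin M T -> retract M T.
Proof.
move=> Tl [I [u [v uv]]].
have [i [g [gK _]]] := socle_scalar_sum (h := fun i => v i \o u i) Tl uv.
by exists (u i), (g \o v i) => x; exact: gK.
Qed.

Lemma addin_of_retract T M : retract M T -> addin M T.
Proof. by move=> [u [v uK]]; exact: addin_retract uK. Qed.

Lemma retract_sum T X M1 M2 (p1 : {linear X -> M1}) (i1 : {linear M1 -> X})
    (p2 : {linear X -> M2}) (i2 : {linear M2 -> X}) :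
  socle_scalar T -> (forall x, x = i1 (p1 x) + i2 (p2 x)) -> retract X T ->
  retract M1 T \/ retract M2 T.
Proof.
move=> Tl idX [u [v uK]].
have [|b [g [gK _]]] := socle_scalar_sum
  (h := fun b : bool => if b then (v \o i1 \o p1 \o u : {linear T -> T})
                        else (v \o i2 \o p2 \o u : {linear T -> T})) Tl.
  by move=> x; rewrite big_bool /= -linearD -idX uK.
case: b gK => gK; [left|right].
  by exists (p1 \o u), (g \o (v \o i1)) => x; exact: gK.
by exists (p2 \o u), (g \o (v \o i2)) => x; exact: gK.
Qed.

Lemma retract_pair T X Y : socle_scalar T -> retract (X * Y)%type T ->
  retract X T \/ retract Y T.
Proof.
have [i iE] := pair_lin (idfun : {linear X -> X}) (\0 : {linear X -> Y}).
have [j jE] := pair_lin (\0 : {linear Y -> X}) (idfun : {linear Y -> Y}).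
move=> Tl; apply: (retract_sum (p1 := (fst : {linear (X * Y)%type -> X})) (i1 := i)
  (p2 := (snd : {linear (X * Y)%type -> Y})) (i2 := j)) => // -[x y].
by rewrite iE jE; congr pair; rewrite /= ?addr0 ?add0r.
Qed.

(** The scalar of [u \o v] is 1, because [u \o v] fixes the nonzero socle element [u x]; hence
    [u \o v] is bijective. *)
Lemma retract_socle_scalar T T' (u : {linear T -> T'}) (v : {linear T' -> T}) :
  socle_scalar T -> socle_scalar T' -> cancel u v -> bijective u.
Proof.
move=> [_ [x [x0 xs]] _ _] T'l uK; have [_ _ _ scal] := T'l.
have [c cE] := scal (u \o v).
have us := in_soc_lin u xs.
have c1 : c = 1.
  apply: (iota_inj (x := u x)); last first.
    by rewrite -cE // rmorph1 scale1r /= uK.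
  by apply: contra x0 => /eqP ux; rewrite -(uK x) ux raddf0.
have [|g [_ gK]] := socle_scalar_bij T'l _ cE; first by rewrite c1 oner_eq0.
exists v => // y; rewrite -(gK y) /=.
by rewrite uK.
Qed.

Definition inverse X (f g : {linear X -> X}) : Prop := cancel f g /\ cancel g f.

(* [1 - v u] is invertible as soon as [1 - u v] is. *)
Lemma drop_summand T X (f : {linear X -> X}) (u : {linear X -> T}) (v : {linear T -> X}) :
  socle_scalar T -> ~ retract X T -> (forall x, x = f x + v (u x)) ->
  exists g, inverse f g.
Proof.
move=> Tl nXT fE; have [_ [x0 _] _ scal] := Tl; have [c cE] := scal (u \o v).
have c0 : c = 0.
  apply/eqP/negPn/negP => c0; apply: nXT.
  have [g [gK _]] := socle_scalar_bij Tl c0 cE.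
  by exists v, (g \o u) => x; exact: gK.
have [w wE] := sub_lin idfun (u \o v : {linear _ -> _}).
have [|w' [w'K wK']] := @socle_scalar_bij T w 1 Tl (oner_neq0 _).
  by move=> x xs; rewrite wE cE // c0 rmorph0 rmorph1 scale0r subr0 scale1r.
have [g gE] := add_lin idfun (v \o (w' \o u) : {linear _ -> _}).
have fE' x : f x = x - v (u x) by rewrite {2}(fE x) addrK.
exists g; split=> x.
  rewrite gE /= fE' linearB.
  have -> : u x - u (v (u x)) = w (u x) by rewrite wE.
  by rewrite w'K subrK.
have ug : u (g x) = w' (u x).
  have uvw : u (v (w' (u x))) = w' (u x) - u x by rewrite -{3}(wK' (u x)) wE /= subKr.
  by rewrite gE linearD /= uvw addrC subrK.
by rewrite fE' ug gE /= addrK.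
Qed.

(** Induction on the number of terms: [F], which is the identity minus one term, is invertible by
    [drop_summand], and composing with its inverse [g] leaves a decomposition of the identity with
    one term fewer. *)
Lemma drop_thru T X (f : {linear X -> X}) (h : X -> X) :
  socle_scalar T -> ~ retract X T -> thru T h -> (forall x, x = f x + h x) ->
  exists g, inverse f g.
Proof.
move=> Tl nXT [I [u [v uv]]] fE.
have {uv}fE x : x = f x + \sum_(i <- index_enum I) v i (u i x) by rewrite -uv.
elim: (index_enum I) f v fE => [|i s IH] f v fE.
  by exists idfun; split=> x; rewrite [in RHS](fE x) big_nil addr0.
have [F0 F0E] := sum_lin u v.
have [F FE] : exists F : {linear X -> X},
    forall x, F x = f x + \sum_(j <- s) v j (u j x).
  apply: linear_lift => a x y; rewrite linearP scalerDr addrACA scaler_sumr -big_split.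
  by congr (_ + _); apply: eq_bigr => j _; rewrite !linearP.
have [|g [gK Kg]] := @drop_summand T X F (u i) (v i) Tl nXT.
  by move=> x; rewrite FE -addrA [_ + v i _]addrC {1}(fE x) big_cons.
have [|g' [g'K Kg']] := IH (g \o f : {linear X -> X}) (fun j => g \o v j : {linear T -> X}).
  by move=> x; rewrite -[LHS]gK FE linearD linear_sum.
exists (g' \o g); split=> x /=; first exact: g'K.
by rewrite -[LHS]Kg; have /= -> := Kg' (g x); rewrite Kg.
Qed.

(** Cancellation: the part [f] of the identity that passes through [Y] is invertible by
    [drop_thru]. *)
Lemma drop_addin T Y X : socle_scalar T -> ~ retract X T ->
  addin (T * Y)%type X -> addin Y X.
Proof.
move=> Tl nXT [I [u [v uv]]].
have [i iE] := pair_lin (idfun : {linear T -> T}) (\0 : {linear T -> Y}).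
have [j jE] := pair_lin (\0 : {linear Y -> T}) (idfun : {linear Y -> Y}).
have [f fE] := sum_lin (fun l => (snd : {linear (T * Y)%type -> Y}) \o u l : {linear X -> Y})
  (fun l => v l \o j : {linear Y -> X}).
have [h hE] := sum_lin (fun l => (fst : {linear (T * Y)%type -> T}) \o u l : {linear X -> T})
  (fun l => v l \o i : {linear T -> X}).
have [||g [_ Kg]] := @drop_thru T X f h Tl nXT.
- by exists I, (fun l => (fst : {linear (T * Y)%type -> T}) \o u l : {linear X -> T}),
    (fun l => v l \o i : {linear T -> X}).
- move=> x; rewrite [LHS]uv fE hE -big_split; apply: eq_bigr => l _ /=.
  rewrite -linearD iE jE; congr (v l _); case: (u l x) => a b.
  by congr pair; rewrite /= ?addr0 ?add0r.
have fY : thru Y f.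
  by exists I, (fun l => (snd : {linear (T * Y)%type -> Y}) \o u l : {linear X -> Y}),
    (fun l => v l \o j : {linear Y -> X}).
by apply: thru_eq (thru_comp idfun g fY) _ => x /=; rewrite Kg.
Qed.

Lemma drop_all T X : socle_scalar T -> ~ retract X T -> addin T X -> zero_module X.
Proof.
move=> Tl nXT TX; have [|g [gK _]] := @drop_thru T X \0 id Tl nXT TX.
  by move=> x; rewrite add0r.
by move=> x; rewrite -(gK x) raddf0.
Qed.

(** Maps [T -> M -> T] act on the socle by the product of the scalars of their components along [T],
    as the part through [M1] has scalar 0. Two independent copies of [T] would force [b a = 1],
    [b a' = 0] and [b' a' = 1] in the field. *)
Lemma no_double T M1 M (i1 : {linear T -> M}) (p1 : {linear M -> T})
    (i2 : {linear M1 -> M}) (p2 : {linear M -> M1})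
    (u u' : {linear T -> M}) (v v' : {linear M -> T}) :
  socle_scalar T -> ~ retract M1 T -> (forall x, x = i1 (p1 x) + i2 (p2 x)) ->
  cancel u v -> cancel u' v' -> (forall x, v (u' x) = 0) -> False.
Proof.
move=> Tl nT idM uK u'K vu'; have [_ [x [x0 xs]] _ scal] := Tl.
have key (a : {linear T -> M}) (b : {linear M -> T}) c d :
    (forall x, in_soc x -> p1 (a x) = iota c *: x) ->
    (forall x, in_soc x -> b (i1 x) = iota d *: x) ->
    b (a x) = iota (d * c) *: x.
  move=> cE dE; rewrite {1}(idM (a x)) linearD cE // (linearZZ i1) (linearZZ b) dE // scalerA -rmorphM mulrC.
  have [e eE] := scal (b \o i2 \o p2 \o a).
  have e0 : e = 0.
    apply/eqP/negPn/negP => e0; apply: nT.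
    have [g [gK _]] := socle_scalar_bij Tl e0 eE.
    by exists (p2 \o a), (g \o (b \o i2)) => y; exact: gK.
  have -> : b (i2 (p2 (a x))) = iota e *: x := eE x xs.
  by rewrite e0 rmorph0 scale0r addr0.
have [a aE] := scal (p1 \o u); have [a' a'E] := scal (p1 \o u').
have [b bE] := scal (v \o i1); have [b' b'E] := scal (v' \o i1).
have ba : b * a = 1.
  by apply: (iota_inj x0); rewrite -(key u v) // uK rmorph1 scale1r.
have ba' : b * a' = 0.
  by apply: (iota_inj x0); rewrite -(key u' v) // vu' rmorph0 scale0r.
have b'a' : b' * a' = 1.
  by apply: (iota_inj x0); rewrite -(key u' v') // u'K rmorph1 scale1r.
move: ba' => /eqP; rewrite mulf_eq0 => /orP[] /eqP z0.
  by move: ba; rewrite z0 mul0r => /esym/eqP; rewrite oner_eq0.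
by move: b'a'; rewrite z0 mulr0 => /esym/eqP; rewrite oner_eq0.
Qed.

End SocleScalar.

(** * The socle of [L] and of [S_n] *)

Section SocleOfS.
Variable k : fieldType.
Local Notation L := (ext_alg k).
Local Notation L1 := (L^o : lmodType L).
Local Notation iota := (GRing.in_alg L : {rmorphism k -> L}).
Local Notation restr := (restr iota).
Local Notation al := (alpha k).
Local Notation be := (beta k).

Lemma regular_in_soc (u : L) : in_soc (u : L1) -> u = ExtAlg 0 0 0 (coefab u).
Proof. by case; exact: ext_socle. Qed.

Lemma regular_socle_scalar : socle_scalar L1.
Proof.
split; first exact: fin_gen_regular.
- exists (al * be); split; last by split; congr ExtAlg => /=; ring.
  have e : coefab (al * be) = 1 by rewrite /=; ring.
  by apply/eqP => /(congr1 (@coefab k)); rewrite e => /eqP; rewrite oner_eq0.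
- move=> x x0; pose ok (u : L) := u *: x != 0 /\ in_soc (u *: x).
  have nz (d : k) : d != 0 -> ExtAlg 0 0 0 d != 0 :> L.
    by move=> d0; apply: contra d0 => /eqP [->].
  have soc (d : k) : in_soc (ExtAlg 0 0 0 d : L1).
    by split; congr ExtAlg => /=; ring.
  have okd (u : L) (d : k) : u * x = ExtAlg 0 0 0 d -> d != 0 -> ok u.
    by move=> ux d0; rewrite /ok {1 2}/GRing.scale /= ux; split; [exact: nz|exact: soc].
  have [c0|c0] := eqVneq (coef1 (x : L)) 0; last first.
    by exists (al * be); apply: okd c0; case: (x) => *; congr ExtAlg => /=; ring.
  have [a0|a0] := eqVneq (coefa (x : L)) 0; last first.
    exists be; apply: (okd _ (- coefa (x : L))); last by rewrite oppr_eq0.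
    by move: c0; case: (x) => /= ? ? ? ? ->; congr ExtAlg => /=; ring.
  have [b0|b0] := eqVneq (coefb (x : L)) 0; last first.
    exists al; apply: okd b0.
    by move: c0; case: (x) => /= ? ? ? ? ->; congr ExtAlg => /=; ring.
  have xE : x = ExtAlg 0 0 0 (coefab (x : L)).
    by move: c0 a0 b0; case: (x) => /= ? ? ? ? -> -> ->.
  exists 1; apply: (okd 1 (coefab (x : L))); first by rewrite mul1r.
  by apply: contra x0 => /eqP c; rewrite xE c.
(* An endomorphism is right multiplication by [f 1], and on the socle only the constant coefficient
   of [f 1] acts. *)
- move=> f; exists (coef1 (f 1 : L)) => x /regular_in_soc xE.
  rewrite -{1}(regular_scale1 x) linearZZ xE.
  by case: (f 1) => *; congr ExtAlg => /=; ring.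
Qed.

Lemma toeplitz (B : nat -> nat -> k) M N :
  (forall i j, (i < M)%N -> (j < N)%N -> B i.+1 j.+1 = B i j) ->
  forall d i j, (i + d <= M)%N -> (j + d <= N)%N -> B (i + d)%N (j + d)%N = B i j.
Proof.
move=> BS; elim=> [|d IH] i j iM jN; first by rewrite !addn0.
by rewrite !addnS in iM jN *; rewrite BS // IH // ltnW.
Qed.

(** Let [B] be the matrix of [f] on the socle basis [F]. From [alpha E_j = F_j] and
    [beta E_j = F_(j+1)] it is constant along diagonals and vanishes above the main one; as it has
    no rows beyond [N], it vanishes below too. *)
Lemma pos_socle_scalar N (V : lmodType L) (t s : V -> nat -> k) :
  fin_gen V -> pos_coord N t s -> socle_scalar V.
Proof.
move=> Vf [[tsD tsZ ts0] ts_ext ts_surj].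
have t0 i : t 0 i = 0 by have := (tsZ 0 0 i).1; rewrite scaler0 mul0r.
have s0 i : s 0 i = 0.
  by have := (tsZ 0 0 i).2; rewrite scaler0 !mul0r !add0r; case: i => // i; rewrite mul0r.
have socP x : in_soc x <-> t x =1 (fun=> 0).
  split=> [[ax _] i|tx].
    by have := (tsZ al x i).2; rewrite ax s0 /= mul0r mul1r add0r; case: i => [|i];
      rewrite ?mul0r addr0.
  split; apply: ts_ext => i.
  - by rewrite (tsZ _ _ _).1 t0 mul0r.
  - by rewrite (tsZ _ _ _).2 s0 tx; case: i => [|i]; rewrite ?tx /=; ring.
  - by rewrite (tsZ _ _ _).1 t0 mul0r.
  - by rewrite (tsZ _ _ _).2 s0 tx; case: i => [|i]; rewrite ?tx /=; ring.
have [E EE] : exists E : nat -> V, forall j i, t (E j) i = ((i < N)%N && (i == j))%:R /\ s (E j) i = 0.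
  have Ej j : exists e, forall i, t e i = ((i < N)%N && (i == j))%:R /\ s e i = 0.
    have [e eE] := ts_surj (fun i => (i == j)%:R) (fun=> 0); exists e => i; split.
      by case: ltnP => iN; [exact: (eE i).1|exact: (ts0 e i).1].
    by case: (ltnP N i) => iN; [exact: (ts0 e i).2|exact: (eE i).2].
  by have [E EE] := choice Ej; exists E.
have [F FE] : exists F : nat -> V, forall j i, t (F j) i = 0 /\ s (F j) i = ((i <= N)%N && (i == j))%:R.
  have Fj j : exists e, forall i, t e i = 0 /\ s e i = ((i <= N)%N && (i == j))%:R.
    have [e eE] := ts_surj (fun=> 0) (fun i => (i == j)%:R); exists e => i; split.
      by case: (ltnP i N) => iN; [exact: (eE i).1|exact: (ts0 e i).1].
    by case: (leqP i N) => iN; [exact: (eE i).2|exact: (ts0 e i).2].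
  by have [F FE] := choice Fj; exists F.
have soc_sum x : in_soc x -> x = \sum_(j < N.+1) iota (s x j) *: F j.
  move=> /socP tx.
  have tsum i : t (\sum_(j < N.+1) iota (s x j) *: F j) i = \sum_(j < N.+1) t (iota (s x j) *: F j) i.
    by apply: (big_morph (fun y => t y i)) => // y z; exact: (tsD y z i).1.
  have ssum i : s (\sum_(j < N.+1) iota (s x j) *: F j) i = \sum_(j < N.+1) s (iota (s x j) *: F j) i.
    by apply: (big_morph (fun y => s y i)) => // y z; exact: (tsD y z i).2.
  have sF j i : s (iota (s x j) *: F j) i = s x j * ((i <= N)%N && (i == j))%:R.
    rewrite (tsZ _ _ _).2 (FE _ _).2 (FE _ _).1 /= mulr1 !mulr0 addr0.
    by case: i => [|i]; rewrite ?(FE _ _).1 ?mulr0 addr0.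
  apply: ts_ext => i; rewrite ?tsum ?ssum.
    by rewrite tx big1 // => j _; rewrite (tsZ _ _ _).1 (FE _ _).1 mulr0.
  have [iN|Ni] := leqP i N; last first.
    rewrite (ts0 x i).2 // big1 // => j _.
    by rewrite sF [(i <= N)%N]leqNgt Ni mulr0.
  rewrite (bigD1 (Ordinal (iN : (i < N.+1)%N))) //= sF iN eqxx mulr1.
  rewrite big1 ?addr0 // => j ji; rewrite sF iN /= eq_sym.
  by move: ji; rewrite -val_eqE /= => /negPf ->; rewrite mulr0.
have Fsoc j : in_soc (F j) by apply/socP => i; rewrite (FE j i).1.
split=> //.
- exists (F 0%N); split=> //; apply/eqP => F0.
  by have := (FE 0%N 0%N).2; rewrite F0 s0 /= => /esym/eqP; rewrite oner_eq0.
- move=> x x0; have [tx|] := pselect (t x =1 (fun=> 0)).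
    by exists 1; rewrite scale1r; split=> //; exact/socP.
  move=> /existsNP [i /eqP txi]; exists al; split.
    apply: contra txi => /eqP ax; have := (tsZ al x i).2.
    by rewrite ax s0 /= mul0r mul1r add0r; case: (i) => [|j]; rewrite ?mul0r addr0 => <-.
  by apply/socP => j; rewrite (tsZ _ _ _).1 mul0r.
move=> f; pose B i j := s (f (F j)) i.
have aE j : (j < N)%N -> al *: E j = F j.
  move=> jN; apply: ts_ext => i; rewrite ?(tsZ _ _ _).1 ?(tsZ _ _ _).2 /=.
    by rewrite (FE _ _).1 mul0r.
  rewrite (FE _ _).2 (EE _ _).1 mul0r mul1r add0r.
  have -> : (if i is j0.+1 then 0 * t (E j) j0 else 0) = 0 by case: (i) => // ?; rewrite mul0r.
  rewrite addr0; congr (_%:R); have [->|_] := eqVneq i j; rewrite ?andbF //.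
  by rewrite jN (ltnW jN).
have bE j : (j < N)%N -> be *: E j = F j.+1.
  move=> jN; apply: ts_ext => i; rewrite ?(tsZ _ _ _).1 ?(tsZ _ _ _).2 /=.
    by rewrite (FE _ _).1 mul0r.
  rewrite (FE _ _).2 mul0r mul0r !add0r.
  case: i => [|i]; first by rewrite andbF.
  by rewrite (EE _ _).1 mul1r eqSS.
have aB i j : (j < N)%N -> B i j = t (f (E j)) i.
  move=> jN; rewrite /B -aE // linearZZ (tsZ _ _ _).2 /= mul0r mul1r add0r.
  by case: i => [|i]; rewrite ?mul0r addr0.
have bB i j : (j < N)%N -> B i.+1 j.+1 = t (f (E j)) i /\ B 0%N j.+1 = 0.
  move=> jN; rewrite /B -bE // linearZZ !(tsZ _ _ _).2 /= !mul0r !add0r mul1r.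
  by [].
have BS i j : (i < i.+1)%N -> (j < N)%N -> B i.+1 j.+1 = B i j.
  by move=> _ jN; rewrite (bB i j jN).1 aB.
have B0 i j : (i <= N)%N -> (j <= N)%N -> i != j -> B i j = 0.
  move=> iN jN; rewrite neq_ltn => /orP[ij|ji].
    have := @toeplitz B N N (fun i j _ => BS i j (ltnSn i)) i 0%N (j - i)%N.
    rewrite add0n subnK ?(ltnW ij) // => -> //.
    by rewrite -(subnSK ij) (bB 0%N _ _).2 // subnSK // (leq_trans (leq_subr _ _)).
  (* Slide down the diagonal to column [N]; the row then exceeds [N], where [s] is zero. *)
  have [d dE] : exists d, (N = j + d)%N by exists (N - j)%N; rewrite subnKC.
  have := @toeplitz B (i + d)%N N (fun i j _ => BS i j (ltnSn i)) d i j (leqnn _).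
  rewrite -dE => /(_ (leqnn _)) <-.
  by rewrite /B (ts0 _ _).2 // dE ltn_add2r.
have Bd i : (i <= N)%N -> B i i = B 0%N 0%N.
  by move=> iN; have := @toeplitz B N N (fun i j _ => BS i j (ltnSn i)) i 0%N 0%N; rewrite add0n; apply.
have fF j : (j <= N)%N -> f (F j) = iota (B 0%N 0%N) *: F j.
  move=> jN; have /socP fs := in_soc_lin f (Fsoc j).
  apply: ts_ext => i; first by rewrite fs (tsZ _ _ _).1 (FE _ _).1 mulr0.
  have -> : s (iota (B 0%N 0%N) *: F j) i = B 0%N 0%N * ((i <= N)%N && (i == j))%:R.
    rewrite (tsZ _ _ _).2 (FE _ _).2 (FE _ _).1 /= mulr1 !mulr0 addr0.
    by case: i => [|i]; rewrite ?(FE _ _).1 ?mulr0 addr0.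
  have [iN|Ni] := leqP i N; last by rewrite (ts0 _ _).2 // mulr0.
  have [->|ij] := eqVneq i j; first by rewrite mulr1 -(Bd j jN).
  by rewrite mulr0 -(B0 i j).
exists (B 0%N 0%N) => x xs; rewrite {1}(soc_sum x xs) {2}(soc_sum x xs).
rewrite linear_sum scaler_sumr; apply: eq_bigr => j _.
by rewrite linearZZ fF ?scalerA -?rmorphM 1?mulrC // -ltnS.
Qed.

(** Now [B] is taken on the top basis [F]: [alpha F_j = E_j = beta F_(j+1)] make it constant along
    diagonals and equal to the action on the socle, while [alpha F_(N+1) = 0] and [beta F_0 = 0]
    give the zeros. [S_0], which is its own socle, is left to the positive coordinates. *)
Lemma neg_socle_scalar N (V : lmodType L) (t s : V -> nat -> k) :
  fin_gen V -> neg_coord N.+1 t s -> socle_scalar V.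
Proof.
move=> Vf [[tsD tsZ ts0] ts_ext ts_surj].
have t0 i : t 0 i = 0 by have := (tsZ 0 0 i).1; rewrite scaler0 mul0r.
have s0 i : s 0 i = 0.
  by have := (tsZ 0 0 i).2; rewrite scaler0 !mul0r !add0r; case: ifP.
have alE x i : s (al *: x) i = if (i < N.+1)%N then t x i else 0.
  by rewrite (tsZ _ _ _).2 /= mul0r mul1r mul0r addr0 add0r.
have beE x i : s (be *: x) i = if (i < N.+1)%N then t x i.+1 else 0.
  by rewrite (tsZ _ _ _).2 /= mul0r mul1r mul0r !add0r.
have socP x : in_soc x <-> t x =1 (fun=> 0).
  split=> [[ax bx] i|tx].
    have [iN|] := ltnP i N.+1; first by have := alE x i; rewrite ax s0 iN.
    rewrite leq_eqVlt => /orP[/eqP <-|Ni]; last exact: (ts0 x i).1.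
    by have := beE x N; rewrite bx s0 ltnSn.
  split; apply: ts_ext => i.
  - by rewrite (tsZ _ _ _).1 t0 mul0r.
  - by rewrite alE s0 tx if_same.
  - by rewrite (tsZ _ _ _).1 t0 mul0r.
  - by rewrite beE s0 tx if_same.
have [F FE] : exists F : nat -> V, forall j i, t (F j) i = ((i <= N.+1)%N && (i == j))%:R /\ s (F j) i = 0.
  have Fj j : exists e, forall i, t e i = ((i <= N.+1)%N && (i == j))%:R /\ s e i = 0.
    have [e eE] := ts_surj (fun i => (i == j)%:R) (fun=> 0); exists e => i; split.
      by case: (leqP i N.+1) => iN; [exact: (eE i).1|exact: (ts0 e i).1].
    by case: (ltnP i N.+1) => iN; [exact: (eE i).2|exact: (ts0 e i).2].
  by have [F FE] := choice Fj; exists F.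
have [E EE] : exists E : nat -> V, forall j i, t (E j) i = 0 /\ s (E j) i = ((i < N.+1)%N && (i == j))%:R.
  have Ej j : exists e, forall i, t e i = 0 /\ s e i = ((i < N.+1)%N && (i == j))%:R.
    have [e eE] := ts_surj (fun=> 0) (fun i => (i == j)%:R); exists e => i; split.
      by case: (leqP i N.+1) => iN; [exact: (eE i).1|exact: (ts0 e i).1].
    by case: (ltnP i N.+1) => iN; [exact: (eE i).2|exact: (ts0 e i).2].
  by have [E EE] := choice Ej; exists E.
have sE (c : k) j i : s (iota c *: E j) i = c * ((i < N.+1)%N && (i == j))%:R.
  by rewrite (tsZ _ _ _).2 (EE _ _).2 /= mulr1 !mulr0 !mul0r addr0 if_same addr0.
have soc_sum x : in_soc x -> x = \sum_(j < N.+1) iota (s x j) *: E j.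
  move=> /socP tx.
  have tsum i : t (\sum_(j < N.+1) iota (s x j) *: E j) i = \sum_(j < N.+1) t (iota (s x j) *: E j) i.
    by apply: (big_morph (fun y => t y i)) => // y z; exact: (tsD y z i).1.
  have ssum i : s (\sum_(j < N.+1) iota (s x j) *: E j) i = \sum_(j < N.+1) s (iota (s x j) *: E j) i.
    by apply: (big_morph (fun y => s y i)) => // y z; exact: (tsD y z i).2.
  apply: ts_ext => i; rewrite ?tsum ?ssum.
    by rewrite tx big1 // => j _; rewrite (tsZ _ _ _).1 (EE _ _).1 mulr0.
  have [iN|Ni] := ltnP i N.+1; last first.
    rewrite (ts0 x i).2 // big1 // => j _.
    by rewrite sE ltnNge Ni mulr0.
  rewrite (bigD1 (Ordinal iN)) //= sE iN eqxx mulr1.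
  rewrite big1 ?addr0 // => j ji; rewrite sE iN /= eq_sym.
  by move: ji; rewrite -val_eqE /= => /negPf ->; rewrite mulr0.
have Esoc j : in_soc (E j) by apply/socP => i; rewrite (EE j i).1.
split=> //.
- exists (E 0%N); split=> //; apply/eqP => E0.
  by have := (EE 0%N 0%N).2; rewrite E0 s0 /= => /esym/eqP; rewrite oner_eq0.
- move=> x x0; have [sx|] := pselect (in_soc x); first by exists 1; rewrite scale1r.
  have soc_act (u : L) : coef1 u = 0 -> in_soc (u *: x).
    by move=> u0; apply/socP => i; rewrite (tsZ _ _ _).1 u0 mul0r.
  have [ax|ax] := eqVneq (al *: x) 0; last by exists al; split; [|exact: soc_act].
  have [bx|bx] := eqVneq (be *: x) 0; last by exists be; split; [|exact: soc_act].
  by case.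
move=> f; pose B i j := t (f (F j)) i.
have aE j : al *: F j = if (j < N.+1)%N then E j else 0.
  have tE0 i : t (al *: F j) i = 0 by rewrite (tsZ _ _ _).1 mul0r.
  apply: ts_ext => i; first by rewrite tE0; case: ifP; rewrite ?(EE _ _).1 ?t0.
  rewrite alE (FE _ _).1; case: ltnP => iN.
    rewrite (ltnW iN) /=; case: ltnP => jN; first by rewrite (EE _ _).2 iN.
    by rewrite s0 ltn_eqF // (leq_trans iN).
  case: ifP => _; last by rewrite s0.
  by rewrite (EE _ _).2 [(i < N.+1)%N]ltnNge iN.
have bE j : be *: F j.+1 = E j.
  apply: ts_ext => i; first by rewrite (tsZ _ _ _).1 mul0r (EE _ _).1.
  by rewrite beE (FE _ _).1 (EE _ _).2 eqSS; case: ltnP => // iN; rewrite ltnS iN.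
have b0E : be *: F 0%N = 0.
  apply: ts_ext => i; first by rewrite (tsZ _ _ _).1 mul0r t0.
  by rewrite beE (FE _ _).1 s0 andbF if_same.
have aB i j : (i < N.+1)%N -> (j < N.+1)%N -> s (f (E j)) i = B i j.
  by move=> iN jN; have := aE j; rewrite jN => <-; rewrite linearZZ alE iN.
have aB0 i : (i < N.+1)%N -> B i N.+1 = 0.
  by move=> iN; rewrite /B; have := alE (f (F N.+1)) i; rewrite iN -linearZZ aE ltnn raddf0 s0.
have bB i j : (i < N.+1)%N -> s (f (E j)) i = B i.+1 j.+1.
  by move=> iN; rewrite -bE linearZZ beE iN.
have bB0 i : (i < N.+1)%N -> B i.+1 0%N = 0.
  by move=> iN; rewrite /B; have := beE (f (F 0%N)) i; rewrite iN -linearZZ b0E raddf0 s0.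
have BS i j : (i < N.+1)%N -> (j < N.+1)%N -> B i.+1 j.+1 = B i j.
  by move=> iN jN; rewrite -bB // aB.
have Bd i j : (i < N.+1)%N -> (j < N.+1)%N -> B i j = if i == j then B 0%N 0%N else 0.
  move=> iN jN; have [<-|] := eqVneq i j.
    by have := toeplitz BS (d := i) (i := 0) (j := 0); rewrite add0n; apply; exact: ltnW.
  rewrite neq_ltn => /orP[ij|ji].
    have [d dE] : exists d, (N.+1 = j + d)%N by exists (N.+1 - j)%N; rewrite subnKC // ltnW.
    have iN' : (i + d < N.+1)%N by rewrite dE ltn_add2r.
    have := toeplitz BS (d := d) (i := i) (j := j); rewrite -dE leqnn => <- //; last exact: ltnW.
    exact: aB0.
  have := toeplitz BS (d := j) (i := i - j) (j := 0); rewrite add0n subnK ?(ltnW ji) //.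
  move=> -> //; try exact: ltnW.
  by rewrite -(subnSK ji) bB0 // (leq_ltn_trans (leq_subr _ _)).
have fE j : (j < N.+1)%N -> f (E j) = iota (B 0%N 0%N) *: E j.
  move=> jN; have /socP fs := in_soc_lin f (Esoc j).
  apply: ts_ext => i; first by rewrite fs (tsZ _ _ _).1 (EE _ _).1 mulr0.
  rewrite sE; have [iN|Ni] := ltnP i N.+1; last by rewrite (ts0 _ _).2 // mulr0.
  by rewrite aB // Bd //; case: eqP; rewrite ?mulr1 ?mulr0.
exists (B 0%N 0%N) => x xs; rewrite {1}(soc_sum x xs) {2}(soc_sum x xs).
rewrite linear_sum scaler_sumr; apply: eq_bigr => j _.
by rewrite linearZZ fE ?scalerA -?rmorphM 1?mulrC.
Qed.

Lemma S_fin_gen (n : int) : fin_gen (S_ k n).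
Proof.
have [m [i [p [_ _ pS]]]] := S_ses k n.
exact: fin_gen_surj pS (fin_gen_ffun _ (fin_gen_regular _)).
Qed.

Lemma S_socle_scalar (n : int) : socle_scalar (S_ k n).
Proof.
have Sf := S_fin_gen n; case: n Sf => N Sf.
  by have [t [s ts]] := S_pos_coord k N; exact: pos_socle_scalar Sf ts.
have [t [s ts]] := S_neg_coord k N.+1; move: Sf t s ts; rewrite -NegzE => Sf t s ts.
exact: neg_socle_scalar Sf ts.
Qed.

Lemma S_scaleE (n : int) (c : k) (x : S_ k n) :
  iota c *: x = c *: (x : 'cV[k]_(`|n| + `|n|.+1)) :> 'cV[k]_(`|n| + `|n|.+1).
Proof. by rewrite S_actE /= mulr1 mulr0 !scale0r !addr0. Qed.

Lemma S_dim_le (n : int) (X : lmodType L) (f : {linear S_ k n -> X}) N (g : 'I_N -> X) :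
  injective f -> (forall x, exists c : 'I_N -> k, x = \sum_i iota (c i) *: g i) ->
  (`|n| + `|n|.+1 <= N)%N.
Proof.
move=> fI gP; have [|j jE] := @linear_lift k 'rV[k]_(`|n| + `|n|.+1) (restr X)
  (fun v => f (v^T : 'cV[k]_(`|n| + `|n|.+1))).
  move=> c v w; rewrite restr_scaleE -linearP; congr (f _).
  by rewrite S_scaleE linearP.
by apply: (dim_le (j := j)) gP => v w; rewrite !jE => /fI /trmx_inj.
Qed.

(** The dimension [2|n| + 1] recovers only [|n|], which is enough to tell [S_n] from [S_(n+1)]. *)
Lemma S_retract_dim (n m : int) : retract (S_ k m) (S_ k n) -> `|n|%N = `|m|%N.
Proof.
move=> [u [v uK]].
have [u' uu' u'u] := retract_socle_scalar (S_socle_scalar n) (S_socle_scalar m) uK.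
have span (l : int) x : exists c : 'I_(`|l| + `|l|.+1) -> k,
    x = \sum_i iota (c i) *: ((delta_mx i 0 : 'cV[k]_(`|l| + `|l|.+1)) : S_ k l).
  exists (fun i => (x : 'cV[k]_(`|l| + `|l|.+1)) i 0).
  rewrite [LHS](matrix_sum_delta (x : 'cV[k]_(`|l| + `|l|.+1))).
  by apply: eq_bigr => i _; rewrite big_ord1 -S_scaleE.
have vI : injective v.
  by move=> x y; rewrite -(u'u x) -(u'u y) !uK => ->.
have := S_dim_le (can_inj uK) (@span m); have := S_dim_le vI (@span n).
rewrite !addnS !ltnS !addnn !leq_double => mn nm.
by apply/eqP; rewrite eqn_leq mn nm.
Qed.

Lemma S_annihilated (n : int) (x : S_ k n) : (al * be) *: x = 0.
Proof.
by rewrite [LHS]S_actE /= !mulr0 !mul0r !addr0 !scale0r !addr0.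
Qed.

Lemma S_retract_regular (n : int) : ~ retract (S_ k n) L1 /\ ~ retract L1 (S_ k n).
Proof.
have no (u : {linear L1 -> S_ k n}) (v : {linear S_ k n -> L1}) : cancel u v -> False.
  move=> uK; have := uK (al * be); rewrite -(regular_scale1 (al * be)).
  rewrite linearZZ S_annihilated raddf0 => /esym /(congr1 (@coefab k)).
  rewrite regular_scale1 (_ : coefab (al * be) = 1); last by rewrite /=; ring.
  by move/eqP; rewrite oner_eq0.
split=> -[u [v uK]]; first exact: no uK.
have [u' uu' u'u] := retract_socle_scalar (S_socle_scalar n) regular_socle_scalar uK.
apply: (no v u) => x; by rewrite -[x]u'u uK.
Qed.

End SocleOfS.

(** * Approximations by [S_n (+) S_(n+1)] *)

Section ApproxS.
Variable k : fieldType.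
Local Notation L := (ext_alg k).
Local Notation L1 := (L^o : lmodType L).
Local Notation iota := (GRing.in_alg L : {rmorphism k -> L}).
Local Notation al := (alpha k).
Local Notation be := (beta k).
Implicit Types X Y Z M T C : lmodType L.

Lemma int_ind_from (P : int -> Prop) (a : int) : P a ->
  (forall n, P n -> P (n + 1)) -> (forall n, P n -> P (n - 1)) -> forall n, P n.
Proof.
move=> Pa PS PN n.
have up (m : nat) : P (a + m%:Z).
  by elim: m => [|m IH]; rewrite ?addr0 // -addn1 PoszD addrA; exact: PS.
have down (m : nat) : P (a - m%:Z).
  by elim: m => [|m IH]; rewrite ?subr0 // -addn1 PoszD opprD addrA; exact: PN.
rewrite -(subrKC a n); case: (n - a) => m; first exact: up.
by rewrite NegzE; exact: down.
Qed.

Lemma ses_pair X Y Z X' Y' Z' (i : {linear X -> Y}) (p : {linear Y -> Z})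
    (i' : {linear X' -> Y'}) (p' : {linear Y' -> Z'}) :
  ses i p -> ses i' p' ->
  exists (j : {linear (X * X')%type -> (Y * Y')%type})
    (q : {linear (Y * Y')%type -> (Z * Z')%type}), ses j q.
Proof.
move=> [iI ip pS] [i'I ip' pS'].
have [j jE] := pair_lin (i \o (fst : {linear (X * X')%type -> X}) : {linear _ -> _})
  (i' \o (snd : {linear (X * X')%type -> X'}) : {linear _ -> _}).
have [q qE] := pair_lin (p \o (fst : {linear (Y * Y')%type -> Y}) : {linear _ -> _})
  (p' \o (snd : {linear (Y * Y')%type -> Y'}) : {linear _ -> _}).
exists j, q; split.
- by move=> [x x'] [y y']; rewrite !jE /= => -[/iI -> /i'I ->].
- move=> [y y']; rewrite qE /=; split=> [[/ip [x <-] /ip' [x' <-]]|[[x x']]].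
    by exists (x, x'); rewrite jE.
  rewrite jE /= => -[<- <-]; congr pair; first by apply/ip; exists x.
  by apply/ip'; exists x'.
- move=> [z z']; have [y <-] := pS z; have [y' <-] := pS' z'.
  by exists (y, y'); rewrite qE.
Qed.

Lemma S_annihilator (n : int) (f : {linear S_ k n -> L1}) x : coef1 (f x : L) = 0.
Proof.
have := congr1 f (S_annihilated x); rewrite linearZZ raddf0.
move=> /(congr1 (@coefab k)) e; rewrite -[RHS]e.
by case: (f x : L) => a b c d /=; ring.
Qed.

(** The case [N = 0] of [neg_ses], with the power indexed by ['I_1] replaced by [L]. Since [alpha]
    and [beta] kill [S_0], the map [q] depends on [coef1] only. *)
Lemma radical_ses : exists (j : {linear S_ k (- 1) -> L1}) (q : {linear L1 -> S_ k 0}),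
  ses j q /\ forall u : L, q u = 0 <-> coef1 u = 0.
Proof.
have [t [s ts]] := S_neg_coord k 1; have [t' [s' ts']] := S_neg_coord k 0.
have [i [p [iI ip pS]]] := neg_ses ts ts'.
have [e eE] := @ffun_inj L 'I_1 L1 ord0; have [r rE] := @ffun_proj L 'I_1 L1 ord0.
have er x : e (r x) = x by apply/ffunP => l; rewrite eE rE (ord1 l).
have re x : r (e x) = x by rewrite rE eE.
have [j jE] : exists j : {linear S_ k (- 1) -> L1}, forall x, j x = r (i x).
  by exists (r \o i).
have [q qE] : exists q : {linear L1 -> S_ k 0}, forall x, q x = p (e x).
  by exists (p \o e).
have sq : ses j q.
  split.
  - by move=> x y; rewrite !jE => /(congr1 e) /=; rewrite !er => /iI.
  - move=> u; rewrite qE; split=> [/ip [x xE]|[x <-]]; first by exists x; rewrite jE xE re.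
    by rewrite jE er; apply/ip; exists x.
  - by move=> y; have [x <-] := pS y; exists (r x); rewrite qE er.
exists j, q; split=> // u.
have S0_soc (x : S_ k 0) : in_soc x.
  have [[_ tsZ _] ts_ext _] := ts'.
  have z0 i0 : t' 0 i0 = 0 /\ s' 0 i0 = 0.
    have [] := tsZ 0 0 i0; rewrite scaler0 !mul0r => -> ->.
    by rewrite ltn0 addr0.
  by split; apply: ts_ext => i0; rewrite ?(z0 i0).1 ?(z0 i0).2 ?(tsZ _ _ _).1
    ?(tsZ _ _ _).2 ?mul0r // ltn0 addr0.
have qu v : q v = iota (coef1 (v : L)) *: q 1.
  have [ax bx] := S0_soc (q 1).
  by rewrite -[in LHS](regular_scale1 (v : L)) linearZZ (trivial_act v ax bx).
have q1 : q 1 != 0.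
  apply/eqP => q1; have [_ [x [x0 _]] _ _] := S_socle_scalar k 0.
  have [_ _ qS] := sq; have [v vE] := qS x; move/eqP: x0; apply.
  by rewrite -vE qu q1 scaler0.
rewrite qu; split=> [cu|->]; last by rewrite rmorph0 scale0r.
by apply/eqP/negPn/negP => c0; move/eqP: q1; apply; exact: iota_neq0 c0 cu.
Qed.

(** From [n] to [n + 1], treat a syzygy of [X] and pass to cokernels; from [n] to [n - 1], treat a
    cosyzygy and pass to kernels. *)
Lemma approx_S (n : int) X : fin_gen X -> exists C,
  sadd (S_ k n * S_ k (n + 1))%type C /\ approx (S_ k n * S_ k (n + 1))%type X C.
Proof.
move: n X; apply: (int_ind_from (a := - 1)).
- move=> X Xf; have [j [q [s q0]]] := radical_ses; rewrite addNr.
  have [C [SC XC]] := approx_base s q0 Xf; exists C; split=> //.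
  by apply/addin_sadd/(thru_trans SC)/addin_snd.
- move=> n IH X Xf.
  have [m1 [i1 [p1 s1]]] := S_ses k (n + 1); have [m2 [i2 [p2 s2]]] := S_ses k (n + 1 + 1).
  rewrite addrK in i1 s1; rewrite addrK in i2 s2.
  have [j [q sT]] := ses_pair s1 s2.
  have FP : projective ({ffun 'I_m1 -> L1} * {ffun 'I_m2 -> L1})%type.
    by apply/projectiveP/addin_pair; exact/projectiveP/projective_free.
  have [m [K [i [p s]]]] := ses_free Xf; have [iI _ _] := s.
  have Kf : fin_gen K.
    by apply: fin_gen_sub_ext iI _; exact/fin_gen_ffun/fin_gen_regular.
  have [C' [TC' KC']] := IH K Kf.
  have C'f : fin_gen C'.
    by apply: fin_gen_sadd TC' _; apply: fin_gen_pair; exact: S_fin_gen.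
  have [l [e eI]] := ext_embedding C'f; have [C [c sC]] := ses_coker eI.
  exists C; split.
    exact: sadd_cosyzygy sC sT (projective_free _ _) FP TC'.
  exact: approx_cosyzygy sT s sC FP (projective_free _ _) (projective_free _ _) KC'.
- move=> n IH X Xf.
  have [m1 [i1 [p1 s1]]] := S_ses k n; have [m2 [i2 [p2 s2]]] := S_ses k (n + 1).
  rewrite subrK; rewrite addrK in i2 s2.
  have [j [q sT]] := ses_pair s1 s2.
  have FP : projective ({ffun 'I_m1 -> L1} * {ffun 'I_m2 -> L1})%type.
    by apply/projectiveP/addin_pair; exact/projectiveP/projective_free.
  have [m [i iI]] := ext_embedding Xf; have [Y [p s]] := ses_coker iI.
  have Yf : fin_gen Y.
    have [_ _ pS] := s; apply: fin_gen_surj pS _.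
    exact/fin_gen_ffun/fin_gen_regular.
  have [C [TC YC]] := IH Y Yf.
  have Cf : fin_gen C.
    by apply: fin_gen_sadd TC _; apply: fin_gen_pair; exact: S_fin_gen.
  have [l [C' [e [c sC]]]] := ses_free Cf.
  exists C'; split.
    exact: sadd_syzygy sC sT (projective_free _ _) FP TC.
  exact: approx_syzygy sT s sC FP (projective_free _ _) (projective_free _ _) YC.
Qed.

Lemma approx_S_next (n : int) : exists X, fin_gen X /\ approx (S_ k n) X (S_ k (n + 1)).
Proof.
move: n; apply: (int_ind_from (a := - 1)).
- have [j [q [s q0]]] := radical_ses; have [jI jq _] := s.
  have [t [u tu]] := S_neg_coord k 1; have [t' [u' tu']] := S_neg_coord k 0.
  have [[tD tZ _] _ tu_surj] := tu.
  (* [p] maps the radical to the simple module by reading one of the two top coordinates. *)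
  have [|p pE] := neg_map (f := fun (x : S_ k (- 1)) i => if i == 0%N then t x 0%N else 0)
    (g := fun _ _ => 0) _ tu'.
    split=> [x y i|v x i|x i].
    + by rewrite (tD _ _ _).1 addr0; case: eqP; rewrite ?addr0.
    + by rewrite (tZ _ _ _).1 mulr0 ltn0 addr0; case: eqP; rewrite ?mulr0.
    + by split=> //; case: i.
  have pS : surjective p.
    move=> y; have [x xE] := tu_surj (t' y) (fun=> 0); exists x.
    have [[_ _ t0'] ext' _] := tu'; apply: ext' => i.
      rewrite (pE x).1; case: eqP => [->|/eqP]; first by rewrite (xE 0%N).1.
      by rewrite -lt0n => i0; rewrite (t0' y i).1.
    by rewrite (pE x).2 (t0' y i).2.
  have [X [i si]] := ses_ker pS; have [iI _ _] := si.
  exists X; split; first exact: fin_gen_sub_ext iI (S_fin_gen _ _).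
  rewrite addNr; exists (S_ k (- 1)), i, p; split=> //.
    exact/addin_sadd/addin_refl.
  (* Composed with [j], the map [h] extends to [S_(-1) -> L]; since [alpha beta] kills [S_(-1)], the
     extension stays in the radical. *)
  move=> h; have [g gE] := ext_selfinjective (j \o h : {linear _ -> _}) (addin_refl L1) iI (S_fin_gen _ _).
  have [|g' g'E] := factor_inj (f := g) jI.
    by move=> x; apply/jq/q0; exact: S_annihilator.
  by exists g' => x; apply: jI; rewrite g'E gE.
- move=> n [X [Xf XS]].
  have [m1 [i1 [p1 s1]]] := S_ses k (n + 1); have [m2 [i2 [p2 s2]]] := S_ses k (n + 1 + 1).
  rewrite addrK in i1 s1; rewrite addrK in i2 s2.
  have [m [i iI]] := ext_embedding Xf; have [Y [p s]] := ses_coker iI.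
  exists Y; split.
    have [_ _ pS] := s; apply: fin_gen_surj pS _.
    exact/fin_gen_ffun/fin_gen_regular.
  exact: approx_cosyzygy s1 s s2 (projective_free _ _) (projective_free _ _) (projective_free _ _) XS.
- move=> n [X [Xf XS]].
  have [m1 [i1 [p1 s1]]] := S_ses k n; have [m2 [i2 [p2 s2]]] := S_ses k (n + 1).
  rewrite addrK in i2 s2.
  have [m [K [i [p s]]]] := ses_free Xf; have [iI _ _] := s.
  exists K; rewrite subrK; split.
    by apply: fin_gen_sub_ext iI _; exact/fin_gen_ffun/fin_gen_regular.
  exact: approx_syzygy s1 s s2 (projective_free _ _) (projective_free _ _) (projective_free _ _) XS.
Qed.

End ApproxS.

(** * Global dimensions of endomorphism rings *)

Section Main.
Variable k : fieldType.
Local Notation L := (ext_alg k).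
Local Notation L1 := (L^o : lmodType L).
Local Notation iota := (GRing.in_alg L : {rmorphism k -> L}).
Implicit Types X Y Z M N Q T C : lmodType L.

Lemma M_fin_gen (n : int) : fin_gen (M_ k n).
Proof.
by apply: fin_gen_pair (fin_gen_regular _) (fin_gen_pair _ _); exact: S_fin_gen.
Qed.

Lemma gldim_M_le (n : int) : (gldim (lin_end (M_ k n)) <= 3%:R%:E)%E.
Proof.
have Mf := M_fin_gen n.
apply: gldim_end_le => // [X Y j jI Xf|X Xf]; first exact: fin_gen_sub_end Mf jI Xf.
have [C [TC [Q [i [p [s TQ iT]]]]]] := approx_S n Xf.
have ML : addin (M_ k n) L1 by exact: addin_fst.
have MT : addin (M_ k n) (S_ k n * S_ k (n + 1))%type by exact: addin_snd.
apply: (pdle1_hom s); [exact: sadd_addin TQ MT ML|exact: sadd_addin TC MT ML|move=> f].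
have [iI _ _] := s.
have Qf : fin_gen Q.
  by apply: fin_gen_sadd TQ _; apply: fin_gen_pair; exact: S_fin_gen.
have [g1 g1E] := ext_selfinjective
  ((fst : {linear (L1 * (S_ k n * S_ k (n + 1)))%type -> L1}) \o f : {linear _ -> _})
  (addin_refl L1) iI Qf.
have [g2 g2E] := iT
  ((snd : {linear (L1 * (S_ k n * S_ k (n + 1)))%type -> (S_ k n * S_ k (n + 1))%type}) \o f
    : {linear _ -> _}).
have [g gE] := pair_lin g1 g2; exists g => x.
by rewrite gE g1E g2E /=; case: (f x).
Qed.

Lemma cogenerator_of_regular M C (c : C) : addin M L1 -> fin_gen C -> c != 0 ->
  exists g : {linear C -> M}, g c != 0.
Proof.
move=> [I [u [v uv]]] Cf c0; have [h hc] := ext_cogenerator Cf c0.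
suff [i ui] : exists i, u i (h c) != 0 by exists (u i \o h).
apply: contrapT => u0; move/eqP: hc; apply; rewrite [LHS]uv big1 // => i _.
have -> : u i (h c) = 0 by apply/eqP/negPn/negP => ui; apply: u0; exists i.
exact: raddf0.
Qed.

Lemma regular_indecomposable : indecomposable L1.
Proof.
have Ll := regular_socle_scalar k; split.
  by have [_ [x [x0 _]] _ _] := Ll => z; move: x0; rewrite (z x) eqxx.
move=> X Y [f [g fK gK]].
have [f' [f'f ff']] := linear_bij (can_inj fK) (bij_surj (Bijective fK gK)).
have [i iE] := pair_lin (idfun : {linear X -> X}) (\0 : {linear X -> Y}).
have [j jE] := pair_lin (\0 : {linear Y -> X}) (idfun : {linear Y -> Y}).
have [|b [h [_ hK]]] := socle_scalar_sum
  (h := fun b : bool => if b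
    then (f' \o i \o (fst : {linear (X * Y)%type -> X}) \o f : {linear L1 -> L1})
    else (f' \o j \o (snd : {linear (X * Y)%type -> Y}) \o f : {linear L1 -> L1})) Ll.
  move=> x; rewrite big_bool /= -linearD -[LHS]f'f; congr (f' _).
  by rewrite iE jE; case: (f x) => a b; congr pair; rewrite /= ?addr0 ?add0r.
case: b hK => hK; [right=> y|left=> x].
  have := hK (f' (0, y)) => /(congr1 f) /=.
  by rewrite !ff' iE => -[_ <-].
have := hK (f' (x, 0)) => /(congr1 f) /=.
by rewrite !ff' jE => -[<-].
Qed.

Lemma pdle_hom_ext d M X : fin_gen M -> addin M L1 -> fin_gen X ->
  (forall Y : lmodType (lin_end M), fin_gen Y -> pdle d.+2 Y) -> pdle d (lin_hom M X).
Proof. by move=> Mf; apply: pdle_hom => U V j; exact: fin_gen_sub_ext. Qed.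

Lemma hom_projective_ext M X : fin_gen M -> addin M L1 -> fin_gen X ->
  projective (lin_hom M X) -> addin M X.
Proof.
move=> Mf ML Xf; apply: hom_projective_addin => // C c.
exact: cogenerator_of_regular.
Qed.

Lemma gldim_generator_cogenerator_ge M :
  generator_cogenerator M -> (3%:R%:E <= gldim (lin_end M))%E.
Proof.
move=> [Mf Mproj _]; rewrite leNgt; apply/negP => /gldim_lt M3.
have ML : addin M L1.
  apply/addinP/Mproj; last exact: regular_indecomposable.
  exact/projectiveP/addin_refl.
(* [N] elements span [M] over [k], so [S_N], of dimension [2N + 1], is too large to be a summand. *)
have [N [g gP]] := fin_gen_restr (ext_fin k) Mf.
have MS : addin M (S_ k N).
  apply: hom_projective_ext => //; first exact: S_fin_gen.
  by apply: (@pdle_hom_ext 0) => //; exact: S_fin_gen.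
have [u [v uK]] := retract_addin (S_socle_scalar k N) MS.
have := S_dim_le (can_inj uK) gP; rewrite absz_nat addnS.
by rewrite ltnNge leq_addr.
Qed.

(** [Hom(X, M)] is a second syzygy, hence of projective dimension at most 1. In the exact sequence
    obtained from [i] and [p], the kernel [Hom(C, M)] is therefore projective. *)
Lemma gldim_le_addin M X Q C (i : {linear X -> Q}) (p : {linear Q -> C}) :
  fin_gen M -> addin M L1 -> (gldim (lin_end M) <= 3%:R%:E)%E ->
  fin_gen X -> ses i p -> addin M Q ->
  (forall f : {linear X -> M}, exists g : {linear Q -> M}, forall x, g (i x) = f x) ->
  addin M C.
Proof.
move=> Mf ML /gldim_le M3 Xf s MQ iM; have [_ _ pS] := s.
have Cf : fin_gen C := fin_gen_surj pS (fin_gen_addin MQ Mf).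
apply: hom_projective_ext => //.
have [i' i'E] := precomp_lin M i; have [p' p'E] := precomp_lin M p.
have [p'I p'i'] := hom_ses s i'E p'E.
have s' : ses p' i'.
  split=> // f; have [g gE] := iM f.
  by exists g; apply: lin_hom_eq => x; rewrite i'E gE.
apply: (pdle_syzygy (d := 0) s' (hom_projective MQ)).
exact: pdle_hom_ext.
Qed.

Lemma extend_thru T Y X Q (i : {linear X -> Q}) :
  addin (L1 * T)%type Y -> injective i -> fin_gen Q ->
  (forall f : {linear X -> T}, exists g : {linear Q -> T}, forall x, g (i x) = f x) ->
  forall f : {linear X -> Y}, exists g : {linear Q -> Y}, forall x, g (i x) = f x.
Proof.
move=> [I [u [v uv]]] iI Qf iT f.
have ext (h : {linear X -> (L1 * T)%type}) :
    exists g : {linear Q -> (L1 * T)%type}, forall x, g (i x) = h x.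
  have [g1 g1E] := ext_selfinjective
    ((fst : {linear (L1 * T)%type -> L1}) \o h : {linear _ -> _}) (addin_refl L1) iI Qf.
  have [g2 g2E] := iT ((snd : {linear (L1 * T)%type -> T}) \o h : {linear _ -> _}).
  have [g gE] := pair_lin g1 g2; exists g => x.
  by rewrite gE g1E g2E /=; case: (h x).
have [w wE] := choice (fun l => ext (u l \o f : {linear _ -> _})).
have [g gE] := sum_lin w v; exists g => x.
by rewrite gE [RHS]uv; apply: eq_bigr => l _; rewrite wE.
Qed.

Lemma S_retract_neq (n m : int) : absz n != absz m -> ~ retract (S_ k n) (S_ k m).
Proof. by move=> nm /S_retract_dim mn; rewrite mn eqxx in nm. Qed.

Lemma absz_succ_neq (n : int) : absz n != absz (n + 1).
Proof.
case: n => n.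
  by rewrite (_ : n%:Z + 1 = n.+1) ?neq_ltn ?ltnSn // intS addrC.
rewrite NegzE (_ : - n.+1%:Z + 1 = - n%:Z); last by rewrite intS opprD addrAC addNr add0r.
by rewrite !abszN neq_ltn ltnSn orbT.
Qed.

(** A bound by 3 would put [S_(n+1)] into [add Q], hence into [add (L (+) S_n)]. If [S_n] is a
    summand of [Q], this comes from [approx_S_next]; otherwise [Q] is injective and the embedding of
    [S_n] in a free module is already an approximation. *)
Lemma gldim_le_retract Q (n : int) : fin_gen Q -> addin Q L1 ->
  addin (L1 * S_ k n)%type Q -> ~ (gldim (lin_end Q) <= 3%:R%:E)%E.
Proof.
move=> Qf QL LSQ Q3; have Ll := regular_socle_scalar k.
have absurd m : absz m != absz n -> addin Q (S_ k m) -> False.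
  move=> mn QS; have := retract_addin (S_socle_scalar k m) (thru_trans QS LSQ).
  move/(retract_pair (S_socle_scalar k m)) => [].
    exact: (S_retract_regular k m).2.
  by apply: S_retract_neq; rewrite eq_sym.
have [QS|nQS] := pselect (retract Q (S_ k n)).
  have [X [Xf [Q0 [i [p [s TQ iT]]]]]] := approx_S_next k n.
  apply: (absurd (n + 1)); first by rewrite eq_sym absz_succ_neq.
  have [iI _ _] := s.
  apply: (gldim_le_addin Qf QL Q3 Xf s).
    exact: sadd_addin TQ (addin_of_retract QS) QL.
  apply: extend_thru LSQ iI _ iT.
  by apply: fin_gen_sadd TQ _; exact: S_fin_gen.
have LQ : addin L1 Q.
  apply: drop_addin (S_socle_scalar k n) nQS _.
  apply: thru_trans LSQ _; apply: addin_pair; [exact: addin_snd|exact: addin_fst].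
have [m [i [p s]]] := S_ses k (n + 1).
apply: (absurd (n + 1)); first by rewrite eq_sym absz_succ_neq.
have [iI _ _] := s; apply: (gldim_le_addin Qf QL Q3 _ s).
- exact: S_fin_gen.
- exact: thru_trans (addin_ffun _ _) QL.
move=> f; apply: (ext_selfinjective f LQ iI).
exact/fin_gen_ffun/fin_gen_regular.
Qed.

(** * Multiplicities of the summands of [M_n] *)

Definition complement M T M' : Prop :=
  exists (i : {linear T -> M}) (p : {linear M -> T}) (i' : {linear M' -> M})
    (p' : {linear M -> M'}), forall x, x = i (p x) + i' (p' x).

Lemma complement_fst X Y : complement (X * Y)%type X Y.
Proof.
have [i iE] := pair_lin (idfun : {linear X -> X}) (\0 : {linear X -> Y}).
have [j jE] := pair_lin (\0 : {linear Y -> X}) (idfun : {linear Y -> Y}).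
exists i, (fst : {linear (X * Y)%type -> X}), j, (snd : {linear (X * Y)%type -> Y}).
by move=> [x y]; rewrite iE jE; congr pair; rewrite /= ?addr0 ?add0r.
Qed.

Lemma complement_sym M X Y : complement M X Y -> complement M Y X.
Proof. by move=> [i [p [j [q e]]]]; exists j, q, i, p => x; rewrite addrC. Qed.

Lemma complement_pair X Y T T' :
  complement Y T T' -> complement (X * Y)%type T (X * T')%type.
Proof.
move=> [i [p [j [q e]]]].
have [i1 i1E] := pair_lin (\0 : {linear T -> X}) i.
have [j1 j1E] := pair_lin (fst : {linear (X * T')%type -> X})
  (j \o (snd : {linear (X * T')%type -> T'}) : {linear _ -> _}).
have [q1 q1E] := pair_lin (fst : {linear (X * Y)%type -> X})
  (q \o (snd : {linear (X * Y)%type -> Y}) : {linear _ -> _}).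
exists i1, (p \o (snd : {linear (X * Y)%type -> Y})), j1, q1 => -[x y].
by rewrite i1E j1E q1E; congr pair; rewrite /= ?add0r -?e.
Qed.

(** Here [simple] refers to multiplicity one, not to simple modules: [T] occurs in [M] and not in a
    complement. *)
Definition simple_summand M T : Prop :=
  socle_scalar T /\ exists M', complement M T M' /\ ~ retract M' T.

Lemma simple_summand_double M T (u u' : {linear T -> M}) (v v' : {linear M -> T}) :
  simple_summand M T -> cancel u v -> cancel u' v' -> (forall x, v (u' x) = 0) -> False.
Proof.
move=> [Tl [M' [[i [p [i' [p' e]]]] nT]]] uK u'K vu'.
exact: no_double Tl nT e uK u'K vu'.
Qed.

Lemma M_simple_summand (n : int) :
  [/\ simple_summand (M_ k n) L1, simple_summand (M_ k n) (S_ k n)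
    & simple_summand (M_ k n) (S_ k (n + 1))].
Proof.
have Ll := regular_socle_scalar k; have Sl := S_socle_scalar k.
have nn := absz_succ_neq n.
split; split=> //.
- exists (S_ k n * S_ k (n + 1))%type; split; first exact: complement_fst.
  by move=> /(retract_pair Ll) [] /(S_retract_regular _ _).1.
- exists (L1 * S_ k (n + 1))%type; split; first exact/complement_pair/complement_fst.
  move=> /(retract_pair (Sl n)) [/(S_retract_regular _ _).2//|].
  by apply: S_retract_neq; rewrite eq_sym.
- exists (L1 * S_ k n)%type; split; first exact/complement_pair/complement_sym/complement_fst.
  move=> /(retract_pair (Sl (n + 1))) [/(S_retract_regular _ _).2//|].
  exact: S_retract_neq.
Qed.

Lemma M_summand_retract (n : int) X : addin (M_ k n) X -> ~ zero_module X ->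
  exists T, simple_summand (M_ k n) T /\ retract X T.
Proof.
move=> MX nX; have [ML MS MS'] := M_simple_summand n.
apply: contrapT => nT.
have noT T : simple_summand (M_ k n) T -> ~ retract X T.
  by move=> MT XT; apply: nT; exists T.
apply/nX/(drop_all MS'.1 (noT _ MS')).
apply: (drop_addin MS.1 (noT _ MS)); exact: (drop_addin ML.1 (noT _ ML)).
Qed.

Lemma M_basic (n : int) : basic (M_ k n).
Proof.
move=> X Y Z [f [g fK gK]] [nX _] _ [h [h' hK h'K]].
have [f' [f'f ff']] := linear_bij (can_inj fK) (bij_surj (Bijective fK gK)).
have [l [lh hl]] := linear_bij (can_inj hK) (bij_surj (Bijective hK h'K)).
have [i iE] := pair_lin (idfun : {linear X -> X}) (\0 : {linear X -> (Y * Z)%type}).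
have [j0 j0E] := pair_lin (idfun : {linear Y -> Y}) (\0 : {linear Y -> Z}).
have [j jE] := pair_lin (\0 : {linear Y -> X}) j0.
pose pX : {linear M_ k n -> X} := (fst : {linear (X * (Y * Z))%type -> X}) \o f.
pose pY : {linear M_ k n -> Y} :=
  (fst : {linear (Y * Z)%type -> Y}) \o (snd : {linear (X * (Y * Z))%type -> (Y * Z)%type}) \o f.
have iK : cancel (f' \o i) pX by move=> x; rewrite /pX /= ff' iE.
have [T [MT [u [v uK]]]] := M_summand_retract (addin_retract iK) nX.
(* The summand [T] of [X] is transported to [Y] by [h], giving a second copy of [T] in [M_n]. *)
apply: (@simple_summand_double _ _ (f' \o i \o u) (f' \o j \o h \o u)
  (v \o pX) (v \o l \o pY) MT) => x; rewrite /pX /pY /= ff' ?iE ?jE ?j0E /= ?uK //.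
  by rewrite lh uK.
by rewrite raddf0.
Qed.

Lemma repdim_ext : repdim L = 3%:R%:E.
Proof.
apply/eqP; rewrite eq_le; apply/andP; split.
  apply: le_trans (gldim_M_le 0); apply: ereal_inf_lbound.
  exists (M_ k 0); split=> //; apply: ext_generator_cogenerator (M_fin_gen 0) _.
  exact: addin_fst.
by apply: le_ereal_inf_tmp => _ [M [Mgc ->]]; exact: gldim_generator_cogenerator_ge.
Qed.

Lemma M_generator_cogenerator (n : int) : generator_cogenerator (M_ k n).
Proof. by apply: ext_generator_cogenerator (M_fin_gen n) _; exact: addin_fst. Qed.

Lemma M_Auslander (n : int) : Auslander_generator (M_ k n).
Proof.
split; [exact: M_generator_cogenerator|exact: M_basic|].
rewrite repdim_ext; apply/eqP; rewrite eq_le gldim_M_le.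
exact/gldim_generator_cogenerator_ge/M_generator_cogenerator.
Qed.

Lemma M_minimal (n : int) N Q (i : {linear N -> M_ k n}) (r : {linear M_ k n -> N})
    (p : {linear M_ k n -> Q}) :
  cancel i r -> exact_at i p -> surjective p -> ~ zero_module N ->
  (forall X, direct_summand X N -> projective X \/ injective_module X -> zero_module X) ->
  (gldim (lin_end (M_ k n)) < gldim (lin_end Q))%E.
Proof.
move=> iK ip pS nN Nproj; apply: le_lt_trans (gldim_M_le n) _; rewrite ltNge; apply/negP.
have [ML MS MS'] := M_simple_summand n.
(* [1 - i r] kills the image of [i] and descends to a section [q] of [p], so that [M_n] is the sum
   of [N] and [Q]. *)
have [d dE] := sub_lin idfun (i \o r : {linear _ -> _}).
have [|q qE] := factor_surj (f := d) pS.
  by move=> x /ip [y <-]; rewrite dE /= iK subrr.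
have idM x : x = i (r x) + q (p x) by rewrite qE dE /=; exact/esym/subrKC.
have pq : cancel q p.
  move=> y; have [x <-] := pS y; rewrite qE dE linearB /=.
  have -> : p (i (r x)) = 0 by apply/ip; exists (r x).
  by rewrite subr0.
have rq y : r (q y) = 0.
  by have [x <-] := pS y; rewrite qE dE linearB /= iK subrr.
(* A summand of multiplicity one cannot lie in both [N] and [Q]. *)
have excl T : simple_summand (M_ k n) T -> retract N T -> ~ retract Q T.
  move=> MT [u [v uK]] [u' [v' u'K]].
  apply: (@simple_summand_double _ _ (i \o u) (q \o u') (v \o r) (v' \o p) MT) => x /=.
  - by rewrite iK uK.
  - by rewrite pq u'K.
  - by rewrite rq raddf0.
have nNL : ~ retract N L1.
  move=> [u [v uK]].
  have L0 : zero_module L1.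
    apply: Nproj (retract_summand uK) _; left; exact/projectiveP/addin_refl.
  by have [_ [x [x0 _]] _ _] := regular_socle_scalar k; move: x0; rewrite (L0 x) eqxx.
have QL : addin Q L1.
  have [|//|] := retract_sum ML.1 idM _; last exact: addin_of_retract.
  exact: retract_addin ML.1 (addin_fst _ _).
have MQ : addin (M_ k n) Q := addin_retract pq.
have Qf : fin_gen Q := fin_gen_surj pS (M_fin_gen n).
have NM : addin (M_ k n) N := addin_retract iK.
(* Being nonzero without summand [L], the module [N] contains [S_n] or [S_(n+1)]. That one is then
   missing from [Q], which lies in [add] of [L] and the other one. *)
have [NS|nNS] := pselect (retract N (S_ k n)).
  apply: (@gldim_le_retract Q (n + 1)) => //.
  apply: drop_addin MS.1 (excl _ MS NS) (thru_trans MQ _).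
  have [a [b [c [e abce]]]] := complement_pair L1 (complement_fst (S_ k n) (S_ k (n + 1))).
  apply: thru_eq (thruD (thru_trans (thru1 b a) (addin_fst _ _))
    (thru_trans (thru1 e c) (addin_snd _ _))) _ => x.
  by rewrite [RHS]abce.
have [NS'|nNS'] := pselect (retract N (S_ k (n + 1))).
  apply: (@gldim_le_retract Q n) => //.
  apply: drop_addin MS'.1 (excl _ MS' NS') (thru_trans MQ _).
  have [a [b [c [e abce]]]] := complement_pair L1 (complement_sym (complement_fst (S_ k n) (S_ k (n + 1)))).
  apply: thru_eq (thruD (thru_trans (thru1 b a) (addin_fst _ _))
    (thru_trans (thru1 e c) (addin_snd _ _))) _ => x.
  by rewrite [RHS]abce.
exfalso; apply/nN/(drop_all MS'.1 nNS').
apply: (drop_addin MS.1 nNS); exact: (drop_addin ML.1 nNL).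
Qed.

End Main.

Theorem proposition2p1 (k : closedFieldType) (n : int) :
  minimal_Auslander_generator (M_ k n).
Proof. by split; [exact: M_Auslander|exact: M_minimal]. Qed.
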